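(* The iterated half-Hartley transform $\mathcal{H}_+^2=\mathcal{H}_+\mathcal{H}_+$ extends to a bounded invertible map $\mathcal{H}^2_+: L_2(\mathbb{R}_+)\to L_2(\mathbb{R}_+)$, and for every $f\in L_2(\mathbb{R}_+)$ the following reciprocal formulas hold for $x>0$: $$(\mathcal{H}^2_+ f)(x) = 2 f(x) + \frac{2}{\pi}\int_0^\infty \frac{f(t)}{x+t}\,dt,$$ $$f(x)= \frac12 (\mathcal{H}^2_+ f)(x) - \frac{1}{\pi^2}\int_0^\infty \frac{\sqrt{xt}\,[\log x-\log t]}{x^2-t^2}\,(\mathcal{H}^2_+ f)(t)\,dt.$$ Moreover, for every $f\in L_2(\mathbb{R}_+)$, $$\|f\|\le \|\mathcal{H}^2_+ f\|\le 8\,\|f\|.$$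
   Context: $\mathbb{R}_+=(0,\infty)$; $\|\cdot\|$ is the norm of $L_2(\mathbb{R}_+)$. The half-Hartley transform is $$(\mathcal{H}_+ f)(x)=\sqrt{\frac{2}{\pi}}\int_0^\infty[\cos(xt)+\sin(xt)]f(t)\,dt,\quad x>0.$$ The iterated transform $\mathcal{H}_+^2 f=\mathcal{H}_+(\mathcal{H}_+f)$ is initially defined on the dense subspace $C_c^{(2)}(\mathbb{R}_+)$ of twice continuously differentiable functions with compact support in $\mathbb{R}_+$; ''extends'' means by continuity to all of $L_2(\mathbb{R}_+)$. Equalities between $L_2$ functions are understood almost everywhere. *)

(* Defs.v *)
From HB Require Import structures.
From mathcomp Require Import all_boot all_order all_algebra.
From mathcomp Require Import all_classical all_reals all_analysis.
From mathcomp Require Import complex.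

Set Implicit Arguments.
Unset Strict Implicit.
Unset Printing Implicit Defensive.

Import Order.TTheory GRing.Theory Num.Theory.
Import numFieldNormedType.Exports.

Local Open Scope classical_set_scope.
Local Open Scope ring_scope.
Local Open Scope complex_scope.

(* The elements of L_2(R_+) are complex-valued.  They are represented by
   functions R -> R[i] of which only the values on R_+ are significant, and
   they are compared almost everywhere on R_+.  Since R[i] carries no measure
   or derivative theory over R, measurability, integrals and differentiability
   are taken separately in the real and imaginary parts. *)

Definition Rplus {R : realType} : set R := `]0, +oo[.

Definition cmeasurable {R : realType} (f : R -> R[i]) : Prop :=
  measurable_fun (@Rplus R) (fun t => complex.Re (f t)) /\
  measurable_fun (@Rplus R) (fun t => complex.Im (f t)).

Definition cintegrable {R : realType} (f : R -> R[i]) : Prop :=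
  (@lebesgue_measure R).-integrable Rplus (fun t => (complex.Re (f t))%:E) /\
  (@lebesgue_measure R).-integrable Rplus (fun t => (complex.Im (f t))%:E).

Definition cintegral {R : realType} (f : R -> R[i]) : R[i] :=
  (\int[@lebesgue_measure R]_(t in Rplus) complex.Re (f t)) +i*
  (\int[@lebesgue_measure R]_(t in Rplus) complex.Im (f t)).

Definition ae_eq_Rplus {R : realType} (f g : R -> R[i]) : Prop :=
  f = g %[ae @lebesgue_measure R in Rplus].

Definition L2norm {R : realType} (f : R -> R[i]) : \bar R :=
  ('N[@lebesgue_measure R]_2%:E[(fun x => (Normc.normc (f x))%:E) \_ Rplus])%E.

Definition L2 {R : realType} (f : R -> R[i]) : Prop :=
  cmeasurable f /\ (L2norm f < +oo)%E.

Definition C2_Rplus {R : realType} (g : R -> R) : Prop :=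
  forall x : R, 0 < x ->
    [/\ derivable g x 1, derivable (derive1 g) x 1 &
      {for x, continuous (derive1n 2 g)}].

Definition Cc2 {R : realType} (f : R -> R[i]) : Prop :=
  [/\ C2_Rplus (fun x => complex.Re (f x)), C2_Rplus (fun x => complex.Im (f x)) &
    exists K : set R, [/\ compact K, K `<=` Rplus &
      forall x, Rplus x -> ~ K x -> f x = 0]].

Definition hartley_integrand {R : realType} (f : R -> R[i]) (x t : R) : R[i] :=
  (cos (x * t) + sin (x * t))%:C * f t.

Definition half_hartley {R : realType} (f : R -> R[i]) (x : R) : R[i] :=
  (Num.sqrt (2 / pi))%:C * cintegral (hartley_integrand f x).

Definition hartley_defined {R : realType} (f : R -> R[i]) : Prop :=
  forall x : R, 0 < x -> cintegrable (hartley_integrand f x).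

(* A bounded linear operator on L_2(R_+), given on representatives: the second
   clause makes it act on classes of almost everywhere equal functions. *)
Definition L2_bounded_linear {R : realType}
    (T : (R -> R[i]) -> (R -> R[i])) : Prop :=
  [/\ forall f, L2 f -> L2 (T f),
      forall f g, L2 f -> L2 g -> ae_eq_Rplus f g -> ae_eq_Rplus (T f) (T g),
      forall (a : R[i]) f g, L2 f -> L2 g ->
        ae_eq_Rplus (T (fun x => a * f x + g x)) (fun x => a * T f x + T g x) &
      exists M : R, forall f, L2 f -> (L2norm (T f) <= M%:E * L2norm f)%E].

Definition L2_invertible {R : realType}
    (T : (R -> R[i]) -> (R -> R[i])) : Prop :=
  exists S : (R -> R[i]) -> (R -> R[i]),
    L2_bounded_linear S /\
    forall f, L2 f -> ae_eq_Rplus (S (T f)) f /\ ae_eq_Rplus (T (S f)) f.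

Definition extends_half_hartley2 {R : realType}
    (T : (R -> R[i]) -> (R -> R[i])) : Prop :=
  L2_bounded_linear T /\
  forall f, Cc2 f -> ae_eq_Rplus (T f) (half_hartley (half_hartley f)).

Definition stieltjes_integrand {R : realType}
    (f : R -> R[i]) (x t : R) : R[i] :=
  ((x + t)^-1)%:C * f t.

(* At t = x the quotient is 0 / 0 = 0; this single point does not affect the
   integral. *)
Definition log_integrand {R : realType} (f : R -> R[i]) (x t : R) : R[i] :=
  (Num.sqrt (x * t) * (ln x - ln t) / (x ^+ 2 - t ^+ 2))%:C * f t.

(* Main.v *)
Require Import Defs.
From mathcomp Require Import all_boot all_order all_algebra.
From mathcomp Require Import all_classical all_reals all_analysis.
From mathcomp Require Import measurable_realfun complex.
From mathcomp Require Import ring lra.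
Import Order.TTheory GRing.Theory Num.Theory.
Import numFieldNormedType.Exports.
Local Open Scope classical_set_scope.
Local Open Scope ring_scope.

Set Implicit Arguments.
Unset Strict Implicit.
Unset Printing Implicit Defensive.

(** Let S, B and K be the integral operators on the half-line with the
    symmetric kernels 1 / (x + t), sqrt (x t) / (x^2 + t^2) and
    sqrt (x t) (ln x - ln t) / (x^2 - t^2), and write cas y = cos y + sin y.

    The iterated transform.  The product formula
      cas (x s) cas (s t) = cos ((x - t) s) + sin ((x + t) s),
    integrated over s > 0, formally gives pi delta (x - t) + 1 / (x + t), so
    that the iterated transform is 2 + (2 / pi) S.  The formal computation
    becomes a limit after damping by exp (- e s): the two terms turn into the
    Poisson kernel e / (e^2 + (x - t)^2) and its conjugate
    (x + t) / (e^2 + (x + t)^2) ([has_integral_damped_cas]).  For a C^2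
    function f with compact support, two integrations by parts show that the
    transform of f is O (1 / (1 + s^2)) ([hartley_decay]).  Hence it is
    integrable, which permits e -> 0 ([hartley_hartley]).

    The inverse.  The multiplicative convolution operators S, B and K are
    diagonalised together by the Mellin transform, with symbols pi / cosh (pi u),
    pi / (2 cosh (pi u / 2)) and pi^2 / (4 cosh (pi u / 2)^2), so that K = B B
    and S K = K S = (pi^2 / 2) S - pi K.  This last identity says exactly that
    1 / 2 - K / pi^2 inverts 2 + (2 / pi) S.  It is proved here without Mellin
    transforms: with Q (x, t) = (x + t) / (x^2 + t^2), partial fractions in s
    reduce the compositions
      S B = (pi / sqrt 2) Q - pi B   and   Q B = (pi / sqrt 2) S
    to the integrals of sqrt s / (s^2 + v^2), 1 / (sqrt s (s^2 + v^2)) and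
    1 / ((x + s) sqrt s), and multiplying the first by B on the right gives the
    identity ([has_integral_stieltjes_log]).

    Boundedness.  By the Schur test with weight t^(-1/2) ([energy_kint]) the
    norms of S, B and K are at most pi, pi / 2 and (pi / 2)^2.  Together with
    (p + q)^2 <= 2 p^2 + 2 q^2 this bounds the square of the norm of
    2 + (2 / pi) S by 16 and that of its inverse by 5 / 8 <= 1.

    Extension.  The formula 2 + (2 / pi) S defines a bounded operator that
    agrees with the iterated transform on C^2 functions of compact support.
    These are dense (three Steklov averages of a truncation,
    [C2_csupp_dense]), so no other bounded extension exists.

    All operators have real kernels, so they act separately on real and
    imaginary parts; the last two parts transfer the statements about real
    functions, measured by the energy (the square of the norm), to L_2. *)

(** * Integrals over the half-line *)

Section HalfLine.
Context {R : realType}.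
Notation mu := (@lebesgue_measure R).
Notation Rp := (@Rplus R).

Lemma RplusE (x : R) : Rp x = (0 < x) :> Prop.
Proof. by rewrite /Rplus/= in_itv/= andbT. Qed.

Lemma measurable_Rplus : measurable Rp.
Proof. exact: measurable_itv. Qed.

Lemma measurable_invr (D : set R) : measurable_fun D (@GRing.inv R).
Proof.
apply: measurable_funTS.
have -> : @GRing.inv R = (fun x : R => x * (x ^+ 2) `^ (-1)).
  apply/funext => x; rewrite powR_inv1 ?sqr_ge0//.
  have [->|x0] := eqVneq x 0; first by rewrite invr0 mul0r.
  by field.
apply: measurable_funM => //.
by apply: (measurableT_comp (measurable_powR _)) => //; exact: measurable_funX.
Qed.

Lemma measurable_sqrtr (D : set R) : measurable_fun D (@Num.sqrt R).
Proof.
by apply: measurable_funTS; apply: continuous_measurable_fun; exact: sqrt_continuous.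
Qed.

Lemma bigcup_itv_Rplus : \bigcup_n `[(n.+2%:R : R)^-1, n.+2%:R]%classic = Rp.
Proof.
apply/seteqP; split=> [x [n _]|x].
  by rewrite RplusE/= in_itv/= => /andP[/(lt_le_trans _)-> //]; rewrite invr_gt0.
rewrite RplusE => x0.
have [n nx] : exists n, (x + x^-1 <= n%:R)%R.
  exists (Num.bound (x + x^-1)); apply/ltW/archi_boundP.
  by rewrite addr_ge0 ?invr_ge0// ltW.
have xi : 0 < x^-1 by rewrite invr_gt0.
have nn : n%:R <= n.+2%:R :> R by rewrite ler_nat -addn2 leq_addr.
exists n => //=; rewrite in_itv/=; apply/andP; split; last by lra.
by rewrite -[leRHS]invrK lef_pV2 ?posrE ?ltr0n//; lra.
Qed.

(** The fundamental theorem of calculus holds on each [1/n, n]; monotone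
    convergence then takes care of both ends at once, whether or not F and f
    extend continuously to 0. *)
Lemma ge0_FTC_Rplus (F f : R -> R) (l0 l r : R) :
  (forall x, 0 < x -> 0 <= f x) ->
  (forall x, 0 < x -> {for x, continuous f}) ->
  (forall x : R, 0 < x -> is_derive x 1 F (f x)) ->
  F x @[x --> 0^'+] --> l0 -> F x @[x --> +oo] --> l ->
  l - l0 = r -> (\int[mu]_(x in Rp) (f x)%:E = r%:E)%E.
Proof.
move=> f0 fc Ff F0 Fl <-.
pose I (n : nat) : set R := `[(n.+2%:R : R)^-1, n.+2%:R]%classic.
have Ipos n x : I n x -> 0 < x.
  by rewrite /I/= in_itv/= => /andP[/(lt_le_trans _)-> //]; rewrite invr_gt0.
have n1 n : (n.+2%:R : R)^-1 < n.+2%:R.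
  by rewrite (@lt_trans _ _ 1)// ?invf_lt1// ?ltr1n.
have Fc x : 0 < x -> {for x, continuous F}.
  by move=> x0; apply: differentiable_continuous; apply/derivable1_diffP; have [] := Ff _ x0.
have fcI n : {within I n, continuous f}.
  by apply: continuous_in_subspaceT => x /set_mem/Ipos /fc.
have step n : (\int[mu]_(x in I n) (f x)%:E = (F n.+2%:R)%:E - (F (n.+2%:R)^-1)%:E)%E.
  apply: (continuous_FTC2 (n1 n) (fcI n)).
  - split.
    + move=> x; rewrite in_itv/= => /andP[x1 x2].
      have x0 : 0 < x by rewrite (lt_trans _ x1)// invr_gt0.
      by have [] := Ff x x0.
    + by apply: cvg_at_right_filter; apply: Fc; rewrite invr_gt0.
    + by apply: cvg_at_left_filter; apply: Fc.
  - move=> x; rewrite in_itv/= => /andP[x1 x2].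
    have x0 : 0 < x by rewrite (lt_trans _ x1)// invr_gt0.
    by rewrite derive1E; apply: derive_val; exact: Ff.
have ndI : {homo I : n m / (n <= m)%N >-> (n <= m)%O}.
  move=> n m nm; apply/subsetPset => x; rewrite /I/= !in_itv/= => /andP[x1 x2].
  have nm2 : n.+2%:R <= m.+2%:R :> R by rewrite ler_nat.
  by rewrite (le_trans x2 nm2) andbT (le_trans _ x1)// lef_pV2 ?posrE ?ltr0n.
have h : (\int[mu]_(x in I i) (f x)%:E @[i --> \oo] --> \int[mu]_(x in Rp) (f x)%:E)%E.
  rewrite -bigcup_itv_Rplus; apply: ge0_nondecreasing_set_cvg_integral => //.
  - by move=> i; exact: measurable_itv.
  - move=> i; apply/measurable_EFinP.
    by apply: subspace_continuous_measurable_fun => //; exact: measurable_itv.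
  - by move=> i x /Ipos /f0; rewrite lee_fin.
rewrite -(cvg_lim (@ereal_hausdorff R) h).
apply: cvg_lim => //=; under eq_fun do rewrite step -EFinB.
apply: cvg_EFin; first exact: nearW.
apply: cvgB.
- move/cvg_pinftyP : Fl; apply.
  apply/cvgryPge => A; near=> n.
  by rewrite (@le_trans _ _ n%:R)//; [near: n; exact: nbhs_infty_ger|rewrite ler_nat -addn2 leq_addr].
- move/cvg_at_rightP : F0; apply; split; first by move=> n; rewrite invr_gt0.
  by have := @cvg_harmonic R; rewrite -(cvg_shiftn 1); under eq_fun do rewrite addn1.
Unshelve. all: by end_near. Qed.

End HalfLine.

(** * Tonelli and Fubini on the quarter-plane *)

Section TonelliHalfLine.
Context {R : realType}.
Notation mu := (@lebesgue_measure R).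
Notation Rp := (@Rplus R).
Local Open Scope ereal_scope.
Implicit Type h : R * R -> \bar R.

Let mQ : measurable (Rp `*` Rp) := measurableX measurable_Rplus measurable_Rplus.

Lemma patch_quadrant h x y :
  (h \_ (Rp `*` Rp)) (x, y) =
  ((fun x => (fun y => h (x, y)) \_ Rp) \_ Rp) x y.
Proof.
rewrite !patchE; case: ifPn => [/set_mem[/= x0 y0]|/negP xy].
  by rewrite mem_set// patchE mem_set.
case: ifPn => // /set_mem x0; rewrite patchE; case: ifPn => // /set_mem y0.
by exfalso; apply: xy; exact: mem_set.
Qed.

Lemma integral_quadrant h x :
  \int[mu]_y (h \_ (Rp `*` Rp)) (x, y) =
  ((fun x => \int[mu]_(y in Rp) h (x, y)) \_ Rp) x.
Proof.
under eq_integral do rewrite patch_quadrant.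
rewrite !patchE; case: ifPn => _; last by rewrite integral0.
by rewrite [RHS]integral_mkcond.
Qed.

Lemma integral_quadrant_swap h y :
  \int[mu]_x (h \_ (Rp `*` Rp)) (x, y) =
  ((fun y => \int[mu]_(x in Rp) h (x, y)) \_ Rp) y.
Proof.
rewrite -(integral_quadrant (fun z => h (z.2, z.1))).
apply: eq_integral => x _; rewrite !patchE.
by congr (if _ then _ else _); apply/idP/idP; rewrite !inE => -[].
Qed.

Lemma tonelli_Rplus h : measurable_fun (Rp `*` Rp) h ->
  (forall x y, (0 < x)%R -> (0 < y)%R -> 0 <= h (x, y)) ->
  \int[mu]_(x in Rp) \int[mu]_(y in Rp) h (x, y) =
  \int[mu]_(y in Rp) \int[mu]_(x in Rp) h (x, y).
Proof.
move=> mh h0; pose g := h \_ (Rp `*` Rp).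
have mg : measurable_fun setT g by apply/(measurable_restrictT _ mQ).
have g0 z : 0 <= g z.
  rewrite /g patchE; case: ifPn => //; rewrite inE; case: z => x y [/=].
  by rewrite !RplusE; exact: h0.
have : \int[mu]_x \int[mu]_y g (x, y) = \int[mu]_y \int[mu]_x g (x, y).
  exact: fubini_tonelli.
under eq_integral do rewrite integral_quadrant.
rewrite -integral_mkcond => ->.
rewrite [RHS]integral_mkcond; apply: eq_integral => y _.
exact: integral_quadrant_swap.
Qed.

(** Positive and negative parts are treated separately, so h is allowed to
    have sections that are not integrable. *)
Lemma measurable_integral_Rplus h : measurable_fun (Rp `*` Rp) h ->
  measurable_fun Rp (fun x => \int[mu]_(y in Rp) h (x, y)).
Proof.
move=> mh; pose g := h \_ (Rp `*` Rp).
have mg : measurable_fun setT g by apply/(measurable_restrictT _ mQ).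
suff : measurable_fun setT (fun x => \int[mu]_y g (x, y)).
  rewrite (_ : (fun x => _) = (fun x => \int[mu]_(y in Rp) h (x, y)) \_ Rp).
    by move/(measurable_restrictT _ measurable_Rplus).2.
  by apply/funext => x; exact: integral_quadrant.
have -> : (fun x => \int[mu]_y g (x, y)) = fubini_F mu g^\+ \- fubini_F mu g^\-.
  apply/funext => x; rewrite integralE /fubini_F; congr (_ - _).
  - by apply: eq_integral => y _; rewrite !funeposE.
  - by apply: eq_integral => y _; rewrite !funenegE.
apply: emeasurable_funB.
- apply: measurable_fun_fubini_tonelli_F => //; exact: measurable_funepos.
- apply: measurable_fun_fubini_tonelli_F => //; exact: measurable_funeneg.
Qed.

Lemma fubini_Rplus h : measurable_fun (Rp `*` Rp) h ->
  \int[mu]_(x in Rp) \int[mu]_(y in Rp) `|h (x, y)| < +oo ->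
  \int[mu]_(x in Rp) \int[mu]_(y in Rp) h (x, y) =
  \int[mu]_(y in Rp) \int[mu]_(x in Rp) h (x, y).
Proof.
move=> mh hoo; pose g := h \_ (Rp `*` Rp).
have mg : measurable_fun setT g by apply/(measurable_restrictT _ mQ).
have ig : (mu \x mu).-integrable setT g.
  apply/(integrable12ltyP mu mu mg); apply: le_lt_trans hoo.
  rewrite [leRHS]integral_mkcond le_eqVlt; apply/orP; left; apply/eqP.
  apply: eq_integral => x _; rewrite -(integral_quadrant (abse \o h)).
  by apply: eq_integral => y _; rewrite /g !patchE; case: ifPn; rewrite ?abse0.
have : \int[mu]_x \int[mu]_y g (x, y) = \int[mu]_y \int[mu]_x g (x, y).
  exact: Fubini.
under eq_integral do rewrite integral_quadrant.
rewrite -integral_mkcond => ->.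
rewrite [RHS]integral_mkcond; apply: eq_integral => y _.
exact: integral_quadrant_swap.
Qed.

End TonelliHalfLine.

(** * Square-integrable functions *)

Section SquareIntegrable.
Context {R : realType}.
Notation mu := (@lebesgue_measure R).
Notation Rp := (@Rplus R).
Implicit Types (f g : R -> R) (x t : R).

(** The square of the norm. Working with squares keeps every estimate below
    an inequality between integrals of nonnegative functions. *)
Definition energy f : \bar R := (\int[mu]_(x in Rp) (f x ^+ 2)%:E)%E.

Definition sqint f := measurable_fun Rp f /\ (energy f < +oo)%E.

Lemma energy_ge0 f : (0 <= energy f)%E.
Proof. by apply: integral_ge0 => x _; rewrite lee_fin sqr_ge0. Qed.

Lemma eq_energy f g : (forall x, 0 < x -> f x ^+ 2 = g x ^+ 2) -> energy f = energy g.
Proof. by move=> fg; apply: eq_integral => x; rewrite inE RplusE => /fg ->. Qed.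

(** From (p + q)^2 <= 2 p^2 + 2 q^2: cruder than the triangle inequality for
    the norm, but sharp enough for all the constants below. *)
Lemma energy_lin (a b : R) f g : measurable_fun Rp f -> measurable_fun Rp g ->
  (energy (fun x => (a * f x + b * g x)%R) <=
   (2 * a ^+ 2)%:E * energy f + (2 * b ^+ 2)%:E * energy g)%E.
Proof.
move=> mf mg.
have m2 (c : R) (h : R -> R) : measurable_fun Rp h -> measurable_fun Rp (fun x => (c * h x ^+ 2)%:E).
  move=> mh; apply/measurable_EFinP; apply: measurable_funM => //.
  exact: measurable_funX.
have p2 (c : R) : (0 <= 2 * c ^+ 2)%R by rewrite mulr_ge0// sqr_ge0.
rewrite /energy -!ge0_integralZl_EFin//; try exact: measurable_Rplus;
  try by [move=> x _; rewrite lee_fin sqr_ge0|apply/measurable_EFinP/measurable_funX].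
rewrite -ge0_integralD//.
- apply: ge0_le_integral.
  + exact: measurable_Rplus.
  + by move=> x _; rewrite lee_fin sqr_ge0.
  + apply/measurable_EFinP/measurable_funX; apply: measurable_funD; exact: measurable_funM.
  + apply: emeasurable_funD; under eq_fun do rewrite -EFinM; exact: m2.
  + move=> x _; rewrite -!EFinM -EFinD lee_fin.
    by have := sqr_ge0 (a * f x - b * g x); nra.
- exact: measurable_Rplus.
- by move=> x _; rewrite -EFinM lee_fin mulr_ge0// sqr_ge0.
- by under eq_fun do rewrite -EFinM; exact: m2.
- by move=> x _; rewrite -EFinM lee_fin mulr_ge0// sqr_ge0.
- by under eq_fun do rewrite -EFinM; exact: m2.
Qed.

Lemma sqint_lin (a b : R) f g : sqint f -> sqint g ->
  sqint (fun x => a * f x + b * g x).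
Proof.
move=> [mf ef] [mg eg]; split; first by apply: measurable_funD; exact: measurable_funM.
apply: le_lt_trans (energy_lin a b mf mg) _.
have p2 (c : R) : (0 <= 2 * c ^+ 2)%R by rewrite mulr_ge0// sqr_ge0.
by apply: lte_add_pinfty; apply: lte_mul_pinfty => //; rewrite ?lee_fin.
Qed.

Lemma sqint_norm f : sqint f -> sqint (fun x => `|f x|).
Proof.
move=> [mf ef]; split; first exact: measurableT_comp.
by rewrite (@eq_energy _ f)// => x _; rewrite real_normK// num_real.
Qed.

Lemma ae_eq_energy f g : measurable_fun Rp f -> measurable_fun Rp g ->
  ae_eq mu Rp f g -> energy f = energy g.
Proof.
move=> mf mg fg; apply: ge0_ae_eq_integral => //.
- exact: measurable_Rplus.
- exact/measurable_EFinP/measurable_funX.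
- exact/measurable_EFinP/measurable_funX.
- by move=> x _; rewrite lee_fin sqr_ge0.
- by move=> x _; rewrite lee_fin sqr_ge0.
- by apply: filterS fg => x fg /fg ->.
Qed.

Lemma sqint_integrableM f g : sqint f -> sqint g ->
  mu.-integrable Rp (fun x => (f x * g x)%:E).
Proof.
move=> [mf ef] [mg eg].
have mfg : measurable_fun Rp (fun x => f x * g x) by exact: measurable_funM.
apply/integrableP; split; first exact/measurable_EFinP.
apply: (@le_lt_trans _ _ (energy f + energy g)%E); last exact: lte_add_pinfty.
rewrite /energy -ge0_integralD//.
- apply: ge0_le_integral => //.
  + exact: measurable_Rplus.
  + by apply: measurableT_comp => //; exact/measurable_EFinP.
  + by apply: emeasurable_funD; apply/measurable_EFinP/measurable_funX.
  + move=> x _; rewrite -EFinD abse_EFin lee_fin ler_norml.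
    have := sqr_ge0 (f x - g x); have := sqr_ge0 (f x + g x).
    by rewrite !expr2 => ? ?; apply/andP; split; nra.
- exact: measurable_Rplus.
- by move=> x _; rewrite lee_fin sqr_ge0.
- by apply/measurable_EFinP/measurable_funX.
- by move=> x _; rewrite lee_fin sqr_ge0.
- by apply/measurable_EFinP/measurable_funX.
Qed.

End SquareIntegrable.

(** * Integral operators and the Schur test *)

Section Schur.
Context {R : realType}.
Notation mu := (@lebesgue_measure R).
Notation Rp := (@Rplus R).
Implicit Types (f g : R -> R) (k : R -> R -> R) (x t C : R).

(** A nonnegative symmetric kernel that maps the weight t^(-1/2) to at most
    C times itself. This weight is the natural one for kernels that are
    homogeneous of degree -1. Square-integrability of the rows makes the
    operator defined at every point of the half-line, and not only almost
    everywhere. *)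
Record schur_kernel k C : Prop := SchurKernel {
  schur_meas : measurable_fun (Rp `*` Rp) (fun z : R * R => k z.1 z.2);
  schur_ge0 : forall x t, 0 < x -> 0 < t -> 0 <= k x t;
  schur_sym : forall x t, 0 < x -> 0 < t -> k x t = k t x;
  schur_cst : 0 < C;
  schur_bound : forall x, 0 < x ->
    (\int[mu]_(t in Rp) (k x t * (Num.sqrt t)^-1)%:E <= (C * (Num.sqrt x)^-1)%:E)%E;
  schur_row : forall x, 0 < x -> sqint (k x) }.

Definition kint k f x : R := \int[mu]_(t in Rp) (k x t * f t).

Lemma measurable_quadrant_fst f : measurable_fun Rp f ->
  measurable_fun (Rp `*` Rp) (fun z : R * R => f z.1).
Proof.
move=> mf; apply: (measurable_comp measurable_Rplus _ mf) => //.
- by move=> _ [[x y] [/= x0 y0] <-].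
- by apply: measurable_funTS; exact: measurable_fst.
Qed.

Lemma measurable_quadrant_snd f : measurable_fun Rp f ->
  measurable_fun (Rp `*` Rp) (fun z : R * R => f z.2).
Proof.
move=> mf; apply: (measurable_comp measurable_Rplus _ mf) => //.
- by move=> _ [[x y] [/= x0 y0] <-].
- by apply: measurable_funTS; exact: measurable_snd.
Qed.

Lemma measurable_quadrant_swap d (T : sigmaRingType d) (h : R * R -> T) :
  measurable_fun (Rp `*` Rp) h ->
  measurable_fun (Rp `*` Rp) (fun z : R * R => h (z.2, z.1)).
Proof.
have mQ : measurable (Rp `*` Rp) by apply: measurableX; exact: measurable_Rplus.
move=> mh; apply: (measurable_comp mQ _ mh).
- by move=> _ [[x y] [/= x0 y0] <-].
- apply: measurable_funTS; apply: measurable_fun_pair.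
  + exact: measurable_snd.
  + exact: measurable_fst.
Qed.

Lemma measurable_kint k f :
  measurable_fun (Rp `*` Rp) (fun z : R * R => k z.1 z.2) ->
  measurable_fun Rp f -> measurable_fun Rp (kint k f).
Proof.
move=> mk mf; suff : measurable_fun Rp (fun x => \int[mu]_(t in Rp) (k x t * f t)%:E)%E.
  exact: measurableT_comp.
apply: (@measurable_integral_Rplus _ (fun z => (k z.1 z.2 * f z.2)%:E)).
apply/measurable_EFinP; apply: measurable_funM => //.
exact: measurable_quadrant_snd.
Qed.

Lemma kint_integrable k C f x : schur_kernel k C -> sqint f -> 0 < x ->
  mu.-integrable Rp (fun t => (k x t * f t)%:E).
Proof. by move=> sk sf x0; apply: sqint_integrableM => //; exact: schur_row sk _ x0. Qed.

(** The Cauchy-Schwarz inequality for the splitting k f = (k^(1/2) t^(-1/4))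
    (k^(1/2) t^(1/4) f), followed by the weight bound of the kernel on the
    first factor. The inequality is obtained by optimising the parameter l
    in 2 |f| <= l t^(-1/2) + l^(-1) t^(1/2) f^2. *)
Lemma kint_sqr_le k C f x : schur_kernel k C -> sqint f -> 0 < x ->
  ((kint k f x ^+ 2)%:E <= (C * (Num.sqrt x)^-1)%:E *
    \int[mu]_(t in Rp) (k x t * (Num.sqrt t * f t ^+ 2))%:E)%E.
Proof.
move=> sk sf x0; have [mkx ekx] := schur_row sk x0; have [mf _] := sf.
set a := `|kint k f x|.
set p := C * _; set G := integral _ _ _.
have p0 : 0 < p by rewrite mulr_gt0 ?invr_gt0 ?sqrtr_gt0// (schur_cst sk).
have ms : measurable_fun Rp (@Num.sqrt R) by exact: measurable_sqrtr.
have msi : measurable_fun Rp (fun t : R => (Num.sqrt t)^-1).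
  exact: measurableT_comp (@measurable_invr R setT) ms.
have G0 : (0 <= G)%E.
  apply: integral_ge0 => t; rewrite RplusE => t0.
  by rewrite lee_fin mulr_ge0 ?(schur_ge0 sk)// mulr_ge0 ?sqrtr_ge0 ?sqr_ge0.
have key (l : R) : 0 < l -> ((2 * a)%:E <= (l * p)%:E + (l^-1)%:E * G)%E.
  move=> l0.
  have mkf : measurable_fun Rp (fun t => k x t * f t) by exact: measurable_funM.
  have m1 : measurable_fun Rp (fun t => (k x t * (Num.sqrt t)^-1)%:E).
    by apply/measurable_EFinP; exact: measurable_funM.
  have m2 : measurable_fun Rp (fun t => (k x t * (Num.sqrt t * f t ^+ 2))%:E).
    apply/measurable_EFinP; apply: measurable_funM => //.
    by apply: measurable_funM => //; exact: measurable_funX.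
  apply: (@le_trans _ _ (2%:E * \int[mu]_(t in Rp) `|k x t * f t|%:E)%E).
    rewrite EFinM lee_pmul2l// /a EFin_normr_Rintegral.
    - by apply: le_abse_integral; [exact: measurable_Rplus|exact/measurable_EFinP].
    - exact: measurable_Rplus.
    - exact: (kint_integrable sk sf x0).
  apply: (@le_trans _ _ (l%:E * \int[mu]_(t in Rp) (k x t * (Num.sqrt t)^-1)%:E
      + (l^-1)%:E * G)%E); last first.
    rewrite leeD2r// EFinM; apply: lee_wpmul2l; first by rewrite lee_fin ltW.
    exact: (schur_bound sk).
  have k0 t : Rp t -> (0 <= k x t) by rewrite RplusE; exact: (schur_ge0 sk).
  have p1 t : Rp t -> (0 <= (k x t * (Num.sqrt t)^-1)%:E)%E.
    by move=> t0; rewrite lee_fin mulr_ge0 ?invr_ge0 ?sqrtr_ge0 ?k0.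
  have p2 t : Rp t -> (0 <= (k x t * (Num.sqrt t * f t ^+ 2))%:E)%E.
    by move=> t0; rewrite lee_fin mulr_ge0 ?k0// mulr_ge0 ?sqrtr_ge0 ?sqr_ge0.
  have l1 : 0 <= l^-1 by rewrite invr_ge0 ltW.
  rewrite -!ge0_integralZl_EFin//; try exact: measurable_Rplus; try exact: ltW.
  - rewrite -ge0_integralD//.
    + apply: ge0_le_integral => //.
      * exact: measurable_Rplus.
      * by apply: measurable_funeM; apply/measurable_EFinP; exact: measurableT_comp.
      * by apply: emeasurable_funD; exact: measurable_funeM.
      * move=> t Rt; rewrite -!EFinM -EFinD lee_fin normrM (ger0_norm (k0 _ Rt)).
        have t0 : 0 < Num.sqrt t by move: Rt; rewrite RplusE sqrtr_gt0.
        rewrite [leLHS](_ : _ = k x t * (2 * `|f t|)); last by ring.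
        rewrite [leRHS](_ : _ = k x t * (l / Num.sqrt t + l^-1 * Num.sqrt t * f t ^+ 2)); last by ring.
        apply: ler_wpM2l; first exact: k0.
        rewrite -(real_normK (num_real (f t))) -subr_ge0.
        rewrite (_ : _ - _ = (l - Num.sqrt t * `|f t|) ^+ 2 / (l * Num.sqrt t)).
          by rewrite divr_ge0 ?sqr_ge0// mulr_ge0 ?ltW.
        by field; rewrite !gt_eqF.
    + exact: measurable_Rplus.
    + by move=> t Rt; apply: mule_ge0; [rewrite lee_fin ltW|exact: p1].
    + exact: measurable_funeM.
    + by move=> t Rt; apply: mule_ge0; [rewrite lee_fin|exact: p2].
    + exact: measurable_funeM.
  - by apply/measurable_EFinP; exact: measurableT_comp.
have [a0|a0] := eqVneq a 0.
  rewrite -(real_normK (num_real (kint k f x))) -/a a0 expr0n/=.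
  by apply: mule_ge0 => //; rewrite lee_fin ltW.
have ap : 0 < a by rewrite lt_neqAle eq_sym a0 normr_ge0.
(* With l = a / p, multiplying by a turns the bound into a^2 <= p G. *)
have := key (a / p) (divr_gt0 ap p0).
rewrite divfK ?gt_eqF// invf_div -(real_normK (num_real (kint k f x))) -/a.
case: G G0 {key} => [g| |]//.
  rewrite lee_fin => g0; rewrite -!EFinM -EFinD !lee_fin => h.
  have : 2 * a * a <= (a + p / a * g) * a by rewrite ler_wpM2r// ltW.
  have -> : (a + p / a * g) * a = a * a + p * g by field.
  by rewrite expr2; lra.
by move=> _ _; rewrite gt0_muley ?lte_fin// leey.
Qed.

(** The Schur test: integrate the pointwise bound in x, exchange the
    integrals, and use the symmetry of the kernel to apply the weight bound
    once more, now in the other variable. *)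
Lemma energy_kint k C f : schur_kernel k C -> sqint f ->
  (energy (kint k f) <= (C ^+ 2)%:E * energy f)%E.
Proof.
move=> sk sf; have [mf _] := sf; have mk := schur_meas sk.
have ms : measurable_fun Rp (@Num.sqrt R) by exact: measurable_sqrtr.
have msi : measurable_fun Rp (fun t : R => (Num.sqrt t)^-1).
  exact: measurableT_comp (@measurable_invr R setT) ms.
have C0 := schur_cst sk.
pose h (z : R * R) := (C * (Num.sqrt z.1)^-1 * (k z.1 z.2 * (Num.sqrt z.2 * f z.2 ^+ 2)))%:E.
have k0 x t : 0 < x -> 0 < t -> 0 <= k x t by exact: (schur_ge0 sk).
have mh : measurable_fun (Rp `*` Rp) h.
  apply/measurable_EFinP; apply: measurable_funM.
    by apply: measurable_funM => //; exact: (measurable_quadrant_fst msi).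
  apply: measurable_funM => //.
  apply: (@measurable_quadrant_snd (fun t => Num.sqrt t * f t ^+ 2)).
  by apply: measurable_funM => //; exact: measurable_funX.
have h0 x y : 0 < x -> 0 < y -> (0 <= h (x, y))%E.
  move=> x0 y0; rewrite lee_fin mulr_ge0//.
    by rewrite mulr_ge0 ?invr_ge0 ?sqrtr_ge0// ltW.
  by rewrite mulr_ge0 ?k0// mulr_ge0 ?sqrtr_ge0 ?sqr_ge0.
have mrow x : 0 < x -> measurable_fun Rp (k x) by case/(schur_row sk).
apply: (@le_trans _ _ (\int[mu]_(x in Rp) \int[mu]_(t in Rp) h (x, t))%E).
  apply: ge0_le_integral => //.
  - exact: measurable_Rplus.
  - by move=> x _; rewrite lee_fin sqr_ge0.
  - by apply/measurable_EFinP/measurable_funX; exact: measurable_kint.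
  - exact: measurable_integral_Rplus.
  - move=> x; rewrite RplusE => x0; apply: le_trans (kint_sqr_le sk sf x0) _.
    rewrite -ge0_integralZl_EFin//.
    + exact: measurable_Rplus.
    + move=> t; rewrite RplusE => t0.
      by rewrite lee_fin mulr_ge0 ?k0// mulr_ge0 ?sqrtr_ge0 ?sqr_ge0.
    + apply/measurable_EFinP; apply: measurable_funM => //; first exact: mrow.
      by apply: measurable_funM => //; exact: measurable_funX.
    + by rewrite mulr_ge0 ?invr_ge0 ?sqrtr_ge0// ltW.
rewrite tonelli_Rplus// /energy -ge0_integralZl_EFin//; last 4 first.
- exact: measurable_Rplus.
- by move=> x _; rewrite lee_fin sqr_ge0.
- exact/measurable_EFinP/measurable_funX.
- exact: sqr_ge0.
apply: ge0_le_integral => //.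
- exact: measurable_Rplus.
- move=> t; rewrite RplusE => t0; apply: integral_ge0 => x; rewrite RplusE => x0.
  exact: h0.
- apply: (@measurable_integral_Rplus _ (fun z => h (z.2, z.1))).
  exact: measurable_quadrant_swap.
- by apply: measurable_funeM; apply/measurable_EFinP/measurable_funX.
- move=> t; rewrite RplusE => t0 /=.
  have -> : (\int[mu]_(x in Rp) h (x, t) = \int[mu]_(x in Rp)
      ((C * Num.sqrt t * f t ^+ 2)%:E * (k t x * (Num.sqrt x)^-1)%:E))%E.
    apply: eq_integral => x; rewrite inE RplusE => x0; rewrite /h/= -EFinM; congr EFin.
    by rewrite (schur_sym sk t0 x0); ring.
  rewrite ge0_integralZl_EFin//.
  + apply: (@le_trans _ _ ((C * Num.sqrt t * f t ^+ 2)%:E * (C * (Num.sqrt t)^-1)%:E)%E).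
      apply: lee_wpmul2l; last exact: (schur_bound sk).
      rewrite lee_fin.
      by rewrite mulr_ge0 ?sqr_ge0// mulr_ge0 ?sqrtr_ge0// ltW.
    rewrite -!EFinM lee_fin le_eqVlt; apply/orP; left; apply/eqP.
    by field; rewrite gt_eqF// sqrtr_gt0.
  + exact: measurable_Rplus.
  + move=> x; rewrite RplusE => x0.
    by rewrite lee_fin mulr_ge0 ?invr_ge0 ?sqrtr_ge0// k0.
  + by apply/measurable_EFinP; apply: measurable_funM => //; exact: mrow.
  + by rewrite mulr_ge0 ?sqr_ge0// mulr_ge0 ?sqrtr_ge0// ltW.
Qed.

Lemma sqint_kint k C f : schur_kernel k C -> sqint f -> sqint (kint k f).
Proof.
move=> sk sf; split; first by apply: measurable_kint; [exact: schur_meas sk|case: sf].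
apply: le_lt_trans (energy_kint sk sf) _.
by apply: lte_mul_pinfty; rewrite ?lee_fin ?sqr_ge0//; case: sf.
Qed.

Lemma kint_lin k C (a b : R) f g x : schur_kernel k C -> sqint f -> sqint g -> 0 < x ->
  kint k (fun t => a * f t + b * g t) x = a * kint k f x + b * kint k g x.
Proof.
move=> sk sf sg x0.
have fi := kint_integrable sk sf x0; have gi := kint_integrable sk sg x0.
have mRp := @measurable_Rplus R.
rewrite /kint -!RintegralZl// -RintegralD//; last 2 first.
- rewrite (_ : _ \o _ = (fun t => a%:E * (k x t * f t)%:E)%E); first exact: integrableZl.
  by apply/funext => t; rewrite -EFinM.
- rewrite (_ : _ \o _ = (fun t => b%:E * (k x t * g t)%:E)%E); first exact: integrableZl.
  by apply/funext => t; rewrite -EFinM.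
by apply: eq_Rintegral => t _; ring.
Qed.

Lemma ae_eq_kint k C f g x : schur_kernel k C -> sqint f -> sqint g -> 0 < x ->
  ae_eq mu Rp f g -> kint k f x = kint k g x.
Proof.
move=> sk sf sg x0 fg; congr fine; apply: ae_eq_integral.
- exact: measurable_Rplus.
- by have /measurable_int := kint_integrable sk sf x0.
- by have /measurable_int := kint_integrable sk sg x0.
- by apply: filterS fg => t fg /fg ->.
Qed.

(** Composition of operators is composition of kernels, by Fubini. The
    absolute convergence that Fubini needs comes from the same operators
    applied to |f|, which is square-integrable as well. *)
Lemma kint_comp k1 k2 C1 C2 f x :
  schur_kernel k1 C1 -> schur_kernel k2 C2 -> sqint f -> 0 < x ->
  kint k1 (kint k2 f) x = \int[mu]_(t in Rp) (kint k1 (k2 ^~ t) x * f t).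
Proof.
move=> sk1 sk2 sf x0; have [mf _] := sf.
have mRp := @measurable_Rplus R.
pose h (z : R * R) := (k1 x z.1 * (k2 z.1 z.2 * f z.2))%:E.
have mk1 : measurable_fun Rp (k1 x) by case: (schur_row sk1 x0).
have mh : measurable_fun (Rp `*` Rp) h.
  apply/measurable_EFinP; apply: measurable_funM; first exact: measurable_quadrant_fst.
  by apply: measurable_funM; [exact: schur_meas sk2|exact: measurable_quadrant_snd].
have sk2f := sqint_kint sk2 sf.
have sk2nf := sqint_kint sk2 (sqint_norm sf).
have hoo : (\int[mu]_(s in Rp) \int[mu]_(t in Rp) `|h (s, t)| < +oo)%E.
  have /integrableP[_] := kint_integrable sk1 sk2nf x0.
  apply: le_lt_trans; rewrite le_eqVlt; apply/orP; left; apply/eqP.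
  apply: eq_integral => s; rewrite inE RplusE => s0.
  have i2 := kint_integrable sk2 (sqint_norm sf) s0.
  have k20 : 0 <= kint k2 (fun t => `|f t|) s.
    apply: Rintegral_ge0 => t; rewrite RplusE => t0.
    by rewrite mulr_ge0// (schur_ge0 sk2).
  have k10 := schur_ge0 sk1 x0 s0.
  rewrite [RHS]gee0_abs ?lee_fin ?mulr_ge0// EFinM.
  rewrite /kint /Rintegral fineK; last exact: integrable_fin_num.
  rewrite -integralZl//; apply: eq_integral => t; rewrite inE RplusE => t0.
  by rewrite abse_EFin !normrM (ger0_norm k10) (ger0_norm (schur_ge0 sk2 s0 t0)).
have row2 t : 0 < t -> sqint (k2 ^~ t).
  move=> t0; have [m2 e2] := schur_row sk2 t0; split.
    by apply: eq_measurable_fun m2 => s; rewrite inE RplusE => s0; exact: schur_sym sk2 _ _ t0 s0.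
  by rewrite (@eq_energy _ _ (k2 t))// => s s0; rewrite (schur_sym sk2 t0 s0).
transitivity (fine (\int[mu]_(s in Rp) \int[mu]_(t in Rp) h (s, t))).
  congr fine; apply: eq_integral => s; rewrite inE RplusE => s0.
  have i2 := kint_integrable sk2 sf s0.
  rewrite /h/=; under [RHS]eq_integral do rewrite EFinM.
  by rewrite integralZl// EFinM fineK//; exact: integrable_fin_num.
rewrite fubini_Rplus//; congr fine; apply: eq_integral => t; rewrite inE RplusE => t0.
have i1 := kint_integrable sk1 (row2 t t0) x0.
rewrite /h/=; under eq_integral do rewrite mulrA EFinM.
by rewrite integralZr// EFinM fineK//; exact: integrable_fin_num.
Qed.

End Schur.

(** * Calculus on the half-line *)

Section Calculus.
Context {R : realType}.
Notation mu := (@lebesgue_measure R).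
Notation Rp := (@Rplus R).
Implicit Types (f g F G : R -> R) (x t v : R).

Lemma is_derive_continuous f x df : is_derive x 1 f df -> {for x, continuous f}.
Proof.
by move=> fx; apply: differentiable_continuous; apply/derivable1_diffP; have [] := fx.
Qed.

Lemma continuous_sqr f x : {for x, continuous f} -> {for x, continuous (fun y => f y ^+ 2)}.
Proof. by move=> fx; apply: cvgM. Qed.

Lemma is_derive_atan_comp g x dg : is_derive x 1 g dg ->
  is_derive x 1 (fun y => atan (g y)) (dg / (1 + g x ^+ 2)).
Proof.
move=> gx; rewrite mulrC.
exact: (@is_derive1_comp _ atan g x _ _ (is_derive1_atan (g x)) gx).
Qed.

Lemma is_derive_ln_comp g x dg : 0 < g x -> is_derive x 1 g dg ->
  is_derive x 1 (fun y => ln (g y)) (dg / g x).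
Proof.
move=> g0 gx; rewrite mulrC.
exact: (@is_derive1_comp _ (@ln R) g x _ _ (is_derive1_ln g0) gx).
Qed.

Lemma cvgy_inv : (x^-1 : R) @[x --> +oo] --> (0 : R).
Proof.
apply/cvgr0Pnorm_lt => e e0; near=> x.
have x0 : 0 < x by near: x; apply: nbhs_pinfty_gt; exact: num_real.
rewrite ger0_norm ?invr_ge0 ?ltW// -[ltRHS]invrK ltf_pV2 ?posrE ?invr_gt0//.
by near: x; apply: nbhs_pinfty_gt; exact: num_real.
Unshelve. all: by end_near. Qed.

Lemma cvgy_sqrt : (Num.sqrt x : R) @[x --> +oo] --> +oo.
Proof.
apply/cvgryPge => A; near=> x.
apply: (le_trans (ler_norm A)); rewrite -sqrtr_sqr; apply: ler_wsqrtr.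
by near: x; apply: nbhs_pinfty_ge; exact: num_real.
Unshelve. all: by end_near. Qed.

(** Limits at infinity are computed as values at 0 of the function in the
    variable 1/x, which is continuous there in all the uses below. *)
Lemma cvg_pinfty_comp_inv F G : {for 0, continuous G} ->
  (forall x, 0 < x -> F x = G x^-1) -> F x @[x --> +oo] --> G 0.
Proof.
move=> G0 FG.
have GV : G x^-1 @[x --> +oo] --> G 0 by apply: continuous_cvg => //; exact: cvgy_inv.
apply: cvg_trans GV.
by apply: near_eq_cvg; near=> x; rewrite FG//; near: x; apply: nbhs_pinfty_gt; exact: num_real.
Unshelve. all: by end_near. Qed.

Lemma cvg_pinfty_comp_inv_sqrt F G : {for 0, continuous G} ->
  (forall x, 0 < x -> F x = G (Num.sqrt x)^-1) -> F x @[x --> +oo] --> G 0.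
Proof.
move=> G0 FG.
have GV : G x^-1 @[x --> +oo] --> G 0 by exact: cvg_pinfty_comp_inv.
have Gs : G (Num.sqrt x)^-1 @[x --> +oo] --> G 0.
  by apply: (cvg_comp _ (fun x => G x^-1) cvgy_sqrt GV).
apply: cvg_trans Gs.
by apply: near_eq_cvg; near=> x; rewrite FG//; near: x; apply: nbhs_pinfty_gt; exact: num_real.
Unshelve. all: by end_near. Qed.

Lemma cvg_at_right0_comp_sqrt F G : {for 0, continuous G} ->
  (forall x, 0 < x -> F x = G (Num.sqrt x)) -> F x @[x --> 0^'+] --> G 0.
Proof.
move=> G0 FG.
have s0 : Num.sqrt x @[x --> 0^'+] --> (0 : R).
  by apply: cvg_at_right_filter; rewrite -[X in _ --> X]sqrtr0; exact: sqrt_continuous.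
have Gs : G (Num.sqrt x) @[x --> 0^'+] --> G 0 by exact: continuous_cvg.
apply: cvg_trans Gs.
by apply: near_eq_cvg; near=> x; rewrite FG//; near: x; exact: nbhs_right_gt.
Unshelve. all: by end_near. Qed.

(** The substitution t = r^2 gives the primitive (2 / sqrt x) atan (sqrt t /
    sqrt x). This is the Schur weight bound for the Stieltjes kernel, with
    equality. *)
Lemma integral_stieltjes_weight x : 0 < x ->
  (\int[mu]_(t in Rp) ((x + t)^-1 * (Num.sqrt t)^-1)%:E = (pi * (Num.sqrt x)^-1)%:E)%E.
Proof.
move=> x0; have sx0 : 0 < Num.sqrt x by rewrite sqrtr_gt0.
(* Continuity of F at 0 is needed only in the variable sqrt t. *)
pose F t := 2 / Num.sqrt x * atan (Num.sqrt t / Num.sqrt x).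
apply: (@ge0_FTC_Rplus _ F _ 0 (2 / Num.sqrt x * (pi / 2))).
- by move=> t t0; rewrite mulr_ge0 ?invr_ge0 ?sqrtr_ge0// addr_ge0 ?ltW.
- move=> t t0; apply: cvgM; apply: cvgV.
  + by rewrite gt_eqF// addr_gt0.
  + by apply: cvgD; [exact: cvg_cst|exact: cvg_id].
  + by rewrite gt_eqF// sqrtr_gt0.
  + exact: sqrt_continuous.
- move=> t t0; have st0 : 0 < Num.sqrt t by rewrite sqrtr_gt0.
  have a1 : is_derive t 1 (@Num.sqrt R) (2 * Num.sqrt t)^-1 by exact: is_derive1_sqrt.
  have a3 : is_derive t 1 (fun t => Num.sqrt t / Num.sqrt x) ((2 * Num.sqrt t)^-1 / Num.sqrt x).
    by apply: is_derive_eq; rewrite /GRing.scale/=; ring.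
  have a4 := is_derive_atan_comp a3.
  apply: is_derive_eq; rewrite /GRing.scale/=.
  move: (sqr_sqrtr (ltW x0)) (sqr_sqrtr (ltW t0)) sx0 st0.
  generalize (Num.sqrt x) (Num.sqrt t) => p q <- <- p0 q0.
  by field; rewrite !gt_eqF// ltr_pwDl ?exprn_gt0// exprn_ge0// ltW.
- pose G r := 2 / Num.sqrt x * atan (r / Num.sqrt x).
  have G0 : G 0 = 0 by rewrite /G mul0r atan0 mulr0.
  rewrite -[X in _ --> X]G0.
  apply: cvg_at_right0_comp_sqrt => //.
  apply: cvgM; first exact: cvg_cst.
  apply: continuous_cvg; first exact: continuous_atan.
  by apply: cvgM; [exact: cvg_id|exact: cvg_cst].
- apply: cvgM; first exact: cvg_cst.
  apply: (cvg_comp (fun t => Num.sqrt t / Num.sqrt x) atan); last exact: cvgy_atan.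
  apply/cvgryPge => A; near=> t; rewrite ler_pdivlMr//.
  by near: t; move/cvgryPge : cvgy_sqrt; exact.
- by field; rewrite gt_eqF.
Unshelve. all: by end_near. Qed.

End Calculus.

(** * Elementary integrals *)

Section RationalIntegrals.
Context {R : realType}.
Notation mu := (@lebesgue_measure R).
Notation Rp := (@Rplus R).
Implicit Types (f g F G : R -> R) (x t v s : R).

Lemma integral_inv_sqrD x : 0 < x ->
  (\int[mu]_(v in Rp) ((x ^+ 2 + v ^+ 2)^-1)%:E = (pi / (2 * x))%:E)%E.
Proof.
move=> x0.
apply: (@ge0_FTC_Rplus _ (fun v => x^-1 * atan (v / x)) _ 0 (x^-1 * (pi / 2))).
- by move=> v v0; rewrite invr_ge0 addr_ge0 ?sqr_ge0.
- move=> v v0; apply: cvgV; first by rewrite gt_eqF// addr_gt0 ?exprn_gt0.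
  by apply: cvgD; [exact: cvg_cst|exact: exprn_continuous].
- move=> v v0.
  have a3 : is_derive v 1 (fun v => v / x) x^-1.
    by apply: is_derive_eq; rewrite /GRing.scale/=; ring.
  have a4 := is_derive_atan_comp a3.
  apply: is_derive_eq; rewrite /GRing.scale/=.
  by field; rewrite !gt_eqF// addr_gt0 ?exprn_gt0.
- have G0 : x^-1 * atan (0 / x) = 0 by rewrite mul0r atan0 mulr0.
  rewrite -[X in _ --> X]G0.
  apply: cvg_at_right_filter; apply: cvgM; first exact: cvg_cst.
  apply: continuous_cvg; first exact: continuous_atan.
  by apply: cvgM; [exact: cvg_id|exact: cvg_cst].
- apply: cvgM; first exact: cvg_cst.
  apply: (cvg_comp (fun v => v / x) atan); last exact: cvgy_atan.
  by apply/cvgryPge => A; near=> t; rewrite ler_pdivlMr.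
- by field; rewrite gt_eqF.
Unshelve. all: by end_near. Qed.

(** The energy of a row of the Stieltjes kernel. *)
Lemma integral_inv_Dsqr x : 0 < x ->
  (\int[mu]_(t in Rp) ((x + t)^-1 ^+ 2)%:E = (x^-1)%:E)%E.
Proof.
move=> x0.
apply: (@ge0_FTC_Rplus _ (fun t => - (x + t)^-1) _ (- x^-1) 0).
- by move=> t t0; rewrite exprn_ge0// invr_ge0 addr_ge0 ?ltW.
- move=> t t0; apply: continuous_sqr.
  apply: cvgV; first by rewrite gt_eqF// addr_gt0.
  by apply: cvgD; [exact: cvg_cst|exact: cvg_id].
- move=> t t0; have xt : x + t != 0 by rewrite gt_eqF// addr_gt0.
  have a1 : is_derive t 1 (fun t => x + t) 1 by apply: is_derive_eq; ring.
  have a2 := @is_deriveV _ (fun t => x + t) t _ 1 xt a1.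
  by apply: is_derive_eq; rewrite /GRing.scale/=; field.
- apply: cvg_at_right_filter; apply: cvgN.
  have x00 : x + 0 = x by rewrite addr0.
  rewrite -{2}x00; apply: cvgV; first by rewrite addr0 gt_eqF.
  by apply: cvgD; [exact: cvg_cst|exact: cvg_id].
- pose G w := - (w / (x * w + 1)).
  have G0 : G 0 = 0 by rewrite /G mul0r oppr0.
  rewrite -[X in _ --> X]G0; apply: cvg_pinfty_comp_inv.
    apply: cvgN; apply: cvgM; first exact: cvg_id.
    apply: cvgV; first by rewrite mulr0 add0r oner_neq0.
    by apply: cvgD; [apply: cvgM; [exact: cvg_cst|exact: cvg_id]|exact: cvg_cst].
  by move=> t t0; rewrite /G; field; rewrite !gt_eqF// addr_gt0.
- by rewrite sub0r opprK.
Qed.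

(** The energy of a row of the kernel sqrt (x t) / (x^2 + t^2). *)
Lemma integral_x_inv_sqrD_sqr x : 0 < x ->
  (\int[mu]_(v in Rp) (x * v / (x ^+ 2 + v ^+ 2) ^+ 2)%:E = ((2 * x)^-1)%:E)%E.
Proof.
move=> x0.
have D v : x ^+ 2 + v ^+ 2 != 0 by rewrite gt_eqF// ltr_pwDl ?exprn_gt0// sqr_ge0.
have cD v : {for v, continuous (fun v => x ^+ 2 + v ^+ 2)}.
  by apply: cvgD; [exact: cvg_cst|exact: exprn_continuous].
apply: (@ge0_FTC_Rplus _ (fun v => - (x / 2) * (x ^+ 2 + v ^+ 2)^-1) _ (- (x / 2) * (x ^+ 2 + 0 ^+ 2)^-1) 0).
- by move=> v v0; rewrite divr_ge0 ?sqr_ge0// mulr_ge0 ?ltW.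
- move=> v v0; apply: cvgM.
    by apply: cvgM; [exact: cvg_cst|exact: cvg_id].
  apply: cvgV; first by rewrite expf_neq0.
  by apply: (@continuous_sqr _ (fun v => x ^+ 2 + v ^+ 2)); exact: cD.
- move=> v v0.
  have a1 : is_derive v 1 (fun v => x ^+ 2 + v ^+ 2) (2 * v).
    by apply: is_derive_eq; rewrite /GRing.scale/=; ring.
  have a2 := @is_deriveV _ (fun v => x ^+ 2 + v ^+ 2) v _ 1 (D v) a1.
  by apply: is_derive_eq; rewrite /GRing.scale/=; field.
- apply: cvg_at_right_filter; apply: cvgM; first exact: cvg_cst.
  by apply: cvgV; [exact: D|exact: cD].
- pose G w := - (x / 2) * (w ^+ 2 / ((x * w) ^+ 2 + 1)).
  have G0 : G 0 = 0 by rewrite /G expr0n/= mul0r mulr0.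
  rewrite -[X in _ --> X]G0; apply: cvg_pinfty_comp_inv.
    apply: cvgM; first exact: cvg_cst.
    apply: cvgM; first exact: exprn_continuous.
    apply: cvgV; first by rewrite mulr0 expr0n/= add0r oner_neq0.
    apply: cvgD; last exact: cvg_cst.
    apply: (@continuous_sqr _ (fun w => x * w)).
    by apply: cvgM; [exact: cvg_cst|exact: cvg_id].
  by move=> t t0; rewrite /G; field; rewrite D gt_eqF// addr_gt0 ?exprn_gt0// mulr_gt0.
- by rewrite expr0n/= addr0; field; rewrite gt_eqF.
Qed.

(** Partial fractions: the primitive is (ln (t^2 + v^2) - ln (x^2 + v^2)) /
    (2 (x^2 - t^2)), which vanishes at infinity. This is where the logarithm
    in the inverse comes from. *)
Lemma integral_log_kernel x t : 0 < x -> 0 < t -> x != t ->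
  (\int[mu]_(v in Rp) (v / ((x ^+ 2 + v ^+ 2) * (v ^+ 2 + t ^+ 2)))%:E =
   ((ln x - ln t) / (x ^+ 2 - t ^+ 2))%:E)%E.
Proof.
move=> x0 t0 xt.
have D (y v : R) : 0 < y -> 0 < y ^+ 2 + v ^+ 2 by move=> y0; rewrite ltr_pwDl ?exprn_gt0// sqr_ge0.
have cD (y v : R) : {for v, continuous (fun v => y ^+ 2 + v ^+ 2)}.
  by apply: cvgD; [exact: cvg_cst|exact: exprn_continuous].
have xt2 : x ^+ 2 - t ^+ 2 != 0.
  by rewrite subr_sqr mulf_neq0// ?subr_eq0// gt_eqF// addr_gt0.
pose c := (2 * (x ^+ 2 - t ^+ 2))^-1.
pose H (v : R) := ln (t ^+ 2 + v ^+ 2) - ln (x ^+ 2 + v ^+ 2).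
apply: (@ge0_FTC_Rplus _ (fun v => c * H v) _ (c * H 0) (c * (ln 1 - ln 1))).
- by move=> v v0; rewrite divr_ge0 ?ltW// mulr_gt0// ?D// addrC D.
- move=> v v0; apply: cvgM; first exact: cvg_id.
  apply: cvgV; first by rewrite mulf_neq0// gt_eqF// 1?[_ + t ^+ 2]addrC D.
  apply: cvgM; first exact: cD.
  by apply: cvgD; [exact: exprn_continuous|exact: cvg_cst].
- move=> v v0.
  have a1 y : is_derive v 1 (fun v => y ^+ 2 + v ^+ 2) (2 * v).
    by apply: is_derive_eq; rewrite /GRing.scale/=; ring.
  have a2 := @is_derive_ln_comp _ (fun v => t ^+ 2 + v ^+ 2) v _ (D t v t0) (a1 t).
  have a3 := @is_derive_ln_comp _ (fun v => x ^+ 2 + v ^+ 2) v _ (D x v x0) (a1 x).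
  apply: is_derive_eq; rewrite /GRing.scale/= /c.
  by field; rewrite xt2 !gt_eqF ?D// addrC D.
- apply: cvg_at_right_filter; apply: cvgM; first exact: cvg_cst.
  by apply: cvgB; apply: continuous_cvg; try exact: continuous_ln (D _ _ _); exact: cD.
- apply: cvgM; first exact: cvg_cst.
  pose G w := ln ((t * w) ^+ 2 + 1) - ln ((x * w) ^+ 2 + 1).
  have G0 : G 0 = ln 1 - ln 1 by rewrite /G !mulr0 expr0n/= add0r.
  rewrite -G0; apply: cvg_pinfty_comp_inv.
    have cG y : (fun w => ln ((y * w) ^+ 2 + 1)) w @[w --> (0 : R)] --> ln ((y * 0) ^+ 2 + 1).
      apply: continuous_cvg; first by apply: continuous_ln; rewrite mulr0 expr0n/= add0r.
      apply: cvgD; last exact: cvg_cst.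
      apply: (@continuous_sqr _ (fun w => y * w)).
      by apply: cvgM; [exact: cvg_cst|exact: cvg_id].
    by apply: cvgB; exact: cG.
  move=> v v0.
  have E y : 0 < y -> ln (y ^+ 2 + v ^+ 2) = ln ((y * v^-1) ^+ 2 + 1) + ln (v ^+ 2).
    move=> y0; rewrite -lnM ?posrE ?exprn_gt0//; last first.
      by rewrite addr_gt0 ?exprn_gt0// mulr_gt0 ?invr_gt0.
    by congr ln; field; rewrite gt_eqF.
  by rewrite /H !E// /G; ring.
- have lnX y : 0 < y -> ln (y ^+ 2) = 2 * ln y by move=> y0; rewrite lnXn// mulr_natl.
  have H0 : H 0 = 2 * ln t - 2 * ln x by rewrite /H expr0n !addr0 !lnX.
  rewrite H0 subrr mulr0 sub0r /c.
  move: xt2; generalize (ln x) (ln t) (x ^+ 2 - t ^+ 2) => p q d d0.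
  by field.
Qed.

End RationalIntegrals.

(** * Integrals with a square root in the numerator or denominator *)

Section QuarticIntegrals.
Context {R : realType}.
Notation mu := (@lebesgue_measure R).
Notation Rp := (@Rplus R).
Implicit Types (c r v s : R).

Let quad_gt0 c r : 0 < c -> 0 < r ^+ 2 + c ^+ 2 / 2 + c * r.
Proof.
move=> c0; have -> : r ^+ 2 + c ^+ 2 / 2 + c * r = (r + c / 2) ^+ 2 + (c / 2) ^+ 2 by field.
by rewrite ltr_wpDl ?sqr_ge0// exprn_gt0// divr_gt0.
Qed.

Let quadB_gt0 c r : 0 < c -> 0 < r ^+ 2 + c ^+ 2 / 2 - c * r.
Proof. by move=> c0; have := quad_gt0 (- r) c0; rewrite sqrrN mulrN. Qed.

(** With s = r^2 and v = c^2 / 2 one has s^2 + v^2 = (r^2 + c^2 / 2 - c r)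
    (r^2 + c^2 / 2 + c r). The two functions below are the arctangent and
    the logarithm that this factorisation contributes to the primitives of r
    / (s^2 + v^2) and r^(-1) / (s^2 + v^2). *)
Definition quartic_atan c r := atan ((2 * r + c) / c) + atan ((2 * r - c) / c).

Definition quartic_ln c r :=
  ln (r ^+ 2 + c ^+ 2 / 2 - c * r) - ln (r ^+ 2 + c ^+ 2 / 2 + c * r).

Lemma is_derive_quartic_atan c s : 0 < c -> 0 < s ->
  is_derive s 1 (fun s => quartic_atan c (Num.sqrt s))
    (c * (s + c ^+ 2 / 2) / (2 * Num.sqrt s * (s ^+ 2 + (c ^+ 2 / 2) ^+ 2))).
Proof.
move=> c0 s0; have r0 : 0 < Num.sqrt s by rewrite sqrtr_gt0.
have a1 : is_derive s 1 (@Num.sqrt R) (2 * Num.sqrt s)^-1 by exact: is_derive1_sqrt.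
have a2 : is_derive s 1 (fun s => (2 * Num.sqrt s + c) / c) ((c * Num.sqrt s)^-1).
  by apply: is_derive_eq; rewrite /GRing.scale/=; field; rewrite !gt_eqF.
have a3 : is_derive s 1 (fun s => (2 * Num.sqrt s - c) / c) ((c * Num.sqrt s)^-1).
  by apply: is_derive_eq; rewrite /GRing.scale/=; field; rewrite !gt_eqF.
have a4 := @is_derive_atan_comp _ (fun s => (2 * Num.sqrt s + c) / c) s _ a2.
have a5 := @is_derive_atan_comp _ (fun s => (2 * Num.sqrt s - c) / c) s _ a3.
rewrite /quartic_atan.
apply: is_derive_eq; rewrite /GRing.scale/=.
move: (sqr_sqrtr (ltW s0)) r0; generalize (Num.sqrt s) => r <- r0.
have := quad_gt0 r c0; have := quadB_gt0 r c0 => q1 q2.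
have e1 : 1 + ((2 * r + c) / c) ^+ 2 = 4 / c ^+ 2 * (r ^+ 2 + c ^+ 2 / 2 + c * r).
  by field; rewrite gt_eqF.
have e2 : 1 + ((2 * r - c) / c) ^+ 2 = 4 / c ^+ 2 * (r ^+ 2 + c ^+ 2 / 2 - c * r).
  by field; rewrite gt_eqF.
have e3 : (r ^+ 2) ^+ 2 + (c ^+ 2 / 2) ^+ 2 =
  (r ^+ 2 + c ^+ 2 / 2 + c * r) * (r ^+ 2 + c ^+ 2 / 2 - c * r) by field.
rewrite e1 e2 e3.
have e4 : r ^+ 2 + c ^+ 2 / 2 = ((r ^+ 2 + c ^+ 2 / 2 + c * r) + (r ^+ 2 + c ^+ 2 / 2 - c * r)) / 2 by field.
move: q1 q2 e4; set A := _ - c * r; set B := _ + c * r; move=> q1 q2 e4.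
rewrite e4.
by field; rewrite !gt_eqF.
Qed.

Lemma is_derive_quartic_ln c s : 0 < c -> 0 < s ->
  is_derive s 1 (fun s => quartic_ln c (Num.sqrt s))
    (c * (s - c ^+ 2 / 2) / (Num.sqrt s * (s ^+ 2 + (c ^+ 2 / 2) ^+ 2))).
Proof.
move=> c0 s0; have r0 : 0 < Num.sqrt s by rewrite sqrtr_gt0.
have a1 : is_derive s 1 (@Num.sqrt R) (2 * Num.sqrt s)^-1 by exact: is_derive1_sqrt.
pose A s := Num.sqrt s ^+ 2 + c ^+ 2 / 2 - c * Num.sqrt s.
pose B s := Num.sqrt s ^+ 2 + c ^+ 2 / 2 + c * Num.sqrt s.
have a2 : is_derive s 1 A (1 - c / (2 * Num.sqrt s)).
  by rewrite /A; apply: is_derive_eq; rewrite /GRing.scale/=; field; rewrite !gt_eqF.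
have a3 : is_derive s 1 B (1 + c / (2 * Num.sqrt s)).
  by rewrite /B; apply: is_derive_eq; rewrite /GRing.scale/=; field; rewrite !gt_eqF.
have a4 := @is_derive_ln_comp _ A s _ (quadB_gt0 _ c0) a2.
have a5 := @is_derive_ln_comp _ B s _ (quad_gt0 _ c0) a3.
rewrite (_ : (fun _ => _) = (fun y => ln (A y)) - (fun y => ln (B y)))//.
apply: is_derive_eq.
rewrite /A /B.
move: (sqr_sqrtr (ltW s0)) r0; generalize (Num.sqrt s) => r <- r0.
have := quad_gt0 r c0; have := quadB_gt0 r c0 => q1 q2.
have e3 : (r ^+ 2) ^+ 2 + (c ^+ 2 / 2) ^+ 2 =
  (r ^+ 2 + c ^+ 2 / 2 + c * r) * (r ^+ 2 + c ^+ 2 / 2 - c * r) by field.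
rewrite e3.
by field; rewrite !gt_eqF// ?mulr_gt0//; lra.
Qed.

Let quartic_atan_cvg0 c : 0 < c -> quartic_atan c (Num.sqrt s) @[s --> 0^'+] --> 0.
Proof.
move=> c0.
have G0 : quartic_atan c 0 = 0.
  rewrite /quartic_atan mulr0 add0r sub0r mulNr atanN subrr//.
rewrite -[X in _ --> X]G0; apply: cvg_at_right0_comp_sqrt => //.
apply: cvgD; apply: continuous_cvg; try exact: continuous_atan.
- apply: cvgM; last exact: cvg_cst.
  by apply: cvgD; [apply: cvgM; [exact: cvg_cst|exact: cvg_id]|exact: cvg_cst].
- apply: cvgM; last exact: cvg_cst.
  by apply: cvgB; [apply: cvgM; [exact: cvg_cst|exact: cvg_id]|exact: cvg_cst].
Qed.

Let quartic_atan_cvgy c : 0 < c -> quartic_atan c (Num.sqrt s) @[s --> +oo] --> (pi : R).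
Proof.
move=> c0; have -> : pi = pi / 2 + pi / 2 :> R by field.
apply: cvgD.
- apply: (cvg_comp (fun s => (2 * Num.sqrt s + c) / c) atan); last exact: cvgy_atan.
  apply/cvgryPge => A; near=> s; rewrite ler_pdivlMr//.
  suff : (A * c - c) / 2 <= Num.sqrt s by lra.
  by near: s; move/cvgryPge : (@cvgy_sqrt R); exact.
- apply: (cvg_comp (fun s => (2 * Num.sqrt s - c) / c) atan); last exact: cvgy_atan.
  apply/cvgryPge => A; near=> s; rewrite ler_pdivlMr//.
  suff : (A * c + c) / 2 <= Num.sqrt s by lra.
  by near: s; move/cvgryPge : (@cvgy_sqrt R); exact.
Unshelve. all: by end_near. Qed.

Let quartic_ln_cvg0 c : 0 < c -> quartic_ln c (Num.sqrt s) @[s --> 0^'+] --> 0.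
Proof.
move=> c0.
have G0 : quartic_ln c 0 = 0 by rewrite /quartic_ln mulr0 addr0 subr0 subrr.
rewrite -[X in _ --> X]G0; apply: cvg_at_right0_comp_sqrt => //.
apply: cvgB; (apply: continuous_cvg; first apply: continuous_ln).
- exact: quadB_gt0.
- apply: cvgB; last by apply: cvgM; [exact: cvg_cst|exact: cvg_id].
  by apply: cvgD; [exact: exprn_continuous|exact: cvg_cst].
- exact: quad_gt0.
- apply: cvgD; last by apply: cvgM; [exact: cvg_cst|exact: cvg_id].
  by apply: cvgD; [exact: exprn_continuous|exact: cvg_cst].
Qed.

Let quartic_ln_cvgy c : 0 < c -> quartic_ln c (Num.sqrt s) @[s --> +oo] --> 0.
Proof.
move=> c0.
pose G w := ln (1 + c ^+ 2 / 2 * w ^+ 2 - c * w) - ln (1 + c ^+ 2 / 2 * w ^+ 2 + c * w).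
have G0 : G 0 = 0 by rewrite /G expr0n/= !mulr0 !addr0 subr0 subrr.
rewrite -[X in _ --> X]G0; apply: cvg_pinfty_comp_inv_sqrt.
- have cw : c * w @[w --> 0] --> c * 0 by apply: cvgM; [exact: cvg_cst|exact: cvg_id].
  have cw2 : 1 + c ^+ 2 / 2 * w ^+ 2 @[w --> 0] --> 1 + c ^+ 2 / 2 * 0 ^+ 2.
    apply: cvgD; first exact: cvg_cst.
    by apply: cvgM; [exact: cvg_cst|exact: exprn_continuous].
  apply: cvgB; (apply: continuous_cvg; first apply: continuous_ln).
  + by rewrite expr0n/= !mulr0 addr0 subr0.
  + exact: cvgB.
  + by rewrite expr0n/= !mulr0 !addr0.
  + exact: cvgD.
- move=> s s0; have r0 : 0 < Num.sqrt s by rewrite sqrtr_gt0.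
  rewrite /quartic_ln /G; move: (Num.sqrt s) r0 => r r0.
  have := quad_gt0 r c0; have := quadB_gt0 r c0 => q1 q2.
  have -> : 1 + c ^+ 2 / 2 * r^-1 ^+ 2 - c / r = (r ^+ 2 + c ^+ 2 / 2 - c * r) / r ^+ 2.
    by field; rewrite gt_eqF.
  have -> : 1 + c ^+ 2 / 2 * r^-1 ^+ 2 + c / r = (r ^+ 2 + c ^+ 2 / 2 + c * r) / r ^+ 2.
    by field; rewrite gt_eqF.
  rewrite !ln_div ?posrE ?exprn_gt0//; ring.
Qed.

Let continuous_quartic v s : 0 < v -> {for s, continuous (fun s => (s ^+ 2 + v ^+ 2)^-1)}.
Proof.
move=> v0; apply: cvgV; first by rewrite gt_eqF// ltr_wpDl ?sqr_ge0// exprn_gt0.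
by apply: cvgD; [exact: exprn_continuous|exact: cvg_cst].
Qed.

(** Only the arctangent part of the primitive contributes: the logarithmic
    part vanishes at both ends. *)
Lemma integral_sqrt_div_sqrD v : 0 < v ->
  (\int[mu]_(s in Rp) (Num.sqrt s / (s ^+ 2 + v ^+ 2))%:E = (pi / Num.sqrt (2 * v))%:E)%E.
Proof.
move=> v0; set c := Num.sqrt (2 * v).
have c0 : 0 < c by rewrite sqrtr_gt0 mulr_gt0.
have vE : v = c ^+ 2 / 2 by rewrite sqr_sqrtr ?mulr_ge0 ?ltW//; field.
pose F s := c^-1 * quartic_atan c (Num.sqrt s) + (2 * c)^-1 * quartic_ln c (Num.sqrt s).
apply: (@ge0_FTC_Rplus R F (fun s => Num.sqrt s / (s ^+ 2 + v ^+ 2))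
  (c^-1 * 0 + (2 * c)^-1 * 0) (c^-1 * pi + (2 * c)^-1 * 0) (pi / c)).
- by move=> s s0; rewrite divr_ge0 ?sqrtr_ge0// addr_ge0 ?sqr_ge0.
- move=> s s0; apply: cvgM; first exact: sqrt_continuous.
  exact: continuous_quartic.
- move=> s s0; have r0 : 0 < Num.sqrt s by rewrite sqrtr_gt0.
  have a1 := is_derive_quartic_atan c0 s0.
  have a2 := is_derive_quartic_ln c0 s0.
  apply: is_derive_eq; rewrite /GRing.scale/= -vE.
  have d0 : 0 < s ^+ 2 + v ^+ 2 by rewrite addr_gt0 ?exprn_gt0.
  move: (sqr_sqrtr (ltW s0)) r0 d0; generalize (Num.sqrt s) => r <- r0 d0.
  by field; rewrite !gt_eqF.
- by apply: cvgD; (apply: cvgM; first exact: cvg_cst); [exact: quartic_atan_cvg0|exact: quartic_ln_cvg0].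
- by apply: cvgD; (apply: cvgM; first exact: cvg_cst); [exact: quartic_atan_cvgy|exact: quartic_ln_cvgy].
- by field; rewrite gt_eqF.
Qed.

Lemma integral_inv_sqrt_sqrD v : 0 < v ->
  (\int[mu]_(s in Rp) ((Num.sqrt s)^-1 / (s ^+ 2 + v ^+ 2))%:E =
   (pi / (v * Num.sqrt (2 * v)))%:E)%E.
Proof.
move=> v0; set c := Num.sqrt (2 * v).
have c0 : 0 < c by rewrite sqrtr_gt0 mulr_gt0.
have vE : v = c ^+ 2 / 2 by rewrite sqr_sqrtr ?mulr_ge0 ?ltW//; field.
pose F s := (v * c)^-1 * quartic_atan c (Num.sqrt s) - (2 * v * c)^-1 * quartic_ln c (Num.sqrt s).
apply: (@ge0_FTC_Rplus R F (fun s => (Num.sqrt s)^-1 / (s ^+ 2 + v ^+ 2))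
  ((v * c)^-1 * 0 - (2 * v * c)^-1 * 0) ((v * c)^-1 * pi - (2 * v * c)^-1 * 0) (pi / (v * c))).
- by move=> s s0; rewrite divr_ge0 ?invr_ge0 ?sqrtr_ge0// addr_ge0 ?sqr_ge0.
- move=> s s0; apply: cvgM; last exact: continuous_quartic.
  apply: cvgV; last exact: sqrt_continuous.
  by rewrite gt_eqF// sqrtr_gt0.
- move=> s s0; have r0 : 0 < Num.sqrt s by rewrite sqrtr_gt0.
  have a1 := is_derive_quartic_atan c0 s0.
  have a2 := is_derive_quartic_ln c0 s0.
  apply: is_derive_eq; rewrite /GRing.scale/= -vE.
  have d0 : 0 < s ^+ 2 + v ^+ 2 by rewrite addr_gt0 ?exprn_gt0.
  move: (sqr_sqrtr (ltW s0)) r0 d0; generalize (Num.sqrt s) => r <- r0 d0.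
  by field; rewrite !gt_eqF.
- by apply: cvgB; (apply: cvgM; first exact: cvg_cst); [exact: quartic_atan_cvg0|exact: quartic_ln_cvg0].
- by apply: cvgB; (apply: cvgM; first exact: cvg_cst); [exact: quartic_atan_cvgy|exact: quartic_ln_cvgy].
- by field; rewrite !gt_eqF.
Qed.

End QuarticIntegrals.

(** * The three kernels *)

Section Kernels.
Context {R : realType}.
Notation mu := (@lebesgue_measure R).
Notation Rp := (@Rplus R).
Implicit Types (x t v s : R).

Definition stieltjes_kernel x t : R := (x + t)^-1.

(** The convolution square root of the logarithmic kernel. *)
Definition half_kernel x t : R := Num.sqrt x * Num.sqrt t / (x ^+ 2 + t ^+ 2).

Definition log_kernel x t : R :=
  Num.sqrt (x * t) * (ln x - ln t) / (x ^+ 2 - t ^+ 2).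

Let mQ : measurable (Rp `*` Rp) := measurableX measurable_Rplus measurable_Rplus.
Let m1 : measurable_fun (Rp `*` Rp) (fun z : R * R => z.1).
Proof. by apply: measurable_funTS; exact: measurable_fst. Qed.
Let m2 : measurable_fun (Rp `*` Rp) (fun z : R * R => z.2).
Proof. by apply: measurable_funTS; exact: measurable_snd. Qed.

Let minv (h : R * R -> R) : measurable_fun (Rp `*` Rp) h ->
  measurable_fun (Rp `*` Rp) (fun z => (h z)^-1).
Proof. by move=> mh; exact: measurableT_comp (@measurable_invr R setT) mh. Qed.
Let msqrt (h : R * R -> R) : measurable_fun (Rp `*` Rp) h ->
  measurable_fun (Rp `*` Rp) (fun z => Num.sqrt (h z)).
Proof. by move=> mh; exact: measurableT_comp (@measurable_sqrtr R setT) mh. Qed.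
Lemma measurable_section (k : R -> R -> R) x : 0 < x ->
  measurable_fun (Rp `*` Rp) (fun z => k z.1 z.2) -> measurable_fun Rp (k x).
Proof.
move=> x0 mk; apply: (measurable_comp mQ _ mk (g := fun t => (x, t))).
- by move=> _ [t /= t0 <-]; split => //=; rewrite RplusE.
- apply: measurable_funTS; apply: measurable_fun_pair => //.
Qed.

Lemma schur_stieltjes : schur_kernel stieltjes_kernel pi.
Proof.
have mk : measurable_fun (Rp `*` Rp) (fun z : R * R => stieltjes_kernel z.1 z.2).
  by apply: minv; exact: measurable_funD.
split => //.
- by move=> x t x0 t0; rewrite invr_ge0 addr_ge0 ?ltW.
- by move=> x t _ _; rewrite /stieltjes_kernel addrC.
- exact: pi_gt0.
- by move=> x x0; rewrite integral_stieltjes_weight.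
- move=> x x0; split; first exact: measurable_section.
  by rewrite /energy integral_inv_Dsqr// ltry.
Qed.

Let half_ge0 x t : 0 <= half_kernel x t.
Proof. by rewrite divr_ge0 ?mulr_ge0 ?sqrtr_ge0// addr_ge0 ?sqr_ge0. Qed.

Lemma schur_half : schur_kernel half_kernel (pi / 2).
Proof.
have mk : measurable_fun (Rp `*` Rp) (fun z : R * R => half_kernel z.1 z.2).
  apply: measurable_funM.
    by apply: measurable_funM; exact: msqrt.
  by apply: minv; apply: measurable_funD; exact: measurable_funX.
split => //.
- by move=> x t _ _; rewrite /half_kernel addrC [_ * Num.sqrt t]mulrC.
- by rewrite divr_gt0// pi_gt0.
- move=> x x0; have sx : 0 < Num.sqrt x by rewrite sqrtr_gt0.
  rewrite (_ : integral _ _ _ =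
      \int[mu]_(t in Rp) ((Num.sqrt x)%:E * ((x ^+ 2 + t ^+ 2)^-1)%:E))%E; last first.
    apply: eq_integral => t; rewrite inE RplusE => t0; rewrite -EFinM; congr EFin.
    rewrite /half_kernel; have st : 0 < Num.sqrt t by rewrite sqrtr_gt0.
    by field; rewrite !gt_eqF// addr_gt0 ?exprn_gt0.
  rewrite ge0_integralZl_EFin ?sqrtr_ge0//.
  + rewrite integral_inv_sqrD// -EFinM lee_fin le_eqVlt; apply/orP; left; apply/eqP.
    rewrite -[X in 2 * X](sqr_sqrtr (ltW x0)).
    by field; rewrite gt_eqF.
  + exact: measurable_Rplus.
  + by move=> t _; rewrite lee_fin invr_ge0 addr_ge0 ?sqr_ge0.
  + apply/measurable_EFinP; apply: measurableT_comp (@measurable_invr R setT) _.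
    by apply: measurable_funD => //; exact: measurable_funX.
- move=> x x0; split; first exact: measurable_section.
  rewrite (@le_lt_trans _ _ ((2 * x)^-1)%:E) ?ltry//.
  rewrite -(integral_x_inv_sqrD_sqr x0) le_eqVlt; apply/orP; left; apply/eqP.
  apply: eq_integral => t; rewrite inE RplusE => t0; congr EFin.
  by rewrite /half_kernel expr_div_n exprMn !sqr_sqrtr ?ltW.
Qed.

Lemma half_kernel_sqr x t : 0 < x -> 0 < t -> x != t ->
  (\int[mu]_(v in Rp) (half_kernel x v * half_kernel v t)%:E = (log_kernel x t)%:E)%E.
Proof.
move=> x0 t0 xt.
rewrite (_ : integral _ _ _ = \int[mu]_(v in Rp) ((Num.sqrt (x * t))%:E *
    (v / ((x ^+ 2 + v ^+ 2) * (v ^+ 2 + t ^+ 2)))%:E))%E; last first.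
  apply: eq_integral => v; rewrite inE RplusE => v0; rewrite -EFinM; congr EFin.
  rewrite /half_kernel sqrtrM ?ltW//.
  rewrite -[X in X / (_ * _)](sqr_sqrtr (ltW v0)).
  by field; rewrite !gt_eqF// addr_gt0 ?exprn_gt0.
rewrite ge0_integralZl_EFin ?sqrtr_ge0//.
- by rewrite integral_log_kernel// -EFinM mulrA.
- exact: measurable_Rplus.
- by move=> v /=; rewrite RplusE => v0; rewrite lee_fin divr_ge0 ?ltW// mulr_gt0// addr_gt0 ?exprn_gt0.
- apply/measurable_EFinP; apply: measurable_funM => //.
  apply: measurableT_comp (@measurable_invr R setT) _.
  by apply: measurable_funM; apply: measurable_funD => //; exact: measurable_funX.
Qed.

(** The kernel identities fail or are undefined on the diagonal, which is
    negligible in each variable. *)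
Lemma ae_neq (x : R) (D : set R) (P : R -> Prop) :
  (forall t, D t -> x != t -> P t) -> {ae mu, forall t, D t -> P t}.
Proof.
move=> DP; exists [set x]; split.
- exact: measurable_set1.
- exact: lebesgue_measure_set1.
- move=> t /= nP; apply/eqP; rewrite eq_sym; apply: contrapT => /negP xt.
  by apply: nP => Dt; exact: DP.
Qed.

End Kernels.

(** * Composition of the kernels *)

Section KernelIdentity.
Context {R : realType}.
Notation mu := (@lebesgue_measure R).
Notation Rp := (@Rplus R).
Implicit Types (x t v s : R).
Local Notation S := (@stieltjes_kernel R).
Local Notation B := (@half_kernel R).
Local Notation K := (@log_kernel R).

Let mRp := @measurable_Rplus R.

(** Absolutely convergent integrals with their value, so that partial
    fractions can be integrated term by term with [has_integral_lin]. *)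
Definition has_integral (f : R -> R) (r : R) :=
  mu.-integrable Rp (fun x => (f x)%:E) /\ (\int[mu]_(x in Rp) (f x)%:E = r%:E)%E.

Lemma ge0_has_integral (f : R -> R) (r : R) : measurable_fun Rp f -> (forall x, 0 < x -> 0 <= f x) ->
  (\int[mu]_(x in Rp) (f x)%:E = r%:E)%E -> has_integral f r.
Proof.
move=> mf f0 fr; split => //; apply/integrableP; split; first exact/measurable_EFinP.
rewrite (_ : integral _ _ _ = r%:E) ?ltry// -fr.
by apply: eq_integral => x; rewrite inE RplusE => x0; rewrite abse_EFin ger0_norm ?f0.
Qed.

Lemma has_integral_lin (a b : R) (f g : R -> R) (r1 r2 : R) : has_integral f r1 -> has_integral g r2 ->
  has_integral (fun x => a * f x + b * g x) (a * r1 + b * r2).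
Proof.
move=> [fi fr] [gi gr].
have ai : mu.-integrable Rp (fun x => a%:E * (f x)%:E)%E by exact: integrableZl.
have bi : mu.-integrable Rp (fun x => b%:E * (g x)%:E)%E by exact: integrableZl.
split.
  rewrite (_ : (fun x => _) = (fun x => a%:E * (f x)%:E) \+ (fun x => b%:E * (g x)%:E))%E.
    exact: integrableD.
  by apply/funext => x; rewrite /= -!EFinM -EFinD.
transitivity (\int[mu]_(x in Rp) (a%:E * (f x)%:E + b%:E * (g x)%:E))%E.
  by apply: eq_integral => x _; rewrite -!EFinM -EFinD.
by rewrite integralD// !integralZl// fr gr -!EFinM -EFinD.
Qed.

Lemma eq_has_integral (f g : R -> R) (r1 r2 : R) : (forall x, 0 < x -> f x = g x) -> r1 = r2 ->
  has_integral f r1 -> has_integral g r2.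
Proof.
move=> fg <- [fi fr]; split.
  apply/integrableP; move/integrableP : fi => [mf foo]; split.
    by apply: eq_measurable_fun mf => x; rewrite inE RplusE => /fg ->.
  rewrite (_ : integral _ _ _ = \int[mu]_(x in Rp) `|(f x)%:E|)%E//.
  by apply: eq_integral => x; rewrite inE RplusE => /fg ->.
by rewrite -fr; apply: eq_integral => x; rewrite inE RplusE => /fg ->.
Qed.

Let minv (f : R -> R) : measurable_fun Rp f -> measurable_fun Rp (fun z => (f z)^-1).
Proof. by move=> mh; exact: measurableT_comp (@measurable_invr R setT) mh. Qed.
Let msqrt : measurable_fun Rp (@Num.sqrt R).
Proof. exact: measurable_sqrtr. Qed.
Let mquad v : measurable_fun Rp (fun s : R => (s ^+ 2 + v ^+ 2)^-1).
Proof. by apply: minv; apply: measurable_funD => //; exact: measurable_funX. Qed.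

Let sqrt2M v : Num.sqrt (2 * v) = Num.sqrt 2 * Num.sqrt v.
Proof. by rewrite sqrtrM. Qed.

Let I1 v : 0 < v -> has_integral (fun s => Num.sqrt s / (s ^+ 2 + v ^+ 2)) (pi / Num.sqrt (2 * v)).
Proof.
move=> v0; apply: ge0_has_integral; last exact: integral_sqrt_div_sqrD.
- exact: measurable_funM.
- by move=> s s0; rewrite divr_ge0 ?sqrtr_ge0// addr_ge0 ?sqr_ge0.
Qed.

Let I2 v : 0 < v -> has_integral (fun s => (Num.sqrt s)^-1 / (s ^+ 2 + v ^+ 2))
  (pi / (v * Num.sqrt (2 * v))).
Proof.
move=> v0; apply: ge0_has_integral; last exact: integral_inv_sqrt_sqrD.
- by apply: measurable_funM => //; exact: minv.
- by move=> s s0; rewrite divr_ge0 ?invr_ge0 ?sqrtr_ge0// addr_ge0 ?sqr_ge0.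
Qed.

Let I3 x : 0 < x -> has_integral (fun s => (x + s)^-1 * (Num.sqrt s)^-1) (pi * (Num.sqrt x)^-1).
Proof.
move=> x0; apply: ge0_has_integral; last exact: integral_stieltjes_weight.
- by apply: measurable_funM; [apply: minv; exact: measurable_funD|exact: minv].
- by move=> s s0; rewrite mulr_ge0 ?invr_ge0 ?sqrtr_ge0// addr_ge0 ?ltW.
Qed.

(** S B = (pi / sqrt 2) Q - pi B, where Q (x, v) = (x + v) / (x^2 + v^2). By
    partial fractions in s, the integrand is sqrt v / (x^2 + v^2) times x
    sqrt s / (s^2 + v^2) + v^2 / (sqrt s (s^2 + v^2)) - x / ((x + s) sqrt
    s). *)
Lemma has_integral_stieltjes_half x v : 0 < x -> 0 < v ->
  has_integral (fun s => S x s * B s v)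
    (pi / Num.sqrt 2 * ((x + v) / (x ^+ 2 + v ^+ 2)) - pi * B x v).
Proof.
move=> x0 v0.
have xv : 0 < x ^+ 2 + v ^+ 2 by rewrite addr_gt0 ?exprn_gt0.
have h := has_integral_lin 1 (- x) (has_integral_lin x (v ^+ 2) (I1 v0) (I2 v0)) (I3 x0).
have {h} := has_integral_lin (Num.sqrt v / (x ^+ 2 + v ^+ 2)) 0 h h.
apply: eq_has_integral.
- move=> s s0; rewrite /stieltjes_kernel /half_kernel.
  have : 0 < Num.sqrt s by rewrite sqrtr_gt0.
  move: (sqr_sqrtr (ltW s0)); generalize (Num.sqrt s) => p sp p0.
  rewrite -sp; rewrite -sp in s0.
  by field; rewrite !gt_eqF// ?addr_gt0 ?exprn_gt0//.
- rewrite /half_kernel sqrt2M.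
  have : 0 < Num.sqrt x by rewrite sqrtr_gt0.
  have : 0 < Num.sqrt v by rewrite sqrtr_gt0.
  have : 0 < Num.sqrt 2 :> R by rewrite sqrtr_gt0.
  move: (sqr_sqrtr (ltW x0)) (sqr_sqrtr (ltW v0)) xv.
  generalize (Num.sqrt x) (Num.sqrt v) (Num.sqrt 2 : R) (pi : R) => p q d P <- <- xv d0 q0 p0.
  by field; rewrite !gt_eqF.
Qed.

(** Q B = (pi / sqrt 2) S, again by partial fractions, now between v^2 + x^2
    and v^2 + t^2. *)
Lemma has_integral_half_stieltjes x t : 0 < x -> 0 < t -> x != t ->
  has_integral (fun v => (x + v) / (x ^+ 2 + v ^+ 2) * B v t) (pi / Num.sqrt 2 * S x t).
Proof.
move=> x0 t0 xt.
have xt2 : x ^+ 2 - t ^+ 2 != 0.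
  by rewrite subr_sqr mulf_neq0// ?subr_eq0// gt_eqF// addr_gt0.
have h1 := has_integral_lin x (- t ^+ 2) (I1 t0) (I2 t0).
have h2 := has_integral_lin (- x) (x ^+ 2) (I1 x0) (I2 x0).
have := has_integral_lin (Num.sqrt t / (x ^+ 2 - t ^+ 2)) (Num.sqrt t / (x ^+ 2 - t ^+ 2)) h1 h2.
apply: eq_has_integral.
- move=> v v0; rewrite /half_kernel.
  have : 0 < Num.sqrt v by rewrite sqrtr_gt0.
  move: (sqr_sqrtr (ltW v0)); generalize (Num.sqrt v) => p sp p0.
  rewrite -sp; rewrite -sp in v0.
  by field; rewrite xt2 !gt_eqF// ?addr_gt0 ?exprn_gt0//.
- rewrite /stieltjes_kernel !sqrt2M.
  have xt0 : 0 < x + t by rewrite addr_gt0.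
  have : 0 < Num.sqrt x by rewrite sqrtr_gt0.
  have : 0 < Num.sqrt t by rewrite sqrtr_gt0.
  have : 0 < Num.sqrt 2 :> R by rewrite sqrtr_gt0.
  move: (sqr_sqrtr (ltW x0)) (sqr_sqrtr (ltW t0)) xt2 xt0.
  generalize (Num.sqrt x) (Num.sqrt t) (Num.sqrt 2 : R) (pi : R) => p q d P <- <- xt2 xt0 d0 q0 p0.
  by field; rewrite xt2 !gt_eqF.
Qed.

Lemma has_integral_half_sqr x t : 0 < x -> 0 < t -> x != t ->
  has_integral (fun v => B x v * B v t) (K x t).
Proof.
move=> x0 t0 xt; have sB := @schur_half R.
apply: ge0_has_integral; last exact: half_kernel_sqr.
- apply: measurable_funM; first by case: (schur_row sB x0).
  apply: eq_measurable_fun (proj1 (schur_row sB t0)) => v; rewrite inE RplusE => v0.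
  exact: schur_sym sB _ _ t0 v0.
- by move=> v v0; rewrite mulr_ge0// (schur_ge0 sB).
Qed.

Lemma log_kernel_ge0 x t : 0 < x -> 0 < t -> 0 <= K x t.
Proof.
move=> x0 t0; have [->|xt] := eqVneq x t; first by rewrite /log_kernel !subrr mulr0 mul0r.
rewrite -lee_fin -half_kernel_sqr//; apply: integral_ge0 => v; rewrite RplusE => v0.
by rewrite lee_fin mulr_ge0// (schur_ge0 (@schur_half R)).
Qed.

Lemma log_kernel_sym x t : K x t = K t x.
Proof.
rewrite /log_kernel [x * t]mulrC -!mulrA; congr (_ * _).
by rewrite -[RHS]mulrNN -invrN !opprB.
Qed.

Lemma measurable_log_kernel :
  measurable_fun (Rp `*` Rp) (fun z : R * R => K z.1 z.2).
Proof.
have m1 : measurable_fun (Rp `*` Rp) (fun z : R * R => z.1).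
  by apply: measurable_funTS; exact: measurable_fst.
have m2 : measurable_fun (Rp `*` Rp) (fun z : R * R => z.2).
  by apply: measurable_funTS; exact: measurable_snd.
apply: measurable_funM.
  apply: measurable_funM.
    by apply: measurableT_comp (@measurable_sqrtr R setT) _; exact: measurable_funM.
  by apply: measurable_funB; exact: measurableT_comp (@measurable_ln R) _.
apply: measurableT_comp (@measurable_invr R setT) _.
by apply: measurable_funB; exact: measurable_funX.
Qed.

Let measurable_half2 x : 0 < x -> measurable_fun (Rp `*` Rp)
  (fun z : R * R => (B x z.2 * B z.2 z.1)%:E).
Proof.
move=> x0; apply/measurable_EFinP; apply: measurable_funM.
  by apply: measurable_quadrant_snd; case: (schur_row (@schur_half R) x0).
exact: (measurable_quadrant_swap (schur_meas (@schur_half R))).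
Qed.

(** Positivity, the weight bound and the energy of the rows come from K = B B:
    the constant is the square of that of B by Tonelli, and the row of K at x
    is, off the diagonal, the image under B of the row of B at x. *)
Lemma schur_log : schur_kernel K ((pi / 2) ^+ 2).
Proof.
have sB := @schur_half R.
have B0 x t : 0 < x -> 0 < t -> 0 <= B x t by exact: (schur_ge0 sB).
have C0 := schur_cst sB.
split.
- exact: measurable_log_kernel.
- exact: log_kernel_ge0.
- by move=> x t _ _; exact: log_kernel_sym.
- by rewrite exprn_gt0.
- move=> x x0.
  pose h (z : R * R) := ((Num.sqrt z.1)^-1 * (B x z.2 * B z.2 z.1))%:E.
  have mh : measurable_fun (Rp `*` Rp) h.
    apply/measurable_EFinP; apply: measurable_funM.
      exact: (measurable_quadrant_fst (minv msqrt)).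
    by apply/measurable_EFinP; exact: measurable_half2.
  have h0 t v : 0 < t -> 0 < v -> (0 <= h (t, v))%E.
    move=> t0 v0; rewrite lee_fin mulr_ge0 ?invr_ge0 ?sqrtr_ge0//.
    by rewrite mulr_ge0 ?B0.
  have mBv v : 0 < v -> measurable_fun Rp (B v) by move=> v0; case: (schur_row sB v0).
  have mBV v : 0 < v -> measurable_fun Rp (B ^~ v).
    move=> v0; apply: eq_measurable_fun (mBv v v0) => s; rewrite inE RplusE => s0.
    exact: schur_sym sB _ _ v0 s0.
  have -> : (\int[mu]_(t in Rp) (K x t / Num.sqrt t)%:E =
      \int[mu]_(t in Rp) \int[mu]_(v in Rp) h (t, v))%E.
    apply: ge0_ae_eq_integral => //.
    + apply/measurable_EFinP; apply: measurable_funM; last exact: minv.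
      exact: measurable_section measurable_log_kernel.
    + exact: measurable_integral_Rplus.
    + by move=> t; rewrite RplusE => t0; rewrite lee_fin divr_ge0 ?sqrtr_ge0// log_kernel_ge0.
    + by move=> t; rewrite RplusE => t0; apply: integral_ge0 => v; rewrite RplusE => v0; exact: h0.
    + apply: (@ae_neq _ x) => t; rewrite RplusE => t0 xt.
      rewrite EFinM -half_kernel_sqr// muleC -ge0_integralZl_EFin ?invr_ge0 ?sqrtr_ge0//.
      * by move=> v; rewrite RplusE => v0; rewrite lee_fin mulr_ge0 ?B0.
      * apply/measurable_EFinP; apply: measurable_funM; [exact: mBv|exact: mBV].
  rewrite tonelli_Rplus//.
  apply: (@le_trans _ _ (\int[mu]_(v in Rp) ((pi / 2)%:E * (B x v * (Num.sqrt v)^-1)%:E))%E).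
    apply: ge0_le_integral => //.
    + by move=> v; rewrite RplusE => v0; apply: integral_ge0 => t; rewrite RplusE => t0; exact: h0.
    + apply: (@measurable_integral_Rplus _ (fun z => h (z.2, z.1))).
      exact: measurable_quadrant_swap.
    + by apply: measurable_funeM; apply/measurable_EFinP; apply: measurable_funM; [exact: mBv|exact: minv].
    + move=> v; rewrite RplusE => v0.
      have -> : (\int[mu]_(t in Rp) h (t, v) = \int[mu]_(t in Rp) ((B x v)%:E * (B v t * (Num.sqrt t)^-1)%:E))%E.
        by apply: eq_integral => t _; rewrite -EFinM; congr EFin; ring.
      rewrite ge0_integralZl_EFin ?B0//.
      * apply: (@le_trans _ _ ((B x v)%:E * (pi / 2 * (Num.sqrt v)^-1)%:E)%E); last first.
          by rewrite -!EFinM mulrCA.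
        apply: lee_wpmul2l; first by rewrite lee_fin B0.
        exact: (schur_bound sB).
      * by move=> t; rewrite RplusE => t0; rewrite lee_fin divr_ge0 ?sqrtr_ge0// B0.
      * by apply/measurable_EFinP; apply: measurable_funM; [exact: mBv|exact: minv].
  rewrite ge0_integralZl_EFin ?(ltW C0)//.
  + apply: (@le_trans _ _ ((pi / 2)%:E * (pi / 2 / Num.sqrt x)%:E)%E); last first.
      by rewrite -EFinM lee_fin le_eqVlt; apply/orP; left; apply/eqP; ring.
    apply: lee_wpmul2l; first by rewrite lee_fin ltW.
    exact: (schur_bound sB).
  + by move=> t; rewrite RplusE => t0; rewrite lee_fin divr_ge0 ?sqrtr_ge0// B0.
  + by apply/measurable_EFinP; apply: measurable_funM; [exact: mBv|exact: minv].
- move=> x x0; have sr := schur_row sB x0.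
  have [mr er] := sqint_kint sB sr.
  have mK := measurable_section x0 measurable_log_kernel.
  split => //; rewrite (ae_eq_energy mK mr)//.
  apply: (@ae_neq _ x) => t; rewrite RplusE => t0 xt.
  rewrite /kint /Rintegral; apply: EFin_inj; rewrite -half_kernel_sqr//.
  have [_ iE] := has_integral_half_sqr x0 t0 xt.
  rewrite iE; congr EFin; rewrite -[LHS]/(fine (K x t)%:E) -iE; congr fine.
  apply: eq_integral => v; rewrite inE RplusE => v0.
  by rewrite (schur_sym sB t0 v0) mulrC.
Qed.

(** S K = S B B = (pi / sqrt 2) Q B - pi B B = (pi^2 / 2) S - pi K: the
    identity that makes 1/2 - K / pi^2 the inverse of 2 + (2 / pi) S. *)
Lemma has_integral_stieltjes_log x t : 0 < x -> 0 < t -> x != t ->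
  has_integral (fun s => S x s * K s t) (pi ^+ 2 / 2 * S x t - pi * K x t).
Proof.
move=> x0 t0 xt; have sB := @schur_half R; have sS := @schur_stieltjes R.
have B0 y z : 0 < y -> 0 < z -> 0 <= B y z by exact: (schur_ge0 sB).
have S0 y z : 0 < y -> 0 < z -> 0 <= S y z by exact: (schur_ge0 sS).
have mBv v : 0 < v -> measurable_fun Rp (B v) by move=> v0; case: (schur_row sB v0).
have mBV v : 0 < v -> measurable_fun Rp (B ^~ v).
  move=> v0; apply: eq_measurable_fun (mBv v v0) => s; rewrite inE RplusE => s0.
  exact: schur_sym sB _ _ v0 s0.
have mSx : measurable_fun Rp (S x) by case: (schur_row sS x0).
have mK : measurable_fun Rp (K ^~ t).
  apply: eq_measurable_fun (measurable_section t0 measurable_log_kernel) => s _.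
  exact: log_kernel_sym.
apply: ge0_has_integral.
- exact: measurable_funM.
- by move=> s s0; rewrite mulr_ge0 ?S0 ?log_kernel_ge0.
pose h (z : R * R) := (S x z.1 * B z.1 z.2 * B z.2 t)%:E.
have mh : measurable_fun (Rp `*` Rp) h.
  apply/measurable_EFinP; apply: measurable_funM.
    apply: measurable_funM; first exact: measurable_quadrant_fst.
    exact: (schur_meas sB).
  exact: (measurable_quadrant_snd (mBV t t0)).
have h0 s v : 0 < s -> 0 < v -> (0 <= h (s, v))%E.
  by move=> s0 v0; rewrite lee_fin mulr_ge0 ?B0// mulr_ge0 ?S0 ?B0.
transitivity (\int[mu]_(s in Rp) \int[mu]_(v in Rp) h (s, v))%E.
  apply: ge0_ae_eq_integral => //.
  + by apply/measurable_EFinP; exact: measurable_funM.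
  + exact: measurable_integral_Rplus.
  + by move=> s; rewrite RplusE => s0; rewrite lee_fin mulr_ge0 ?S0 ?log_kernel_ge0.
  + by move=> s; rewrite RplusE => s0; apply: integral_ge0 => v; rewrite RplusE => v0; exact: h0.
  + apply: (@ae_neq _ t) => s; rewrite RplusE => s0 ts.
    rewrite EFinM -half_kernel_sqr//; last by rewrite eq_sym.
    rewrite -ge0_integralZl_EFin ?S0//.
    * by apply: eq_integral => v _; rewrite -EFinM /h/= mulrA.
    * by move=> v; rewrite RplusE => v0; rewrite lee_fin mulr_ge0 ?B0.
    * apply/measurable_EFinP; apply: measurable_funM; [exact: mBv|exact: mBV].
rewrite tonelli_Rplus//.
have := has_integral_lin (pi / Num.sqrt 2) (- pi) (has_integral_half_stieltjes x0 t0 xt)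
  (has_integral_half_sqr x0 t0 xt).
move=> /(eq_has_integral (g := fun v => (pi / Num.sqrt 2 * ((x + v) / (x ^+ 2 + v ^+ 2)) - pi * B x v) * B v t)
   (r2 := pi ^+ 2 / 2 * S x t - pi * K x t)) [].
- by move=> v _; ring.
- have -> : pi ^+ 2 / 2 = (pi / Num.sqrt 2) ^+ 2 :> R by rewrite expr_div_n sqr_sqrtr.
  ring.
move=> _ <-; apply: eq_integral => v; rewrite inE RplusE => v0.
have [_ iE] := has_integral_stieltjes_half x0 v0.
rewrite EFinM -iE muleC -ge0_integralZl_EFin ?B0//.
- by apply: eq_integral => s _; rewrite -EFinM /h/= mulrC.
- by move=> s; rewrite RplusE => s0; rewrite lee_fin mulr_ge0 ?S0 ?B0.
- by apply/measurable_EFinP; apply: measurable_funM => //; exact: mBV.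
Qed.

End KernelIdentity.

(** * Inversion and bounds for real functions *)

Section RealOperators.
Context {R : realType}.
Notation mu := (@lebesgue_measure R).
Notation Rp := (@Rplus R).
Implicit Types (x t v s : R) (f g : R -> R).
Local Notation S := (@stieltjes_kernel R).
Local Notation K := (@log_kernel R).

Let mRp := @measurable_Rplus R.

(** Transfers a linear relation between a composed kernel and two kernels to
    the operators. *)
Lemma kint_combination (k k1 k2 k3 : R -> R -> R) C1 C2 C3 C4 (a b : R) f x :
  schur_kernel k C1 -> schur_kernel k1 C2 -> schur_kernel k2 C3 -> schur_kernel k3 C4 ->
  (forall t, 0 < t -> x != t ->
     has_integral (fun s => k x s * k1 s t) (a * k2 x t + b * k3 x t)) ->
  sqint f -> 0 < x ->
  kint k (kint k1 f) x = a * kint k2 f x + b * kint k3 f x.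
Proof.
move=> sk sk1 sk2 sk3 H sf x0; rewrite (kint_comp sk sk1 sf x0).
have i2 := kint_integrable sk2 sf x0; have i3 := kint_integrable sk3 sf x0.
have ai : mu.-integrable Rp (fun t => a%:E * (k2 x t * f t)%:E)%E by exact: integrableZl.
have bi : mu.-integrable Rp (fun t => b%:E * (k3 x t * f t)%:E)%E by exact: integrableZl.
have E : a * kint k2 f x + b * kint k3 f x =
    \int[mu]_(t in Rp) (a * (k2 x t * f t) + b * (k3 x t * f t)).
  by rewrite RintegralD ?RintegralZl.
rewrite E; congr fine; apply: ae_eq_integral.
- exact: measurable_Rplus.
- apply/measurable_EFinP; apply: measurable_funM; last by case: sf.
  have [mf _] := sf.
  pose h (z : R * R) := (k x z.2 * k1 z.2 z.1)%:E.
  have mh : measurable_fun (Rp `*` Rp) h.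
    apply/measurable_EFinP; apply: measurable_funM.
      exact: (measurable_quadrant_snd (proj1 (schur_row sk x0))).
    exact: (measurable_quadrant_swap (schur_meas sk1)).
  have := measurable_integral_Rplus mh.
  exact: measurableT_comp.
- apply/measurable_EFinP; apply: measurable_funD; apply: measurable_funM => //;
  apply: measurable_funM.
  + by case: (schur_row sk2 x0).
  + by case: sf.
  + by case: (schur_row sk3 x0).
  + by case: sf.
- apply: (@ae_neq _ x) => t; rewrite RplusE => t0 xt; congr EFin.
  rewrite {1}/kint /Rintegral; have [_ ->] := H t t0 xt.
  by rewrite /=; ring.
Qed.

Lemma kint_stieltjes_log f x : sqint f -> 0 < x ->
  kint S (kint K f) x = pi ^+ 2 / 2 * kint S f x - pi * kint K f x.
Proof.
move=> sf x0; have sS := @schur_stieltjes R; have sK := @schur_log R.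
rewrite -mulNr; apply: (kint_combination sS sK sS sK) => // t t0 xt.
by have := has_integral_stieltjes_log x0 t0 xt; rewrite mulNr.
Qed.

Lemma kint_log_stieltjes f x : sqint f -> 0 < x ->
  kint K (kint S f) x = pi ^+ 2 / 2 * kint S f x - pi * kint K f x.
Proof.
move=> sf x0; have sS := @schur_stieltjes R; have sK := @schur_log R.
rewrite -mulNr; apply: (kint_combination sK sS sS sK) => // t t0 xt.
have tx : t != x by rewrite eq_sym.
apply: eq_has_integral (has_integral_stieltjes_log t0 x0 tx).
- by move=> s s0; rewrite mulrC log_kernel_sym (schur_sym sS t0 s0).
- by rewrite mulNr log_kernel_sym (schur_sym sS t0 x0).
Qed.

Definition hartley2 f x : R := 2 * f x + 2 / pi * kint S f x.
Definition hartley2_inv f x : R := 2^-1 * f x + - (pi ^+ 2)^-1 * kint K f x.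

Let pi_neq0 : (pi : R) != 0. Proof. by rewrite gt_eqF// pi_gt0. Qed.

(** The coefficients of S f and of K f both cancel: 1 / pi - (2 / pi^3)
    (pi^2 / 2) = 0 and - 2 / pi^2 + (2 / pi^3) pi = 0. *)
Lemma hartley2K f x : sqint f -> 0 < x -> hartley2_inv (hartley2 f) x = f x.
Proof.
move=> sf x0; have sSf := sqint_kint (@schur_stieltjes R) sf.
rewrite /hartley2_inv (kint_lin 2 (2 / pi) (@schur_log R) sf sSf x0).
rewrite kint_log_stieltjes// /hartley2.
by move: pi_neq0; generalize (pi : R) => p p0; field.
Qed.

Lemma hartley2_invK f x : sqint f -> 0 < x -> hartley2 (hartley2_inv f) x = f x.
Proof.
move=> sf x0; have sKf := sqint_kint (@schur_log R) sf.
rewrite /hartley2 (kint_lin 2^-1 (- (pi ^+ 2)^-1) (@schur_stieltjes R) sf sKf x0).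
rewrite kint_stieltjes_log// /hartley2_inv.
by move: pi_neq0; generalize (pi : R) => p p0; field.
Qed.

Let le_energy_lin a b C c f g : measurable_fun Rp f -> measurable_fun Rp g ->
  (energy g <= C%:E * energy f)%E -> 0 <= C -> 2 * a ^+ 2 + 2 * b ^+ 2 * C <= c ->
  (energy (fun x => (a * f x + b * g x)%R) <= c%:E * energy f)%E.
Proof.
move=> mf mg gf C0 abc; apply: le_trans (energy_lin a b mf mg) _.
have p2 (d : R) : (0 <= 2 * d ^+ 2)%R by rewrite mulr_ge0// sqr_ge0.
apply: (@le_trans _ _ ((2 * a ^+ 2)%:E * energy f + (2 * b ^+ 2)%:E * (C%:E * energy f))%E).
  by rewrite leeD2l// lee_wpmul2l// lee_fin.
rewrite muleA -EFinM -ge0_muleDl; [|by rewrite lee_fin|by rewrite lee_fin mulr_ge0].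
by apply: lee_wpmul2r; [exact: energy_ge0|rewrite -EFinD lee_fin].
Qed.

(** The constant is 2 (2)^2 + 2 (2 / pi)^2 pi^2 = 16. *)
Lemma energy_hartley2 f : sqint f -> (energy (hartley2 f) <= 16%:E * energy f)%E.
Proof.
move=> sf; have [mf _] := sf; have sS := @schur_stieltjes R.
apply: le_energy_lin mf _ (energy_kint sS sf) _ _.
- by case: (sqint_kint sS sf).
- exact: sqr_ge0.
- rewrite le_eqVlt; apply/orP; left; apply/eqP.
  by move: pi_neq0; generalize (pi : R) => p p0; field.
Qed.

(** The constant 2 (1 / 2)^2 + 2 (1 / pi^2)^2 (pi / 2)^4 = 5 / 8 is at most
    1; this is the lower bound of the norm equivalence. *)
Lemma energy_hartley2_inv f : sqint f -> (energy (hartley2_inv f) <= energy f)%E.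
Proof.
move=> sf; have [mf _] := sf; have sK := @schur_log R.
rewrite -[leRHS]mul1e; apply: le_energy_lin mf _ (energy_kint sK sf) _ _.
- by case: (sqint_kint sK sf).
- exact: sqr_ge0.
- rewrite (_ : _ + _ = 5 / 8); first by lra.
  by move: pi_neq0; generalize (pi : R) => p p0; field.
Qed.

End RealOperators.

(** * Steklov averages *)

Section SteklovAverage.
Context {R : realType}.
Notation mu := (@lebesgue_measure R).
Notation Rp := (@Rplus R).
Implicit Types (f g : R -> R) (a b h x y M : R).

Let mRp := @measurable_Rplus R.

(** The class in which the smoothing takes place: it contains the
    truncations of any square-integrable function, and Steklov averaging
    preserves it as long as the step is at most a / 2. *)
Definition bounded_csupp f a b M :=
  [/\ measurable_fun setT f, 0 < a < b, 0 <= M, (forall x, `|f x| <= M) &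
      forall x, ~~ (a <= x <= b) -> f x = 0].

Definition primitive f x : R := \int[mu]_(t in `]-oo, x]) f t.

(** The mean of f over [x, x + h]. Each application gains one derivative. *)
Definition steklov f h x : R := (primitive f (x + h) - primitive f x) / h.

Lemma bounded_csupp_integrable f a b M : bounded_csupp f a b M ->
  mu.-integrable setT (EFin \o f).
Proof.
move=> [mf /andP[a0 ab] M0 fM f0].
have -> : f = f \_ `[a, b].
  apply/funext => x; rewrite patchE; case: ifPn => // /negP xab.
  by rewrite f0//; apply/negP => xI; apply: xab; rewrite inE/= in_itv.
rewrite -restrict_EFin; apply/integrable_restrict => //.
rewrite setTI; apply: measurable_bounded_integrable => //.
- by rewrite /= lebesgue_measure_itv/= lte_fin ab -EFinD ltry.
- exact: measurable_funTS.
- exists M; split; first exact: num_real.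
  by move=> y My x _ /=; rewrite (le_trans (fM x))// ltW.
Qed.

Lemma primitive_diff f a b M x y : bounded_csupp f a b M -> x <= y ->
  primitive f y - primitive f x = \int[mu]_(t in `]x, y]) f t.
Proof.
move=> bf xy; apply: Rintegral_itvB => //.
by apply: integrableS (bounded_csupp_integrable bf).
Qed.

Lemma primitive_lipschitz f a b M x y : bounded_csupp f a b M -> x <= y ->
  `|primitive f y - primitive f x| <= M * (y - x).
Proof.
move=> bf xy; rewrite (primitive_diff bf xy).
have fi := bounded_csupp_integrable bf.
have [mf ab M0 fM f0] := bf.
have fi' : mu.-integrable `]x, y] (EFin \o f) by apply: integrableS fi.
apply: le_trans (le_normr_Rintegral _ fi') _ => //.
have muxy : mu `]x, y] = (y - x)%:E.
  rewrite /= lebesgue_measure_itv/= lte_fin; case: ltP => //.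
  by move=> yx; have -> : x = y by [apply/le_anti/andP]; rewrite subrr.
have -> : M * (y - x) = \int[mu]_(t in `]x, y]) M.
  by rewrite Rintegral_cst// [X in fine X]muxy.
apply: le_Rintegral => //.
- exact: integrable_norm.
- apply: measurable_bounded_integrable => //; first by rewrite [X in (X < _)%E]muxy ltry.
  exists M; split; first exact: num_real.
  by move=> z Mz t _ /=; rewrite ger0_norm// ltW.
Qed.

Lemma steklov_le f a b M h x : bounded_csupp f a b M -> 0 < h -> `|steklov f h x| <= M.
Proof.
move=> bf h0; rewrite normrM normfV (gtr0_norm h0) ler_pdivrMr//.
have := @primitive_lipschitz f a b M x (x + h) bf; rewrite lerDl ltW// => /(_ isT).
by rewrite addrAC subrr add0r.
Qed.

Lemma continuous_primitive f a b M : bounded_csupp f a b M -> continuous (primitive f).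
Proof.
move=> bf x; apply/cvgrPdist_le => e e0.
have [_ _ M0 _ _] := bf.
have M1 : 0 < M + 1 by rewrite ltr_wpDl.
near=> y.
apply: (@le_trans _ _ (M * `|x - y|)).
  have [xy|/ltW yx] := leP x y.
  - by rewrite distrC (ler0_norm (x := x - y)) ?subr_le0// opprB (primitive_lipschitz bf xy).
  - by rewrite (ger0_norm (x := x - y)) ?subr_ge0// (primitive_lipschitz bf yx).
have : `|x - y| <= e / (M + 1).
  by near: y; apply: cvgr_dist_le; [exact: cvg_id|rewrite divr_gt0].
rewrite ler_pdivlMr// => H; apply: le_trans H.
by rewrite mulrC ler_wpM2l// lerDl.
Unshelve. all: by end_near. Qed.

Lemma continuous_steklov f a b M h : bounded_csupp f a b M -> continuous (steklov f h).
Proof.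
move=> bf x; have cF := continuous_primitive bf.
apply: cvgM; last exact: cvg_cst.
apply: cvgB; last exact: cF.
apply: continuous_cvg; first exact: cF.
by apply: cvgD; [exact: cvg_id|exact: cvg_cst].
Qed.

Lemma steklov_csupp f a b M h : bounded_csupp f a b M -> 0 < h <= a / 2 ->
  bounded_csupp (steklov f h) (a / 2) b M.
Proof.
move=> bf /andP[h0 ha]; have [mf /andP[a0 ab] M0 fM f0] := bf; split=> //.
- by apply: continuous_measurable_fun; exact: continuous_steklov bf.
- by rewrite divr_gt0//=; lra.
- by move=> x; exact: steklov_le bf h0.
- move=> x xab; rewrite /steklov (@primitive_diff f a b M)//; last by rewrite lerDl ltW.
  rewrite (_ : Rintegral _ _ _ = 0) ?mul0r//.
  rewrite /Rintegral integral0_eq// => t /=; rewrite in_itv/= => /andP[xt th].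
  congr EFin; apply: f0; apply: contra xab => /andP[at_ tb].
  by apply/andP; split; lra.
Qed.

Lemma is_derive_primitive f a b M x : bounded_csupp f a b M -> {for x, continuous f} ->
  is_derive x 1 (primitive f) (f x).
Proof.
move=> bf cf.
have fi : mu.-integrable `]-oo, (x + 1)] (EFin \o f).
  by apply: integrableS (bounded_csupp_integrable bf).
have [] := @continuous_FTC1 R f -oo%O x (x + 1) _ fi _ cf.
- by rewrite ltrDl.
- by rewrite ltNyr.
- by move=> df <-; rewrite derive1E; exact: derivableP.
Qed.

Lemma is_derive_shift_add f (df h x : R) : is_derive (x + h) 1 f df ->
  is_derive x 1 (fun y => f (y + h)) df.
Proof.
move=> fx; have a1 : is_derive x 1 (fun y : R => y + h) 1.
  by apply: is_derive_eq; ring.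
by have := @is_derive1_comp _ f (fun y => y + h) x _ _ fx a1; rewrite mulr1.
Qed.

Lemma is_derive_steklov f a b M h x : bounded_csupp f a b M -> continuous f ->
  is_derive x 1 (steklov f h) ((f (x + h) - f x) / h).
Proof.
move=> bf cf.
have a1 := is_derive_primitive bf (cf x).
have a2 := is_derive_shift_add (is_derive_primitive bf (cf (x + h))).
rewrite /steklov; apply: is_derive_eq; rewrite /GRing.scale/=; ring.
Qed.

End SteklovAverage.

(** * Density of compactly supported C^2 functions *)

Section Density.
Context {R : realType}.
Notation mu := (@lebesgue_measure R).
Notation Rp := (@Rplus R).
Implicit Types (f g phi : R -> R) (a b h x y M : R).

Let mRp := @measurable_Rplus R.

Lemma energy_dominated_cvg (u : nat -> R -> R) g :
  (forall n, measurable_fun Rp (u n)) -> sqint g ->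
  (forall n x, 0 < x -> `|u n x| <= `|g x|) ->
  {ae mu, forall x, Rp x -> u n x @[n --> \oo] --> 0} ->
  energy (u n) @[n --> \oo] --> 0%E.
Proof.
move=> mu_ sg ug u0.
have ig : mu.-integrable Rp (fun x => (g x ^+ 2)%:E).
  have := sqint_integrableM sg sg.
  by under eq_fun do rewrite -expr2.
have mf : forall n, measurable_fun Rp (fun x => (u n x ^+ 2)%:E).
  by move=> n; apply/measurable_EFinP/measurable_funX.
have cf : {ae mu, forall x, Rp x -> (u n x ^+ 2)%:E @[n --> \oo] --> (cst 0%E : R -> \bar R) x}.
  apply: filterS u0; first exact: (ae_filter_ringOfSetsType mu).
  move=> x ux /ux {}ux; apply/fine_cvgP; split; first exact: nearW.
  rewrite -[X in _ --> X](mul0r (0 : R)); under eq_fun do rewrite /= expr2.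
  exact: cvgM.
have fg : {ae mu, forall x n, Rp x -> (`|(u n x ^+ 2)%:E| <= (g x ^+ 2)%:E)%E}.
  apply: aeW => x n; rewrite RplusE => x0; rewrite abse_EFin lee_fin.
  rewrite normrX -[leRHS](real_normK (num_real (g x))).
  by rewrite lerXn2r ?nnegrE// ug.
have [_ _] := @dominated_convergence _ (measurableTypeR R) R lebesgue_measure Rp
  (measurable_itv _) _ _ _ mf (measurable_cst _) cf ig fg.
by rewrite integral0.
Qed.

Lemma energy_dominated_small (u : nat -> R -> R) g (e : R) :
  (forall n, measurable_fun Rp (u n)) -> sqint g ->
  (forall n x, 0 < x -> `|u n x| <= `|g x|) ->
  {ae mu, forall x, Rp x -> u n x @[n --> \oo] --> 0} -> 0 < e ->
  exists n, (energy (u n) <= e%:E)%E.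
Proof.
move=> mu_ sg ug u0 e0.
have := energy_dominated_cvg mu_ sg ug u0.
move=> /fine_cvgP[fin /cvgr0Pnorm_le/(_ e e0) small].
near \oo => n; exists n.
have fn : energy (u n) \is a fin_num by near: n.
rewrite -(fineK fn) lee_fin; apply: le_trans (ler_norm _) _.
by near: n.
Unshelve. all: by end_near. Qed.

(** This is the Lebesgue differentiation theorem. *)
Lemma ae_cvg_steklov f a b M (d : R) : bounded_csupp f a b M -> 0 < d ->
  {ae mu, forall x, steklov f (d / n.+1%:R) x @[n --> \oo] --> f x}.
Proof.
move=> bf d0; have fi := bounded_csupp_integrable bf.
have locf : locally_integrable setT f.
  by apply: open_integrable_locally => //; exact: openT.
have fiy y : mu.-integrable `]-oo, y] (EFin \o f) by apply: integrableS fi.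
apply: filterS (FTC1Ny fiy locf); first exact: (ae_filter_ringOfSetsType mu).
move=> x [dF <-].
have {dF} : h^-1 *: (primitive f (h + x) - primitive f x) @[h --> 0^'] -->
    derive1 (primitive f) x.
  move/cvg_ex : dF => [l hl]; rewrite /derive1.
  have {}hl : h^-1 *: (primitive f (h + x) - primitive f x) @[h --> 0^'] --> l.
    by move: hl; under eq_fun do rewrite /= scaler1.
  by rewrite (cvg_lim (@Rhausdorff R) hl).
move/cvgr_dnbhsP => /(_ (fun n => d / n.+1%:R)).
have dn0 n : d / n.+1%:R != 0 by rewrite gt_eqF// divr_gt0.
have dnc : d / n.+1%:R @[n --> \oo] --> 0.
  rewrite -[X in _ --> X](mulr0 d); apply: cvgM; first exact: cvg_cst.
  exact: cvg_harmonic.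
move=> /(_ (conj dn0 dnc)).
rewrite /steklov; apply: cvg_trans; apply: near_eq_cvg; apply: nearW => n /=.
by rewrite [_ + x]addrC /GRing.scale/= mulrC.
Qed.

Lemma bounded_csupp_sqint f a b M : bounded_csupp f a b M -> sqint f.
Proof.
move=> [mf ab M0 fM f0]; split; first exact: measurable_funTS.
have b2 : bounded_csupp (fun x => f x ^+ 2) a b (M ^+ 2).
  split => //; first exact: measurable_funX.
  - by rewrite sqr_ge0.
  - by move=> x; rewrite normrX lerXn2r// nnegrE.
  - by move=> x /f0 ->; rewrite expr0n.
apply: integrable_lty => //.
by apply: integrableS (bounded_csupp_integrable b2).
Qed.

(** Almost everywhere convergence upgrades to convergence of the energy
    because the averages stay below M on a fixed interval. *)
Lemma steklov_approx f a b M (e : R) : bounded_csupp f a b M -> 0 < e ->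
  exists2 h, 0 < h <= a / 2 & (energy (fun x => f x - steklov f h x)%R <= e%:E)%E.
Proof.
move=> bf e0; have [mf /andP[a0 ab] M0 fM f0] := bf.
have a20 : 0 < a / 2 by rewrite divr_gt0.
have hn n : 0 < a / 2 / n.+1%:R <= a / 2.
  by rewrite divr_gt0//= ler_pdivrMr// ler_peMr ?ler1n// ltW.
pose g x := M *+ 2 * \1_(`[a / 2, b]%classic : set R) x.
have bg : bounded_csupp g (a / 2) b (M *+ 2).
  split.
  - by apply: measurable_funM => //; exact: measurable_indic.
  - by rewrite a20/=; lra.
  - by rewrite mulrn_wge0.
  - move=> x; rewrite normrM ger0_norm ?mulrn_wge0// indicE.
    by case: (_ \in _); rewrite ?normr1 ?normr0 ?mulr1 ?mulr0// mulrn_wge0.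
  - move=> x xab; rewrite /g indicE memNset ?mulr0//=.
    by rewrite in_itv/=; apply/negP.
have [|n x x0||n en] := @energy_dominated_small
    (fun n x => f x - steklov f (a / 2 / n.+1%:R) x) g e _ (bounded_csupp_sqint bg) _ _ e0.
- move=> n; apply: measurable_funB; first exact: measurable_funTS.
  apply: measurable_funTS; apply: continuous_measurable_fun.
  exact: continuous_steklov bf.
- have [_ _ _ sM s0] := steklov_csupp bf (hn n).
  have [xab|xab] := boolP (a / 2 <= x <= b); last first.
    rewrite s0// f0 ?subr0 ?normr0//; apply: contra xab => /andP[? ->].
    by rewrite andbT; lra.
  rewrite /g indicE mem_set//= mulr1 [leRHS]ger0_norm ?mulrn_wge0//.
  by rewrite (le_trans (ler_normB _ _))// mulr2n lerD.
- apply: filterS (ae_cvg_steklov bf a20); first exact: (ae_filter_ringOfSetsType mu).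
  move=> x sx _; rewrite -[X in _ --> X](subrr (f x)).
  by apply: cvgB => //; exact: cvg_cst.
- by exists (a / 2 / n.+1%:R).
Qed.

Lemma truncation_approx f (e : R) : sqint f -> 0 < e ->
  exists g a b M, bounded_csupp g a b M /\ (energy (fun x => f x - g x)%R <= e%:E)%E.
Proof.
move=> sf e0; have [mf ef] := sf.
pose F := f \_ Rp.
have mF : measurable_fun setT F by apply/(measurable_restrictT _ mRp).
(* Cut off both the domain and the values; F is f extended by 0. *)
pose A n : set R := `[n.+2%:R^-1, n.+2%:R]%classic `&` [set x | `|F x| <= n%:R].
have mA n : measurable (A n).
  apply: measurableI => //.
  rewrite -[X in measurable X]setTI; apply: measurable_fun_ler => //.
  exact: measurableT_comp.
pose u n x := F x * \1_(A n) x.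
have bu n : bounded_csupp (u n) n.+2%:R^-1 n.+2%:R n%:R.
  split.
  - by apply: measurable_funM => //; exact: measurable_indic.
  - by rewrite invr_gt0 ltr0n/= (@lt_trans _ _ 1)// ?invf_lt1// ?ltr1n.
  - exact: ler0n.
  - move=> x; rewrite /u indicE; have [/set_mem[_ /= ?]|_] := boolP (x \in A n).
      by rewrite mulr1.
    by rewrite mulr0 normr0.
  - move=> x xab; rewrite /u indicE memNset ?mulr0//= => -[/= + _].
    by rewrite in_itv/=; apply/negP.
have Ff x : 0 < x -> F x = f x by move=> x0; rewrite /F patchE mem_set// RplusE.
have [|n x x0||n en] := @energy_dominated_small
    (fun n x => f x - u n x) f e _ sf _ _ e0.
- move=> n; apply: measurable_funB => //.
  by apply: measurable_funTS; case: (bu n).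
- rewrite /u indicE Ff//; case: (_ \in _); first by rewrite mulr1 subrr normr0.
  by rewrite mulr0 subr0.
- apply: aeW => x; rewrite RplusE => x0.
  apply: cvg_near_cst.
  have [m xm] : exists m, (x + x^-1 + `|f x| <= m%:R)%R.
    exists (Num.bound (x + x^-1 + `|f x|)); apply/ltW/archi_boundP.
    by rewrite !addr_ge0 ?invr_ge0// ltW.
  near=> n.
  have xn : x + x^-1 + `|f x| <= n%:R.
    by apply: le_trans xm _; rewrite ler_nat; near: n; exists m.
  have nn : n%:R <= n.+2%:R :> R by rewrite ler_nat -addn2 leq_addr.
  have xi : 0 < x^-1 by rewrite invr_gt0.
  have f0 := normr_ge0 (f x).
  rewrite /u indicE mem_set ?mulr1 ?Ff ?subrr//; split => /=.
    rewrite in_itv/=; apply/andP; split; last by lra.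
    by rewrite -[leRHS]invrK lef_pV2 ?posrE ?ltr0n//; lra.
  by rewrite Ff//; lra.
- by exists (u n), n.+2%:R^-1, n.+2%:R, n%:R.
Unshelve. all: by end_near. Qed.

(** Truncate, then average three times: the averages are successively
    continuous, C^1 and C^2, and each step costs an arbitrarily small
    energy. *)
Lemma C2_csupp_dense f (e : R) : sqint f -> 0 < e ->
  exists phi a b M, [/\ C2_Rplus phi, bounded_csupp phi a b M &
    (energy (fun x => f x - phi x)%R <= e%:E)%E].
Proof.
move=> sf e0; have d0 : 0 < e / 22 by rewrite divr_gt0.
have [f1 [a1 [b1 [M1 [B1 E1]]]]] := truncation_approx sf d0.
have [h1 H1 E2] := steklov_approx B1 d0.
set f2 := steklov f1 h1; have B2 := steklov_csupp B1 H1; rewrite -/f2 in E2 B2.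
have c2 : continuous f2 by exact: continuous_steklov B1.
have [h2 H2 E3] := steklov_approx B2 d0.
set f3 := steklov f2 h2; have B3 := steklov_csupp B2 H2; rewrite -/f3 in E3 B3.
have c3 : continuous f3 by exact: continuous_steklov B2.
have D3 x : is_derive x 1 f3 ((f2 (x + h2) - f2 x) / h2) by exact: is_derive_steklov B2 c2.
have [h3 H3 E4] := steklov_approx B3 d0.
set f4 := steklov f3 h3; have B4 := steklov_csupp B3 H3; rewrite -/f4 in E4 B4.
have D4 x : is_derive x 1 f4 ((f3 (x + h3) - f3 x) / h3) by exact: is_derive_steklov B3 c3.
have d4 : derive1 f4 = (fun x => (f3 (x + h3) - f3 x) / h3).
  by apply/funext => x; rewrite derive1E; apply: derive_val.
have D5 x : is_derive x 1 (derive1 f4)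
    (((f2 (x + h3 + h2) - f2 (x + h3)) / h2 - (f2 (x + h2) - f2 x) / h2) / h3).
  rewrite d4; have k1 := D3 x; have k2 := is_derive_shift_add (D3 (x + h3)).
  by apply: is_derive_eq; rewrite /GRing.scale/=; ring.
have d5 : derive1n 2 f4 = (fun x =>
    ((f2 (x + h3 + h2) - f2 (x + h3)) / h2 - (f2 (x + h2) - f2 x) / h2) / h3).
  apply/funext => x; rewrite -[LHS]/(derive1 (derive1 f4) x) derive1E.
  by apply: derive_val.
(* Each use of (p + q)^2 <= 2 p^2 + 2 q^2 combines two errors; over four
   errors d the total is 2 d + 2 (2 d + 2 (2 d + 2 d)) = 22 d, whence the e /
   22. *)
exists f4; do 3 eexists; split; last first.
- have sq := bounded_csupp_sqint.
  have m0 : measurable_fun Rp f by case: sf.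
  have [m1 _] := sq _ _ _ _ B1; have [m2 _] := sq _ _ _ _ B2.
  have [m3 _] := sq _ _ _ _ B3; have [m4 _] := sq _ _ _ _ B4.
  have comb g1 g2 g3 (p q : R) : measurable_fun Rp g1 -> measurable_fun Rp g2 ->
      measurable_fun Rp g3 ->
      (energy (fun x => g1 x - g2 x)%R <= p%:E)%E -> (energy (fun x => g2 x - g3 x)%R <= q%:E)%E ->
      (energy (fun x => g1 x - g3 x)%R <= (2 * p + 2 * q)%:E)%E.
    move=> n1 n2 n3 hp hq.
    have := energy_lin 1 1 (measurable_funB n1 n2) (measurable_funB n2 n3).
    rewrite expr1n !mulr1 (@eq_energy _ _ (fun x => g1 x - g3 x)); last first.
      by move=> x _; rewrite !mul1r addrA subrK.
    move=> /le_trans; apply.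
    have -> : (2 * p + 2 * q)%:E = (2%:E * p%:E + 2%:E * q%:E)%E by [].
    by apply: leeD; apply: lee_wpmul2l.
  have r34 := comb _ _ _ _ _ m2 m3 m4 E3 E4.
  have r24 := comb _ _ _ _ _ m1 m2 m4 E2 r34.
  have := comb _ _ _ _ _ m0 m1 m4 E1 r24.
  move/le_trans; apply; rewrite lee_fin; lra.
- exact: B4.
- move=> x x0; split.
  + by case: (D4 x).
  + by case: (D5 x).
  + rewrite d5.
    have cs (c : R) : {for x, continuous (fun y => f2 (y + c))}.
      apply: continuous_cvg; first exact: c2.
      by apply: cvgD; [exact: cvg_id|exact: cvg_cst].
    have cs2 (c d : R) : {for x, continuous (fun y => f2 (y + c + d))}.
      apply: continuous_cvg; first exact: c2.
      by apply: cvgD; [apply: cvgD; [exact: cvg_id|exact: cvg_cst]|exact: cvg_cst].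
    apply: cvgM; last exact: cvg_cst.
    apply: cvgB; (apply: cvgM; last exact: cvg_cst); apply: cvgB.
    * exact: cs2.
    * exact: cs.
    * exact: cs.
    * exact: c2.
Qed.

End Density.

(** * Damped trigonometric integrals *)

Section DampedTrigonometric.
Context {R : realType}.
Notation mu := (@lebesgue_measure R).
Notation Rp := (@Rplus R).
Implicit Types (c e p q s x y : R).

Let mRp := @measurable_Rplus R.

Lemma cvgy_expRN e : 0 < e -> expR (- (e * s)) @[s --> +oo] --> (0 : R).
Proof.
move=> e0; apply: (cvg_comp (fun s => e * s) (fun y => expR (- y))); last exact: cvgr_expR.
by apply/cvgryPge => A; near=> s; rewrite mulrC -ler_pdivrMr.
Unshelve. all: by end_near. Qed.

Let is_derive_expRN e s : is_derive s 1 (fun s => expR (- (e * s))) (- e * expR (- (e * s))).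
Proof.
have a1 : is_derive s 1 (fun s => - (e * s)) (- e).
  by apply: is_derive_eq; rewrite /GRing.scale/=; ring.
have := @is_derive1_comp _ (@expR R) (fun s => - (e * s)) s _ _ (is_derive_expR _) a1.
by rewrite mulrC.
Qed.

Let is_derive_cosM c s : is_derive s 1 (fun s => cos (c * s)) (- c * sin (c * s)).
Proof.
have a1 : is_derive s 1 (fun s => c * s) c.
  by apply: is_derive_eq; rewrite /GRing.scale/=; ring.
have := @is_derive1_comp _ (@cos R) (fun s => c * s) s _ _ (is_derive_cos _) a1.
by rewrite mulrC mulrN mulNr.
Qed.

Let is_derive_sinM c s : is_derive s 1 (fun s => sin (c * s)) (c * cos (c * s)).
Proof.
have a1 : is_derive s 1 (fun s => c * s) c.
  by apply: is_derive_eq; rewrite /GRing.scale/=; ring.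
have := @is_derive1_comp _ (@sin R) (fun s => c * s) s _ _ (is_derive_sin _) a1.
by rewrite mulrC.
Qed.

Lemma has_integral_expRN e : 0 < e -> has_integral (fun s => expR (- (e * s))) e^-1.
Proof.
move=> e0; pose F s := - e^-1 * expR (- (e * s)).
have ce s : {for s, continuous (fun s => expR (- (e * s)))}.
  exact: is_derive_continuous (is_derive_expRN e s).
apply: ge0_has_integral.
- by apply: measurable_funTS; exact: continuous_measurable_fun.
- by move=> s _; exact: expR_ge0.
apply: (@ge0_FTC_Rplus R F (fun s => expR (- (e * s))) (F 0) (- e^-1 * 0) e^-1).
- by move=> s _; exact: expR_ge0.
- by move=> s _; exact: ce.
- move=> s _; have a1 := is_derive_expRN e s; rewrite /F.
  by apply: is_derive_eq; rewrite /GRing.scale/=; field; rewrite gt_eqF.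
- apply: cvg_at_right_filter; apply: cvgM; first exact: cvg_cst.
  exact: ce.
- by apply: cvgM; [exact: cvg_cst|exact: cvgy_expRN].
- by rewrite /F !mulr0 oppr0 expR0; ring.
Qed.

(** Adding exp (- e s) to the integrand makes it nonnegative, so that the
    fundamental theorem of calculus for nonnegative functions on the half-
    line applies; the added part is then subtracted. *)
Lemma has_integral_damped c e p q : 0 < e ->
  (forall y, -1 <= p * cos y + q * sin y) ->
  has_integral (fun s => expR (- (e * s)) * (p * cos (c * s) + q * sin (c * s)))
    ((e * p + c * q) / (e ^+ 2 + c ^+ 2)).
Proof.
move=> e0 pq.
have D0 : 0 < e ^+ 2 + c ^+ 2 by rewrite ltr_pwDl ?exprn_gt0// sqr_ge0.
(* P and Q are the coefficients of the primitive exp (- e s) (P cos (c s) + Q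
   sin (c s)) of the trigonometric part. *)
pose P := - (e * p + c * q) / (e ^+ 2 + c ^+ 2).
pose Q := (c * p - e * q) / (e ^+ 2 + c ^+ 2).
pose f s := expR (- (e * s)) * (1 + (p * cos (c * s) + q * sin (c * s))).
pose F s := expR (- (e * s)) * (P * cos (c * s) + Q * sin (c * s) - e^-1).
have dF s : is_derive s 1 F (f s).
  have a1 := is_derive_expRN e s; have a2 := is_derive_cosM c s.
  have a3 := is_derive_sinM c s; rewrite /F /f.
  apply: is_derive_eq; rewrite /GRing.scale/= /P /Q.
  by field; rewrite !gt_eqF.
have cf s : {for s, continuous f}.
  apply: cvgM; first exact: is_derive_continuous (is_derive_expRN e s).
  apply: cvgD; first exact: cvg_cst.
  apply: cvgD; (apply: cvgM; first exact: cvg_cst).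
    exact: is_derive_continuous (is_derive_cosM c s).
  exact: is_derive_continuous (is_derive_sinM c s).
have f0 s : 0 <= f s.
  by rewrite mulr_ge0 ?expR_ge0//; have := pq (c * s); lra.
have fi : has_integral f (e^-1 - P).
  apply: ge0_has_integral => //.
    by apply: measurable_funTS; exact: continuous_measurable_fun.
  apply: (@ge0_FTC_Rplus R F f (F 0) 0 (e^-1 - P)) => //.
  - by apply: cvg_at_right_filter; exact: is_derive_continuous (dF 0).
  - apply/cvgr0Pnorm_lt => d d0.
    pose C := `|P| + `|Q| + e^-1.
    have C0 : 0 < C by rewrite ltr_wpDl ?invr_gt0// addr_ge0.
    near=> s.
    have es : expR (- (e * s)) < d / C.
      rewrite -[ltLHS]ger0_norm ?expR_ge0//; near: s.
      by move/cvgr0Pnorm_lt : (cvgy_expRN e0); apply; rewrite divr_gt0.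
    rewrite normrM ger0_norm ?expR_ge0//.
    apply: le_lt_trans (_ : _ <= expR (- (e * s)) * C) _; last by rewrite -ltr_pdivlMr.
    apply: ler_wpM2l; first exact: expR_ge0.
    have ei : 0 <= e^-1 by rewrite invr_ge0 ltW.
    apply: le_trans (ler_normB _ _) _; rewrite (ger0_norm ei).
    rewrite /C lerD2r; apply: le_trans (ler_normD _ _) _; rewrite !normrM.
    by apply: lerD; rewrite ler_piMr// ler_norml ?cos_geN1 ?cos_le1 ?sin_geN1 ?sin_le1.
  - by rewrite /F !mulr0 oppr0 expR0 cos0 sin0; ring.
apply: eq_has_integral (has_integral_lin 1 (-1) fi (has_integral_expRN e0)).
- by move=> s _; rewrite /f; ring.
- by rewrite /P; ring.
Unshelve. all: by end_near. Qed.

Definition cas y : R := cos y + sin y.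

Lemma cas_le2 y : `|cas y| <= 2.
Proof.
apply: le_trans (ler_normD _ _) _; rewrite (_ : 2 = 1 + 1 :> R); last by lra.
by apply: lerD; rewrite ler_norml ?cos_geN1 ?cos_le1 ?sin_geN1 ?sin_le1.
Qed.

(** The product formula cas (x s) cas (s t) = cos ((x - t) s) + sin ((x + t)
    s) turns the damped product kernel into a Poisson kernel plus a
    conjugate Poisson kernel. *)
Lemma has_integral_damped_cas e x t : 0 < e ->
  has_integral (fun s => expR (- (e * s)) * (cas (x * s) * cas (s * t)))
    (e / (e ^+ 2 + (x - t) ^+ 2) + (x + t) / (e ^+ 2 + (x + t) ^+ 2)).
Proof.
move=> e0.
have c1 y : -1 <= 1 * cos y + 0 * sin y by rewrite mul1r mul0r addr0 cos_geN1.
have s1 y : -1 <= 0 * cos y + 1 * sin y by rewrite mul1r mul0r add0r sin_geN1.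
have h1 := @has_integral_damped (x - t) e 1 0 e0 c1.
have h2 := @has_integral_damped (x + t) e 0 1 e0 s1.
apply: eq_has_integral (has_integral_lin 1 1 h1 h2) => //.
- move=> s s0; rewrite /cas.
  have -> : (x - t) * s = x * s - s * t by ring.
  have -> : (x + t) * s = x * s + s * t by ring.
  by rewrite (cosB (x * s)) (sinD (x * s) (s * t)); ring.
- by rewrite !mulr0 !mulr1 !addr0 !add0r !mul1r.
Qed.

End DampedTrigonometric.

(** * Decay of the transform of a test function *)

Section CompactlySupported.
Context {R : realType}.
Notation mu := (@lebesgue_measure R).
Notation Rp := (@Rplus R).
Implicit Types (a b s t x y : R).

Let mRp := @measurable_Rplus R.

Lemma compact_Rplus_itv (K : set R) : compact K -> K `<=` Rp ->
  exists a b, 0 < a < b /\ forall x, K x -> a <= x <= b.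
Proof.
move=> cK KR.
have [M [Mr MK]] := compact_bounded cK.
have cV : compact [set x^-1 | x in K].
  apply: continuous_compact => //; apply: continuous_in_subspaceT => x /set_mem/KR.
  by rewrite RplusE => x0; apply: inv_continuous; rewrite gt_eqF.
have [N [Nr NK]] := compact_bounded cV.
pose m := `|M| + 1; pose n := `|N| + 1.
have n0 : 0 < n by rewrite ltr_wpDl.
have Mm : M < m by rewrite (le_lt_trans (ler_norm _))// ltrDl.
have Nn : N < n by rewrite (le_lt_trans (ler_norm _))// ltrDl.
exists n^-1, (m + n^-1); split.
  by rewrite invr_gt0 n0/= ltrDr ltr_wpDl.
move=> x Kx; have x0 : 0 < x by have := KR x Kx; rewrite RplusE.
have : `|x| <= m := MK m Mm x Kx; rewrite (gtr0_norm x0) => xm.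
have : `|x^-1| <= n := NK n Nn x^-1 (ex_intro2 _ _ x Kx erefl).
have xi0 : 0 < x^-1 by rewrite invr_gt0.
rewrite (gtr0_norm xi0) => xn.
rewrite (le_trans xm) ?lerDl ?invr_ge0 ?(ltW n0)// andbT.
by rewrite -[leRHS]invrK lef_pV2.
Qed.

Lemma norm_Rintegral_itv_le (h : R -> R) a b (M : R) : a <= b ->
  {within `[a, b], continuous h} -> (forall t, a <= t <= b -> `|h t| <= M) ->
  `|\int[mu]_(t in `[a, b]) h t| <= M * (b - a).
Proof.
move=> ab ch hM.
have hi : mu.-integrable `[a, b] (EFin \o h).
  by apply: continuous_compact_integrable => //; exact: segment_compact.
apply: le_trans (le_normr_Rintegral _ hi) _ => //.
have muab : mu `[a, b] = (b - a)%:E.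
  rewrite /= lebesgue_measure_itv/= lte_fin; case: ltP => //.
  by move=> ba; have -> : a = b by [apply/le_anti/andP]; rewrite subrr.
have -> : M * (b - a) = \int[mu]_(t in `[a, b]) M.
  by rewrite Rintegral_cst// [X in fine X]muab.
apply: le_Rintegral => //.
- exact: integrable_norm.
- apply: continuous_compact_integrable; first exact: segment_compact.
  by apply: continuous_subspaceT => z; exact: cvg_cst.
Qed.

Lemma within_continuous_pos (h : R -> R) a b : 0 < a ->
  (forall t, 0 < t -> {for t, continuous h}) -> {within `[a, b], continuous h}.
Proof.
move=> a0 ch; apply: continuous_in_subspaceT => t /set_mem /=; rewrite in_itv/=.
by move=> /andP[at_ _]; apply: ch; exact: lt_le_trans at_.
Qed.

Lemma continuous_bounded_itv (h : R -> R) a b : 0 < a -> a <= b ->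
  (forall t, 0 < t -> {for t, continuous h}) ->
  exists2 M : R, 0 <= M & forall t, a <= t <= b -> `|h t| <= M.
Proof.
move=> a0 ab ch.
have cn : {within `[a, b], continuous (fun t => `|h t|)}.
  apply: within_continuous_pos => // t t0.
  by apply: continuous_cvg; [exact: norm_continuous|exact: ch].
have [c _ cM] := EVT_max ab cn.
by exists `|h c| => // t tab; apply: cM; rewrite in_itv.
Qed.

Lemma continuous_pos_measurable (h : R -> R) :
  (forall t, 0 < t -> {for t, continuous h}) -> measurable_fun Rp h.
Proof.
move=> ch; apply: open_continuous_measurable_fun; first exact: interval_open.
by move=> t /set_mem; rewrite RplusE; exact: ch.
Qed.

Lemma continuous_cas : continuous (@cas R).
Proof. by move=> y; apply: cvgD; [exact: continuous_cos|exact: continuous_sin]. Qed.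

Lemma integrable_bounded_mul (u g : R -> R) (M : R) : measurable_fun Rp u ->
  (forall t, 0 < t -> `|u t| <= M) -> mu.-integrable Rp (fun t => (g t)%:E) ->
  mu.-integrable Rp (fun t => (u t * g t)%:E).
Proof.
move=> mu_ uM gi.
have mg : measurable_fun Rp g by apply/measurable_EFinP; exact: measurable_int gi.
have Mgi : mu.-integrable Rp (fun t => M%:E * (g t)%:E)%E by exact: integrableZl.
apply: le_integrable Mgi => //.
- by apply/measurable_EFinP; exact: measurable_funM.
- move=> t; rewrite RplusE => t0; rewrite -EFinM !abse_EFin lee_fin !normrM.
  by apply: ler_wpM2r => //; apply: le_trans (uM t t0) _; exact: ler_norm.
Qed.

Lemma measurable_cas_section x : measurable_fun Rp (fun t => cas (x * t)).
Proof.
apply: measurable_funTS; apply: continuous_measurable_fun => t.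
apply: continuous_cvg; first exact: continuous_cas.
by apply: cvgM; [exact: cvg_cst|exact: cvg_id].
Qed.

Lemma measurable_cas_kernel : measurable_fun (Rp `*` Rp) (fun z : R * R => cas (z.1 * z.2)).
Proof.
apply: (measurableT_comp (continuous_measurable_fun continuous_cas)).
apply: measurable_funTS; apply: measurable_funM.
- exact: measurable_fst.
- exact: measurable_snd.
Qed.

(** The transform without its normalising factor sqrt (2 / pi). *)
Definition hartley (f : R -> R) (x : R) : R := kint (fun x t => cas (x * t)) f x.

Section TestFunction.
Context (f : R -> R) (a b : R).
Context (a_gt0 : 0 < a) (ab : a < b).
Context (f_supp : forall x, 0 < x -> ~~ (a <= x <= b) -> f x = 0).
Context (C2f : C2_Rplus f).

Let f1 := derive1 f.
Let f2 := derive1 (derive1 f).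

Let dF x : 0 < x -> is_derive x 1 f (f1 x).
Proof.
move=> x0; have [d1 _ _] := C2f x0.
by rewrite /f1 derive1E; exact: derivableP.
Qed.

Let dF1 x : 0 < x -> is_derive x 1 f1 (f2 x).
Proof.
move=> x0; have [_ d2 _] := C2f x0.
by rewrite /f2 derive1E; exact: derivableP.
Qed.

Let cf x : 0 < x -> {for x, continuous f}.
Proof. by move=> x0; exact: is_derive_continuous (dF x0). Qed.

Let cf1 x : 0 < x -> {for x, continuous f1}.
Proof. by move=> x0; exact: is_derive_continuous (dF1 x0). Qed.

Let cf2 x : 0 < x -> {for x, continuous f2}.
Proof. by move=> x0; have [_ _] := C2f x0. Qed.

Let f1_supp x : 0 < x -> ~~ (a <= x <= b) -> f1 x = 0.
Proof.
move=> x0 xab.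
suff : is_derive x 1 f 0 by move=> d0; rewrite /f1 derive1E; exact: derive_val.
apply: (@near_eq_is_derive _ _ _ (cst 0) f x 1 0).
move: xab; rewrite negb_and -!ltNge => /orP[xa|bx]; near=> y.
- rewrite /= f_supp//; first by near: y; exact: lt_nbhsr.
  by rewrite negb_and -!ltNge; apply/orP; left; near: y; exact: lt_nbhsl.
- rewrite /= f_supp//; first by near: y; exact: lt_nbhsr.
  by rewrite negb_and -!ltNge; apply/orP; right; near: y; exact: lt_nbhsr.
Unshelve. all: by end_near. Qed.

Let f_bounded : exists2 M : R, 0 <= M & forall x, 0 < x -> `|f x| <= M.
Proof.
have [M M0 fM] := continuous_bounded_itv a_gt0 (ltW ab) cf.
exists M => // x x0; have [xab|xab] := boolP (a <= x <= b); first exact: fM.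
by rewrite f_supp// normr0.
Qed.

Lemma test_bounded_csupp : exists M, bounded_csupp (f \_ Rp) a b M.
Proof.
have [M M0 fM] := f_bounded; exists M; split => //.
- by apply/(measurable_restrictT _ mRp); exact: continuous_pos_measurable.
- by rewrite a_gt0.
- move=> x; rewrite patchE; case: ifPn => [/set_mem|_]; last by rewrite normr0.
  by rewrite RplusE; exact: fM.
- move=> x xab; rewrite patchE; case: ifPn => // /set_mem; rewrite RplusE => x0.
  exact: f_supp.
Qed.

Let measurable_test : measurable_fun Rp f.
Proof. exact: continuous_pos_measurable. Qed.

Let patch_test x : Rp x -> (f \_ Rp) x = f x.
Proof. by move=> Rx; rewrite patchE mem_set. Qed.

Lemma test_sqint : sqint f.
Proof.
have [M B] := test_bounded_csupp; have [_ e] := bounded_csupp_sqint B.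
split => //; rewrite -(@eq_energy _ (f \_ Rp))// => x x0.
by rewrite patch_test// RplusE.
Qed.

Lemma test_integrable : mu.-integrable Rp (fun t => (f t)%:E).
Proof.
have [M B] := test_bounded_csupp.
have : mu.-integrable Rp (EFin \o (f \_ Rp)).
  by apply: integrableS (bounded_csupp_integrable B).
move=> /integrableP[_ foo]; apply/integrableP; split; first exact/measurable_EFinP.
rewrite (_ : integral _ _ _ = \int[mu]_(x in Rp) `|(EFin \o (f \_ Rp)) x|)%E//.
by apply: eq_integral => x /set_mem Rx; rewrite /= patch_test.
Qed.

Lemma integral_test_itv (u : R -> R) (c d : R) : 0 < c <= a -> b <= d ->
  \int[mu]_(t in Rp) (u t * f t) = \int[mu]_(t in `[c, d]) (u t * f t).
Proof.
move=> /andP[c0 ca] bd; rewrite Rintegral_mkcond [RHS]Rintegral_mkcond.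
apply: eq_Rintegral => t _; rewrite !patchE.
have [/set_mem tR|/negP tR] := boolP (t \in Rp).
  have [//|/negP tcd] := boolP (t \in `[c, d]%classic).
  rewrite f_supp ?mulr0 -?RplusE//; apply/negP => /andP[at_ tb]; apply: tcd.
  by rewrite inE/= in_itv/= (le_trans ca)//= (le_trans tb).
have [/set_mem/=|//] := boolP (t \in `[c, d]%classic).
rewrite in_itv/= => /andP[ct _]; exfalso; apply: tR.
by rewrite inE RplusE (lt_le_trans c0).
Qed.

(** The integral is bounded, and integrating by parts twice gives s^2 times
    it in terms of the second derivative of f, without boundary terms. *)
Lemma hartley_decay : exists2 C : R, 0 <= C &
  forall s, 0 < s -> `|hartley f s| <= C * (1 ^+ 2 + s ^+ 2)^-1.
Proof.
(* Enlarging the support makes f and its derivative vanish at c and d, and c >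
   0 keeps the interval inside the half-line. *)
pose c := a / 2; pose d := b + 1.
have c0 : 0 < c by rewrite divr_gt0.
have ca : c <= a by rewrite ler_pdivrMr// ler_peMr ?ler1n// ltW.
have bd : b < d by rewrite ltrDl.
have cd : c < d by rewrite (le_lt_trans ca)// (lt_trans ab).
have {}bd := ltW bd.
have [M M0 fM] := continuous_bounded_itv c0 (ltW cd) cf.
have [M2 M20 f2M] := continuous_bounded_itv c0 (ltW cd) cf2.
pose C1 := 2 * M * (d - c); pose C2 := 2 * M2 * (d - c).
have C10 : 0 <= C1 by rewrite !mulr_ge0// subr_ge0 ltW.
have C20 : 0 <= C2 by rewrite !mulr_ge0// subr_ge0 ltW.
exists (2 * (C1 + C2)); first by rewrite mulr_ge0// addr_ge0.
move=> s s0.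
have ccas t : {for t, continuous (fun t => cas (s * t))}.
  apply: continuous_cvg; first exact: continuous_cas.
  by apply: cvgM; [exact: cvg_cst|exact: cvg_id].
have HE : hartley f s = \int[mu]_(t in `[c, d]) (cas (s * t) * f t).
  by rewrite /hartley /kint; apply: integral_test_itv => //; rewrite c0.
have wc1 : {within `[c, d], continuous (fun t => cas (s * t) * f t)}.
  by apply: within_continuous_pos => // t t0; apply: cvgM; [exact: ccas|exact: cf].
have wc2 : {within `[c, d], continuous (fun t => cas (s * t) * f2 t)}.
  by apply: within_continuous_pos => // t t0; apply: cvgM; [exact: ccas|exact: cf2].
have bound1 : `|hartley f s| <= C1.
  rewrite HE /C1; apply: norm_Rintegral_itv_le => //; first exact: ltW.
  by move=> t tcd; rewrite normrM; apply: ler_pM => //; [exact: cas_le2|exact: fM].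
have bound2 : s ^+ 2 * `|hartley f s| <= C2.
  (* Both integrations by parts at once: cas'' (s t) = - s^2 cas (s t), so
     G' = s^2 cas (s t) f t + cas (s t) f'' t, and G vanishes at both ends. *)
  pose G t := s * f t * (sin (s * t) - cos (s * t)) + f1 t * cas (s * t).
  pose g t := s ^+ 2 * (cas (s * t) * f t) + cas (s * t) * f2 t.
  have a1 t : is_derive t 1 (fun t => s * t) s.
    by apply: is_derive_eq; rewrite /GRing.scale/=; ring.
  have a2 t := @is_derive1_comp _ (@cos R) (fun t => s * t) t _ _ (is_derive_cos _) (a1 t).
  have a3 t := @is_derive1_comp _ (@sin R) (fun t => s * t) t _ _ (is_derive_sin _) (a1 t).
  have dG t : 0 < t -> is_derive t 1 G (g t).
    move=> t0; have b1 := dF t0; have b2 := dF1 t0.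
    have b3 : is_derive t 1 (fun t => cos (s * t)) (- sin (s * t) * s) by exact: a2.
    have b4 : is_derive t 1 (fun t => sin (s * t)) (cos (s * t) * s) by exact: a3.
    rewrite /G /g /cas; apply: is_derive_eq; rewrite /GRing.scale/=; ring.
  have cG t : 0 < t -> {for t, continuous G}.
    by move=> t0; exact: is_derive_continuous (dG t t0).
  have cg : {within `[c, d], continuous g}.
    apply: within_continuous_pos => // t t0; apply: cvgD.
      by apply: cvgM; [exact: cvg_cst|apply: cvgM; [exact: ccas|exact: cf]].
    by apply: cvgM; [exact: ccas|exact: cf2].
  have d0 : 0 < d by exact: lt_trans cd.
  have := @continuous_FTC2 R g G c d cd cg _ _.
  have G0 t : 0 < t -> ~~ (a <= t <= b) -> G t = 0.
    by move=> t0 tab; rewrite /G f_supp// f1_supp// !(mul0r,mulr0) addr0.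
  have Gc : G c = 0 by apply: G0 => //; rewrite negb_and -ltNge /c; apply/orP; left; rewrite ltr_pdivrMr// ltr_pMr// ltr1n.
  have Gd : G d = 0 by apply: G0 => //; rewrite negb_and -!ltNge /d; apply/orP; right; rewrite ltrDl.
  rewrite Gc Gd subee// => FTC.
  have {}FTC : \int[mu]_(t in `[c, d]) g t = 0.
    rewrite /Rintegral FTC//.
    - split.
      + move=> t; rewrite in_itv/= => /andP[ct _].
        by have [] := dG t (lt_trans c0 ct).
      + by apply: cvg_at_right_filter; exact: cG.
      + by apply: cvg_at_left_filter; exact: cG.
    - move=> t; rewrite in_itv/= => /andP[ct _].
      have t0 := lt_trans c0 ct.
      by rewrite derive1E; apply: derive_val; exact: dG.
  have i1 : mu.-integrable `[c, d] (EFin \o (fun t => cas (s * t) * f t)).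
    by apply: continuous_compact_integrable => //; exact: segment_compact.
  have i2 : mu.-integrable `[c, d] (EFin \o (fun t => cas (s * t) * f2 t)).
    by apply: continuous_compact_integrable => //; exact: segment_compact.
  have i3 : mu.-integrable `[c, d] (EFin \o (fun t => s ^+ 2 * (cas (s * t) * f t))).
    apply: continuous_compact_integrable; first exact: segment_compact.
    apply: within_continuous_pos => // t t0.
    by apply: cvgM; [exact: cvg_cst|apply: cvgM; [exact: ccas|exact: cf]].
  move: FTC; rewrite /g RintegralD// RintegralZl// -HE => /eqP.
  rewrite addr_eq0 => /eqP E.
  rewrite -[X in X * _](ger0_norm (sqr_ge0 s)) -normrM E normrN /C2.
  apply: norm_Rintegral_itv_le => //; first exact: ltW.
  by move=> t tcd; rewrite normrM; apply: ler_pM => //; [exact: cas_le2|exact: f2M].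
rewrite ler_pdivlMr ?expr1n ?ltr_pwDl ?sqr_ge0//.
have := normr_ge0 (hartley f s); nra.
Qed.

End TestFunction.
End CompactlySupported.

(** * The iterated transform of a test function *)

Section IteratedTransform.
Context {R : realType}.
Notation mu := (@lebesgue_measure R).
Notation Rp := (@Rplus R).
Implicit Types (s t x y : R).

Let mRp := @measurable_Rplus R.

Lemma Rintegral_dominated_cvg (D : set R) (u : nat -> R -> R) (l g : R -> R) :
  measurable D -> (forall n, measurable_fun D (u n)) -> measurable_fun D l ->
  mu.-integrable D (fun t => (g t)%:E) ->
  (forall n t, D t -> `|u n t| <= g t) ->
  (forall t, D t -> u n t @[n --> \oo] --> l t) ->
  \int[mu]_(t in D) u n t @[n --> \oo] --> \int[mu]_(t in D) l t.
Proof.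
move=> mD mu_ ml gi ug ul.
have m1 n : measurable_fun D (EFin \o u n) by exact/measurable_EFinP.
have m2 : measurable_fun D (EFin \o l) by exact/measurable_EFinP.
have c1 : {ae mu, forall t, D t -> (EFin \o u n) t @[n --> \oo] --> (EFin \o l) t}.
  by apply: aeW => t Dt; apply: cvg_EFin; [exact: nearW|exact: ul].
have c2 : {ae mu, forall t n, D t -> (`|(EFin \o u n) t| <= (g t)%:E)%E}.
  by apply: aeW => t n Dt; rewrite abse_EFin lee_fin ug.
have [li _] := @dominated_convergence _ (measurableTypeR R) R lebesgue_measure D
  mD _ _ _ m1 m2 c1 gi c2.
have fl : (\int[mu]_(t in D) (EFin \o l) t \is a fin_num)%E by exact: integrable_fin_num.
rewrite -(fineK fl) => /fine_cvgP[_].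
by [].
Qed.

Definition eps (n : nat) : R := n.+1%:R^-1.

Lemma eps_gt0 n : 0 < eps n. Proof. by rewrite invr_gt0. Qed.
Lemma cvg_eps : eps n @[n --> \oo] --> 0. Proof. exact: cvg_harmonic. Qed.
#[local] Hint Resolve eps_gt0 : core.

Section TestFunction.
Context (f : R -> R) (a b : R).
Context (a_gt0 : 0 < a) (ab : a < b).
Context (f_supp : forall x, 0 < x -> ~~ (a <= x <= b) -> f x = 0).
Context (C2f : C2_Rplus f).

Let cf x : 0 < x -> {for x, continuous f}.
Proof.
move=> x0; have [d1 _ _] := C2f x0.
by apply: differentiable_continuous; exact/derivable1_diffP.
Qed.

Let fi : mu.-integrable Rp (fun t => (f t)%:E).
Proof. exact: test_integrable a_gt0 ab f_supp C2f. Qed.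

Let mf : measurable_fun Rp f.
Proof. exact: continuous_pos_measurable. Qed.

Lemma measurable_hartley : measurable_fun Rp (hartley f).
Proof. by apply: measurable_kint => //; exact: measurable_cas_kernel. Qed.

Lemma integrable_hartley : mu.-integrable Rp (fun s => (hartley f s)%:E).
Proof.
have [C C0 HC] := hartley_decay a_gt0 ab f_supp C2f.
have [gi _] : has_integral (fun s : R => (1 ^+ 2 + s ^+ 2)^-1) (pi / (2 * 1)).
  apply: ge0_has_integral; last exact: integral_inv_sqrD.
  - apply: measurableT_comp (@measurable_invr R setT) _.
    by apply: measurable_funD => //; exact: measurable_funX.
  - by move=> s _; rewrite invr_ge0 addr_ge0 ?sqr_ge0.
have Cgi : mu.-integrable Rp (fun s => C%:E * ((1 ^+ 2 + s ^+ 2)^-1)%:E)%E by exact: integrableZl.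
apply: le_integrable Cgi => //.
- by apply/measurable_EFinP; exact: measurable_hartley.
- move=> s; rewrite RplusE => s0; rewrite -EFinM !abse_EFin lee_fin.
  by apply: le_trans (HC s s0) _; exact: ler_norm.
Qed.

Let integrable_cas_hartley x :
  mu.-integrable Rp (fun s => (cas (x * s) * hartley f s)%:E).
Proof.
apply: (integrable_bounded_mul (M := 2)); last exact: integrable_hartley.
- exact: measurable_cas_section.
- by move=> t _; exact: cas_le2.
Qed.

(** The iterated transform with the outer integral damped; by Fubini it is
    an integral operator with an explicit kernel, and the integrability of
    the inner transform lets the damping go to 0. *)
Let damped n x : R :=
  \int[mu]_(s in Rp) (expR (- (eps n * s)) * (cas (x * s) * hartley f s)).

Let measurable_damp e : measurable_fun Rp (fun s : R => expR (- (e * s))).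
Proof.
apply: measurable_funTS; apply: continuous_measurable_fun => s.
apply: continuous_cvg; first exact: continuous_expR.
by apply: cvgN; apply: cvgM; [exact: cvg_cst|exact: cvg_id].
Qed.

Let damped_cvg x : damped n x @[n --> \oo] --> hartley (hartley f) x.
Proof.
apply: (@Rintegral_dominated_cvg Rp _ _ (fun s => `|cas (x * s) * hartley f s|)) => //.
- move=> n; apply: measurable_funM => //; apply: measurable_funM.
    exact: measurable_cas_section.
  exact: measurable_hartley.
- apply: measurable_funM; first exact: measurable_cas_section.
  exact: measurable_hartley.
- have /integrable_abse := integrable_cas_hartley x.
  by apply: eq_integrable.
- move=> n s; rewrite RplusE => s0; rewrite normrM ler_piMl// ger0_norm ?expR_ge0//.
  by rewrite -expR0 ler_expR oppr_le0 mulr_ge0// ltW.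
- move=> s Rs; rewrite -[X in _ --> X]mul1r; apply: cvgM; last exact: cvg_cst.
  rewrite -expR0; apply: continuous_cvg; first exact: continuous_expR.
  rewrite -[X in _ --> X]oppr0 -[X in _ --> - X](mul0r s); apply: cvgN; apply: cvgM.
    exact: cvg_eps.
  exact: cvg_cst.
Qed.

Let poisson e x t : R := e / (e ^+ 2 + (x - t) ^+ 2).
Let conj_poisson e x t : R := (x + t) / (e ^+ 2 + (x + t) ^+ 2).

Let dampedE n x : damped n x =
  \int[mu]_(t in Rp) ((poisson (eps n) x t + conj_poisson (eps n) x t) * f t).
Proof.
set e := eps n; have e0 : 0 < e by exact: eps_gt0.
pose h (z : R * R) := (expR (- (e * z.1)) * (cas (x * z.1) * (cas (z.1 * z.2) * f z.2)))%:E.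
have mh : measurable_fun (Rp `*` Rp) h.
  apply/measurable_EFinP; apply: measurable_funM.
    exact: (measurable_quadrant_fst (measurable_damp e)).
  apply: measurable_funM; first exact: (measurable_quadrant_fst (measurable_cas_section x)).
  apply: measurable_funM; first exact: measurable_cas_kernel.
  exact: measurable_quadrant_snd.
have hoo : (\int[mu]_(s in Rp) \int[mu]_(t in Rp) `|h (s, t)| < +oo)%E.
  have fni := integrable_abse fi.
  have nf : (\int[mu]_(t in Rp) `|(f t)%:E| \is a fin_num)%E by exact: integrable_fin_num.
  set N := fine (\int[mu]_(t in Rp) `|(f t)%:E|)%E.
  have [ei _] := has_integral_expRN e0.
  have eNi : mu.-integrable Rp (fun s => (4 * N)%:E * (expR (- (e * s)))%:E)%E by exact: integrableZl.
  have : (\int[mu]_(s in Rp) ((4 * N)%:E * (expR (- (e * s)))%:E) < +oo)%E by exact: integrable_lty.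
  apply: le_lt_trans; apply: ge0_le_integral => //.
  - by move=> s _; exact: integral_ge0.
  - apply: (@measurable_integral_Rplus _ (abse \o h)).
    exact: measurableT_comp.
  - by apply: measurable_int eNi.
  - move=> s; rewrite RplusE => s0.
    have e1 : 0 <= expR (- (e * s)) by exact: expR_ge0.
    apply: (@le_trans _ _ (\int[mu]_(t in Rp) ((4 * expR (- (e * s)))%:E * `|(f t)%:E|))%E).
      apply: ge0_le_integral => //.
      + apply: measurableT_comp => //; apply/measurable_EFinP.
        have m1 : measurable_fun Rp (fun t => cas (s * t) * f t).
          by apply: measurable_funM => //; exact: measurable_cas_section.
        rewrite /=; apply: measurable_funM; first exact: measurable_cst.
        by apply: measurable_funM; first exact: measurable_cst.
      + by apply: measurable_funeM; apply: measurableT_comp => //; exact/measurable_EFinP.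
      + move=> t _; rewrite /h/= lee_fin !normrM (ger0_norm e1).
        rewrite [4 * _]mulrC -mulrA; apply: ler_wpM2l => //.
        rewrite mulrA; apply: ler_wpM2r => //.
        rewrite (_ : 4 = 2 * 2 :> R); last by ring.
        by apply: ler_pM => //; exact: cas_le2.
    rewrite ge0_integralZl_EFin//.
    + by rewrite -(fineK nf) -/N -!EFinM mulrAC.
    + by apply: measurableT_comp => //; exact/measurable_EFinP.
transitivity (fine (\int[mu]_(s in Rp) \int[mu]_(t in Rp) h (s, t))).
  congr fine; apply: eq_integral => s; rewrite inE RplusE => s0.
  have ci : mu.-integrable Rp (fun t => (cas (s * t) * f t)%:E).
    apply: (integrable_bounded_mul (M := 2)) => //; first exact: measurable_cas_section.
    by move=> t _; exact: cas_le2.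
  rewrite /h/=; under [RHS]eq_integral do rewrite mulrA EFinM.
  rewrite integralZl// mulrA EFinM; congr (_ * _)%E.
  by rewrite /hartley /kint /Rintegral fineK//; exact: integrable_fin_num.
rewrite fubini_Rplus//; congr fine; apply: eq_integral => t; rewrite inE RplusE => t0.
have [ci cE] := has_integral_damped_cas x t e0.
rewrite EFinM -cE -integralZr//; apply: eq_integral => s _.
by rewrite -EFinM /h/= !mulrA.
Qed.

Let mem_Rp t : Rp t -> 0 < t. Proof. by rewrite RplusE. Qed.

(** For x > 0 the conjugate Poisson kernel has no singularity in t > 0 and
    stays below 1 / x, so its limit 1 / (x + t) is taken under the integral. *)
Let conj_poisson_cvg x : 0 < x ->
  \int[mu]_(t in Rp) (conj_poisson (eps n) x t * f t) @[n --> \oo] -->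
  kint (@stieltjes_kernel R) f x.
Proof.
move=> x0; apply: (@Rintegral_dominated_cvg Rp _ _ (fun t => `|x^-1 * f t|)) => //.
- move=> n; apply: measurable_funM => //; apply: measurable_funM; first exact: measurable_funD.
  apply: measurableT_comp (@measurable_invr R setT) _; apply: measurable_funD => //.
  by apply: measurable_funX; exact: measurable_funD.
- apply: measurable_funM => //; apply: measurableT_comp (@measurable_invr R setT) _.
  exact: measurable_funD.
- have : mu.-integrable Rp (fun t => (x^-1)%:E * (f t)%:E)%E by exact: integrableZl.
  by move=> /integrable_abse; apply: eq_integrable.
- move=> n t /mem_Rp t0; rewrite normrM [leRHS]normrM; apply: ler_wpM2r => //.
  have xt : 0 < x + t by rewrite addr_gt0.
  have D0 : 0 < eps n ^+ 2 + (x + t) ^+ 2 by rewrite addr_gt0 ?exprn_gt0// eps_gt0.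
  have p0 : 0 <= conj_poisson (eps n) x t by rewrite divr_ge0 ?ltW.
  have xi0 : 0 <= x^-1 by rewrite invr_ge0 ltW.
  rewrite (ger0_norm p0) (ger0_norm xi0) /conj_poisson ler_pdivrMr// ler_pdivlMl//.
  have := sqr_ge0 (eps n); nra.
- move=> t /mem_Rp t0; have xt : 0 < x + t by rewrite addr_gt0.
  apply: cvgM; last exact: cvg_cst.
  have -> : stieltjes_kernel x t = (x + t) / (0 ^+ 2 + (x + t) ^+ 2).
    by rewrite /stieltjes_kernel; field; rewrite gt_eqF.
  apply: cvgM; first exact: cvg_cst.
  apply: cvgV; first by rewrite expr0n/= add0r gt_eqF// exprn_gt0.
  apply: cvgD; last exact: cvg_cst.
  by rewrite !expr2; apply: cvgM; exact: cvg_eps.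
Qed.

Let continuous_poisson e x t : 0 < e -> {for t, continuous (poisson e x)}.
Proof.
move=> e0; apply: cvgM; first exact: cvg_cst.
apply: cvgV; first by rewrite gt_eqF// ltr_pwDl ?exprn_gt0// sqr_ge0.
apply: cvgD; first exact: cvg_cst.
apply: (@continuous_sqr _ (fun t => x - t)).
by apply: cvgB; [exact: cvg_cst|exact: cvg_id].
Qed.

Let integral_poisson_itv e x c d : 0 < e -> c < d ->
  \int[mu]_(t in `[c, d]) poisson e x t = atan ((d - x) / e) - atan ((c - x) / e).
Proof.
move=> e0 cd; pose F t := atan ((t - x) / e).
have dF t : is_derive t 1 F (poisson e x t).
  have a1 : is_derive t 1 (fun t => (t - x) / e) e^-1.
    by apply: is_derive_eq; rewrite /GRing.scale/=; ring.
  have := @is_derive_atan_comp _ (fun t => (t - x) / e) t _ a1.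
  rewrite (_ : e^-1 / _ = poisson e x t)// /poisson.
  by field; rewrite !gt_eqF// ltr_pwDl ?exprn_gt0// sqr_ge0.
have cF t : {for t, continuous F} by exact: is_derive_continuous (dF t).
rewrite /Rintegral (@continuous_FTC2 R (poisson e x) F c d cd) //.
- by apply: continuous_in_subspaceT => t _; exact: continuous_poisson.
- split.
  + by move=> t _; case: (dF t).
  + by apply: cvg_at_right_filter; exact: cF.
  + by apply: cvg_at_left_filter; exact: cF.
- by move=> t _; rewrite derive1E; exact: derive_val.
Qed.

Let atan_eps_cvg y : 0 < y -> atan (y / eps n) @[n --> \oo] --> pi / 2.
Proof.
move=> y0; apply: (cvg_comp (fun n => y / eps n) atan); last exact: cvgy_atan.
apply/cvgryPge => A; near=> n.
rewrite /eps invrK mulrC -ler_pdivrMr//.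
rewrite (@le_trans _ _ n%:R)//; last by rewrite ler_nat.
by near: n; exact: nbhs_infty_ger.
Unshelve. all: by end_near. Qed.

Let lipschitz_test c d : 0 < c -> c <= d ->
  exists2 L : R, 0 <= L & forall x t, c <= x <= d -> c <= t <= d ->
    `|f t - f x| <= L * `|t - x|.
Proof.
move=> c0 cd.
have df t : 0 < t -> is_derive t 1 f (derive1 f t).
  by move=> t0; have [d1 _ _] := C2f t0; rewrite derive1E; exact: derivableP.
have cf1 t : 0 < t -> {for t, continuous (derive1 f)}.
  move=> t0; have [_ d2 _] := C2f t0.
  by apply: differentiable_continuous; exact/derivable1_diffP.
have [L L0 HL] := continuous_bounded_itv c0 cd cf1.
exists L => //.
have key x t : c <= x -> x <= t -> t <= d -> `|f t - f x| <= L * `|t - x|.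
  move=> cx xt td.
  have wf : {within `[x, t], continuous f}.
    by apply: within_continuous_pos => //; exact: lt_le_trans cx.
  have dfi z : z \in `]x, t[ -> is_derive z 1 f (derive1 f z).
    rewrite in_itv/= => /andP[xz _]; apply: df.
    by rewrite (lt_trans _ xz)// (lt_le_trans c0).
  have [z + ->] := MVT_segment xt dfi wf.
  rewrite in_itv/= => /andP[xz zt]; rewrite normrM; apply: ler_wpM2r => //.
  by apply: HL; rewrite (le_trans cx xz) (le_trans zt td).
move=> x t /andP[cx xd] /andP[ct td]; have [xt|/ltW tx] := leP x t; first exact: key.
by rewrite distrC [`|t - x|]distrC; exact: key.
Qed.

(** The Poisson kernel is an approximate identity of mass pi. The part f x
    contributes arctangents; against f t - f x the kernel is bounded because
    f is Lipschitz near the support, and tends to 0 off the diagonal. *)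
Let poisson_cvg x : 0 < x ->
  \int[mu]_(t in Rp) (poisson (eps n) x t * f t) @[n --> \oo] --> pi * f x.
Proof.
(* An interval inside the half-line that contains the support of f and has x
   in its interior. *)
move=> x0; pose c := Num.min a x / 2; pose d := Num.max b x + 1.
have m0 : 0 < Num.min a x by rewrite lt_min a_gt0.
have c0 : 0 < c by rewrite divr_gt0.
have cm : c < Num.min a x by rewrite ltr_pdivrMr// ltr_pMr// ltr1n.
have ca : c <= a by rewrite (le_trans (ltW cm))// ge_min lexx.
have cx : c < x by rewrite (lt_le_trans cm)// ge_min lexx orbT.
have md : Num.max b x < d by rewrite ltrDl.
have bd : b <= d by rewrite (le_trans _ (ltW md))// le_max lexx.
have xd : x < d by rewrite (le_lt_trans _ md)// le_max lexx orbT.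
have cd : c < d := lt_trans cx xd.
have xcd : c <= x <= d by rewrite !ltW.
have [L L0 HL] := lipschitz_test c0 (ltW cd).
have wp n : {within `[c, d], continuous (poisson (eps n) x)}.
  by apply: continuous_in_subspaceT => t _; apply: continuous_poisson; exact: eps_gt0.
have wpf n : {within `[c, d], continuous (fun t => poisson (eps n) x t * (f t - f x))}.
  apply: within_continuous_pos => // t t0; apply: cvgM.
    by apply: continuous_poisson; exact: eps_gt0.
  by apply: cvgB; [exact: cf|exact: cvg_cst].
have ip n : mu.-integrable `[c, d] (EFin \o poisson (eps n) x).
  by apply: continuous_compact_integrable => //; exact: segment_compact.
have ipf n : mu.-integrable `[c, d] (EFin \o (fun t => poisson (eps n) x t * (f t - f x))).
  by apply: continuous_compact_integrable => //; exact: segment_compact.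
have E n : \int[mu]_(t in Rp) (poisson (eps n) x t * f t) =
    f x * (atan ((d - x) / eps n) + atan ((x - c) / eps n)) +
    \int[mu]_(t in `[c, d]) (poisson (eps n) x t * (f t - f x)).
  have -> : atan ((x - c) / eps n) = - atan ((c - x) / eps n).
    by rewrite -atanN; congr atan; ring.
  rewrite -(integral_poisson_itv x (eps_gt0 n) cd) -RintegralZl// -RintegralD//.
    rewrite (@integral_test_itv _ f a b f_supp _ c d) ?c0//.
    by apply: eq_Rintegral => t _; ring.
  apply: continuous_compact_integrable; first exact: segment_compact.
  apply: within_continuous_pos => // t t0; apply: cvgM; first exact: cvg_cst.
  by apply: continuous_poisson; exact: eps_gt0.
under eq_fun do rewrite E.
have -> : pi * f x = f x * (pi / 2 + pi / 2) + \int[mu]_(t in `[c, d]) (cst 0 t : R).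
  by rewrite Rintegral_cst// mul0r addr0; lra.
apply: cvgD.
  apply: cvgM; first exact: cvg_cst.
  by apply: cvgD; apply: atan_eps_cvg; rewrite subr_gt0.
apply: (@Rintegral_dominated_cvg `[c, d] _ _ (fun=> L)) => //.
- move=> n; apply: subspace_continuous_measurable_fun => //.
  exact: wpf.
- apply: continuous_compact_integrable; first exact: segment_compact.
  by apply: continuous_subspaceT => z; exact: cvg_cst.
- move=> n t /=; rewrite in_itv/= => tcd.
  have e0 := eps_gt0 n; set e := eps n in e0 *.
  have D0 : 0 < e ^+ 2 + (x - t) ^+ 2 by rewrite ltr_pwDl ?exprn_gt0// sqr_ge0.
  have p0 : 0 <= poisson e x t by rewrite divr_ge0 ?ltW.
  rewrite normrM (ger0_norm p0).
  apply: le_trans (ler_wpM2l p0 (HL x t xcd tcd)) _.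
  rewrite mulrCA ler_piMr// /poisson mulrAC ler_pdivrMr// mul1r distrC.
  rewrite -(real_normK (num_real (x - t))).
  have := sqr_ge0 (e - `|x - t|); have := sqr_ge0 (e + `|x - t|); nra.
- move=> t _; have [->|xt] := eqVneq t x.
    by under eq_fun do rewrite subrr mulr0; exact: cvg_cst.
  rewrite -[X in _ --> X](mul0r (f t - f x)); apply: cvgM; last exact: cvg_cst.
  have xt0 : 0 ^+ 2 + (x - t) ^+ 2 != 0.
    by rewrite expr0n/= add0r sqrf_eq0 subr_eq0 eq_sym.
  rewrite -[X in _ --> X](mul0r (0 ^+ 2 + (x - t) ^+ 2)^-1).
  apply: cvgM; first exact: cvg_eps.
  apply: cvgV => //; apply: cvgD; last exact: cvg_cst.
  by rewrite !expr2; apply: cvgM; exact: cvg_eps.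
Qed.

(** The rigorous form of the formal identity int cas (x s) cas (s t) ds = pi
    delta (x - t) + 1 / (x + t). *)
Lemma hartley_hartley x : 0 < x ->
  hartley (hartley f) x = pi * f x + kint (@stieltjes_kernel R) f x.
Proof.
move=> x0; rewrite -(cvg_lim (@Rhausdorff R) (@damped_cvg x)).
apply: cvg_lim; first exact: Rhausdorff.
under eq_fun do rewrite dampedE.
have ip n (u : R -> R) : measurable_fun Rp u -> (exists M, forall t, 0 < t -> `|u t| <= M) ->
    mu.-integrable Rp (EFin \o (fun t => u t * f t)).
  by move=> mu_ [M uM]; exact: integrable_bounded_mul mu_ uM fi.
have D0 e y : 0 < e -> 0 < e ^+ 2 + y ^+ 2 by move=> e0; rewrite ltr_pwDl ?exprn_gt0// sqr_ge0.
have i1 n : mu.-integrable Rp (EFin \o (fun t => poisson (eps n) x t * f t)).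
  have e0 := eps_gt0 n; set e := eps n in e0 *.
  apply: ip => //.
    by apply: continuous_pos_measurable => t _; exact: continuous_poisson.
  exists e^-1 => t t0.
  have p0 : 0 <= poisson e x t by rewrite divr_ge0 ?ltW ?D0.
  rewrite (ger0_norm p0).
  rewrite /poisson ler_pdivrMr ?D0// mulrDr expr2 mulKf ?gt_eqF// lerDl.
  by rewrite mulr_ge0 ?sqr_ge0// invr_ge0 ltW.
have i2 n : mu.-integrable Rp (EFin \o (fun t => conj_poisson (eps n) x t * f t)).
  have e0 := eps_gt0 n; set e := eps n in e0 *.
  apply: ip => //.
    apply: measurable_funM; first exact: measurable_funD.
    apply: measurableT_comp (@measurable_invr R setT) _; apply: measurable_funD => //.
    by apply: measurable_funX; exact: measurable_funD.
  exists x^-1 => t t0; have xt : 0 < x + t by rewrite addr_gt0.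
  have p0 : 0 <= conj_poisson e x t by rewrite divr_ge0 ?ltW ?D0.
  rewrite (ger0_norm p0).
  rewrite /conj_poisson ler_pdivrMr ?D0// ler_pdivlMl//.
  have := sqr_ge0 e; nra.
have E n : \int[mu]_(t in Rp) ((poisson (eps n) x t + conj_poisson (eps n) x t) * f t) =
    \int[mu]_(t in Rp) (poisson (eps n) x t * f t) +
    \int[mu]_(t in Rp) (conj_poisson (eps n) x t * f t).
  by rewrite -RintegralD//; apply: eq_Rintegral => t _; rewrite mulrDl.
under eq_fun do rewrite E.
by apply: cvgD; [exact: poisson_cvg|exact: conj_poisson_cvg].
Qed.

End TestFunction.
End IteratedTransform.

Local Open Scope complex_scope.

(** * Complex-valued functions *)

Section ComplexFunctions.
Context {R : realType}.
Notation mu := (@lebesgue_measure R).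
Notation Rp := (@Rplus R).
Implicit Types (f g : R -> R[i]) (x : R).

Let mRp := @measurable_Rplus R.

Definition re_part f : R -> R := fun x => complex.Re (f x).
Definition im_part f : R -> R := fun x => complex.Im (f x).
Definition cpair (u v : R -> R) : R -> R[i] := fun x => u x +i* v x.

Lemma eq_complexP (z w : R[i]) :
  complex.Re z = complex.Re w -> complex.Im z = complex.Im w -> z = w.
Proof. by move: z w => [a b] [c d] /= -> ->. Qed.

Lemma Re_mul (z w : R[i]) :
  complex.Re (z * w) = complex.Re z * complex.Re w - complex.Im z * complex.Im w.
Proof. by move: z w => [a b] [c d]. Qed.

Lemma Im_mul (z w : R[i]) :
  complex.Im (z * w) = complex.Re z * complex.Im w + complex.Im z * complex.Re w.
Proof. by move: z w => [a b] [c d]. Qed.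

Lemma Re_scale (c : R) (z : R[i]) : complex.Re (c%:C * z) = c * complex.Re z.
Proof. by rewrite Re_mul /= mul0r subr0. Qed.

Lemma Im_scale (c : R) (z : R[i]) : complex.Im (c%:C * z) = c * complex.Im z.
Proof. by rewrite Im_mul /= mul0r addr0. Qed.

Lemma Re_add (z w : R[i]) : complex.Re (z + w) = complex.Re z + complex.Re w.
Proof. by move: z w => [a b] [c d]. Qed.

Lemma Im_add (z w : R[i]) : complex.Im (z + w) = complex.Im z + complex.Im w.
Proof. by move: z w => [a b] [c d]. Qed.

Definition cenergy f : \bar R := (energy (re_part f) + energy (im_part f))%E.

Definition csqint f := sqint (re_part f) /\ sqint (im_part f).

Lemma cenergy_ge0 f : (0 <= cenergy f)%E.
Proof. by apply: adde_ge0; exact: energy_ge0. Qed.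

Lemma L2norm_sqr f : cmeasurable f -> (L2norm f `^ 2 = cenergy f)%E.
Proof.
move=> [mr mi]; rewrite /L2norm poweR_Lnorm ?pnatr_eq0//.
rewrite /cenergy /energy -ge0_integralD//; last 4 first.
- by move=> x _; rewrite lee_fin sqr_ge0.
- exact/measurable_EFinP/measurable_funX.
- by move=> x _; rewrite lee_fin sqr_ge0.
- exact/measurable_EFinP/measurable_funX.
rewrite [RHS]integral_mkcond; apply: eq_integral => x _; rewrite !patchE.
case: ifPn => _; last by rewrite abse0 poweR0r ?pnatr_eq0.
rewrite abse_EFin poweR_EFin -EFinD; congr EFin.
rewrite /re_part /im_part; case: (f x) => p q /=.
rewrite powR_mulrn ?normr_ge0// real_normK ?num_real// sqr_sqrtr//.
by rewrite addr_ge0 ?sqr_ge0.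
Qed.

Lemma L2normE f : cmeasurable f -> (L2norm f = cenergy f `^ 2^-1)%E.
Proof.
move=> mf; rewrite -L2norm_sqr// -poweRrM mulfV ?pnatr_eq0// poweRe1//.
exact: Lnorm_ge0.
Qed.

Lemma L2P f : L2 f <-> csqint f.
Proof.
split=> [[mf nf]|[[mr er] [mi ei]]].
- have [mr mi] := mf.
  have : (cenergy f < +oo)%E by rewrite -L2norm_sqr//; exact: poweR_lty.
  rewrite /cenergy => h; split; split=> //.
  + by apply: le_lt_trans h; rewrite leeDl// energy_ge0.
  + by apply: le_lt_trans h; rewrite leeDr// energy_ge0.
- split; first by split.
  rewrite L2normE; last by split.
  by apply: poweR_lty; exact: lte_add_pinfty.
Qed.

Let ereal_itv (e : \bar R) : (0 <= e)%E -> e \in `[0%E, +oo%E].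
Proof. by move=> e0; rewrite in_itv/= e0 leey. Qed.

Lemma L2norm_le (c : R) f g : 0 <= c -> cmeasurable f -> cmeasurable g ->
  (cenergy g <= (c ^+ 2)%:E * cenergy f)%E -> (L2norm g <= c%:E * L2norm f)%E.
Proof.
move=> c0 mf mg gf; rewrite !L2normE//.
have -> : c%:E = ((c ^+ 2)%:E `^ 2^-1)%E.
  by rewrite poweR_EFin -powR_mulrn// -powRrM mulfV ?pnatr_eq0// powRr1.
rewrite -poweRM ?lee_fin ?sqr_ge0 ?cenergy_ge0//.
apply: gt0_ler_poweR => //; apply: ereal_itv; first exact: cenergy_ge0.
by apply: mule_ge0; [rewrite lee_fin sqr_ge0|exact: cenergy_ge0].
Qed.

Lemma cenergy_le (c : R) f g : 0 <= c -> cmeasurable f -> cmeasurable g ->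
  (L2norm g <= c%:E * L2norm f)%E -> (cenergy g <= (c ^+ 2)%:E * cenergy f)%E.
Proof.
move=> c0 mf mg gf; rewrite -!L2norm_sqr//.
have -> : (c ^+ 2)%:E = (c%:E `^ 2)%E by rewrite poweR_EFin powR_mulrn.
have nf0 : (0 <= L2norm f)%E by exact: Lnorm_ge0.
rewrite -poweRM ?lee_fin//.
apply: gt0_ler_poweR => //; apply: ereal_itv; first exact: Lnorm_ge0.
by apply: mule_ge0 => //; rewrite lee_fin.
Qed.

Lemma ae_eq_parts f g : ae_eq mu Rp (re_part f) (re_part g) ->
  ae_eq mu Rp (im_part f) (im_part g) -> ae_eq_Rplus f g.
Proof.
move=> hr hi; apply: filterS2 hr hi => x hr hi Rx.
by apply: eq_complexP; [exact: hr|exact: hi].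
Qed.

Lemma ae_eq_re_part f g : ae_eq_Rplus f g -> ae_eq mu Rp (re_part f) (re_part g).
Proof.
move=> fg; apply: filterS fg; first exact: (ae_filter_ringOfSetsType mu).
by move=> x fg Rx; rewrite /re_part fg.
Qed.

Lemma ae_eq_im_part f g : ae_eq_Rplus f g -> ae_eq mu Rp (im_part f) (im_part g).
Proof.
move=> fg; apply: filterS fg; first exact: (ae_filter_ringOfSetsType mu).
by move=> x fg Rx; rewrite /im_part fg.
Qed.

Lemma eq_ae_Rplus f g : (forall x, 0 < x -> f x = g x) -> ae_eq_Rplus f g.
Proof. by move=> fg; apply: aeW => x; rewrite RplusE; exact: fg. Qed.

Lemma ae_eq_trans_Rplus f g h : ae_eq_Rplus f g -> ae_eq_Rplus g h -> ae_eq_Rplus f h.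
Proof.
move=> fg gh; apply: filterS2 fg gh; first exact: (ae_filter_ringOfSetsType mu).
by move=> x fg gh Rx; rewrite fg ?gh.
Qed.

Lemma energy_eq0_ae (u : R -> R) : measurable_fun Rp u -> energy u = 0%E ->
  ae_eq mu Rp u (cst 0).
Proof.
move=> mu_ u0.
have mu2 : measurable_fun Rp (fun x => (u x ^+ 2)%:E).
  by apply/measurable_EFinP; exact: measurable_funX.
have : (\int[mu]_(x in Rp) `|(u x ^+ 2)%:E| = 0)%E.
  by rewrite -u0; apply: eq_integral => x _; rewrite abse_EFin ger0_norm// sqr_ge0.
move/(ae_eq_integral_abs mu (measurable_itv _) mu2).
move=> h; apply: filterS h => x h Rx; have /= [/eqP] := h Rx.
by rewrite sqrf_eq0 => /eqP.
Qed.

(** Every operator of the theorem has a real kernel, so it acts separately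
    on the real and imaginary parts. *)
Definition complexify (A : (R -> R) -> R -> R) : (R -> R[i]) -> R -> R[i] :=
  fun f => cpair (A (re_part f)) (A (im_part f)).

(** What has to be known on real functions for the complexification to be a
    bounded linear operator of norm at most the square root of C. *)
Record real_operator (A : (R -> R) -> R -> R) (C : R) : Prop := RealOperator {
  rop_sqint : forall u, sqint u -> sqint (A u);
  rop_lin : forall (a b : R) u v x, sqint u -> sqint v -> 0 < x ->
    A (fun t => a * u t + b * v t) x = a * A u x + b * A v x;
  rop_ae : forall u v, sqint u -> sqint v -> ae_eq mu Rp u v ->
    ae_eq mu Rp (A u) (A v);
  rop_energy : forall u, sqint u -> (energy (A u) <= C%:E * energy u)%E }.

Section Complexify.
Context (A : (R -> R) -> R -> R) (c : R) (hA : real_operator A (c ^+ 2)) (c0 : 0 <= c).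

Lemma complexify_csqint f : csqint f -> csqint (complexify A f).
Proof. by move=> [sr si]; split; exact: (rop_sqint hA). Qed.

Lemma complexify_cenergy f : csqint f ->
  (cenergy (complexify A f) <= (c ^+ 2)%:E * cenergy f)%E.
Proof.
move=> [sr si]; rewrite /cenergy ge0_muleDr ?energy_ge0//.
by apply: leeD; exact: (rop_energy hA).
Qed.

Lemma complexify_L2norm f : L2 f -> (L2norm (complexify A f) <= c%:E * L2norm f)%E.
Proof.
move=> Lf; have sf := (L2P f).1 Lf.
have [mAf _] := (L2P _).2 (complexify_csqint sf).
by apply: L2norm_le => //; [case: Lf|exact: complexify_cenergy].
Qed.

(** Complex linearity is the only point where the two parts mix: they are
    combined through the real linearity of A. *)
Lemma complexify_bounded_linear : L2_bounded_linear (complexify A).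
Proof.
split.
- by move=> f /L2P sf; apply/L2P; exact: complexify_csqint.
- move=> f g /L2P[fr fi] /L2P[gr gi] fg; apply: ae_eq_parts.
  + by apply: (rop_ae hA) => //; exact: ae_eq_re_part.
  + by apply: (rop_ae hA) => //; exact: ae_eq_im_part.
- move=> a f g /L2P[fr fi] /L2P[gr gi]; apply: eq_ae_Rplus => x x0.
  have sr := sqint_lin (complex.Re a) (- complex.Im a) fr fi.
  have si := sqint_lin (complex.Re a) (complex.Im a) fi fr.
  have Er : re_part (fun x => a * f x + g x) =
      (fun t => 1 * (complex.Re a * re_part f t + - complex.Im a * im_part f t) + 1 * re_part g t).
    by apply/funext => t; rewrite /re_part Re_add Re_mul !mul1r mulNr.
  have Ei : im_part (fun x => a * f x + g x) =
      (fun t => 1 * (complex.Re a * im_part f t + complex.Im a * re_part f t) + 1 * im_part g t).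
    by apply/funext => t; rewrite /im_part Im_add Im_mul !mul1r.
  rewrite /complexify Er Ei; apply: eq_complexP; rewrite ?Re_add ?Im_add ?Re_mul ?Im_mul /=.
  + by rewrite (rop_lin hA _ _ sr gr x0) (rop_lin hA _ _ fr fi x0) !mul1r mulNr.
  + by rewrite (rop_lin hA _ _ si gi x0) (rop_lin hA _ _ fi fr x0) !mul1r.
- by exists c => f; exact: complexify_L2norm.
Qed.

End Complexify.
End ComplexFunctions.

(** * The operator and its inverse on L_2 *)

Section Assembly.
Context {R : realType}.
Notation mu := (@lebesgue_measure R).
Notation Rp := (@Rplus R).
Implicit Types (f g : R -> R[i]) (x : R).

Let mRp := @measurable_Rplus R.

Lemma real_operator_kint_combination (k : R -> R -> R) (C a b c : R) :
  schur_kernel k C ->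
  (forall u, sqint u -> (energy (fun x => (a * u x + b * kint k u x)%R) <= c%:E * energy u)%E) ->
  real_operator (fun u x => a * u x + b * kint k u x) c.
Proof.
move=> sk ec; split=> //.
- by move=> u su; apply: sqint_lin => //; exact: sqint_kint sk su.
- move=> p q u v x su sv x0; rewrite (kint_lin p q sk su sv x0); ring.
- move=> u v su sv uv; apply: filterS (uv) => x uvx Rx; rewrite uvx//; congr (_ + _ * _).
  move: Rx; rewrite RplusE => x0.
  exact: (ae_eq_kint sk su sv x0).
Qed.

Lemma real_operator_hartley2 : real_operator (@hartley2 R) (4 ^+ 2).
Proof.
apply: (real_operator_kint_combination (@schur_stieltjes R)) => u su.
have -> : 4 ^+ 2 = 16 :> R by rewrite -natrX.
exact: energy_hartley2.
Qed.

Lemma real_operator_hartley2_inv : real_operator (@hartley2_inv R) (1 ^+ 2).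
Proof.
apply: (real_operator_kint_combination (@schur_log R)) => u su.
by rewrite expr1n mul1e; exact: energy_hartley2_inv.
Qed.

Definition chartley2 := complexify (@hartley2 R).
Definition chartley2_inv := complexify (@hartley2_inv R).

Lemma re_part_hartley_integrand f x :
  re_part (hartley_integrand f x) = (fun t => cas (x * t) * re_part f t).
Proof. by apply/funext => t; rewrite /re_part /hartley_integrand Re_scale. Qed.

Lemma im_part_hartley_integrand f x :
  im_part (hartley_integrand f x) = (fun t => cas (x * t) * im_part f t).
Proof. by apply/funext => t; rewrite /im_part /hartley_integrand Im_scale. Qed.

Lemma cintegralE f : cintegral f =
  (\int[mu]_(t in Rp) re_part f t) +i* (\int[mu]_(t in Rp) im_part f t).
Proof. by []. Qed.

Lemma cintegrableE f : cintegrable f =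
  (mu.-integrable Rp (fun t => (re_part f t)%:E) /\
   mu.-integrable Rp (fun t => (im_part f t)%:E)).
Proof. by []. Qed.

Lemma half_hartleyE f : half_hartley f =
  cpair (fun x => Num.sqrt (2 / pi) * hartley (re_part f) x)
        (fun x => Num.sqrt (2 / pi) * hartley (im_part f) x).
Proof.
apply/funext => x; rewrite /half_hartley cintegralE.
rewrite re_part_hartley_integrand im_part_hartley_integrand.
by apply: eq_complexP; rewrite ?Re_scale ?Im_scale.
Qed.

Lemma kernel_integral (k : R -> R -> R) f (F : R -> R -> R[i]) x :
  (forall t, F x t = (k x t)%:C * f t) ->
  cintegral (F x) = kint k (re_part f) x +i* kint k (im_part f) x.
Proof.
move=> FE; rewrite cintegralE; congr (_ +i* _).
- by apply: eq_Rintegral => t _; rewrite /re_part FE Re_scale.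
- by apply: eq_Rintegral => t _; rewrite /im_part FE Im_scale.
Qed.

Lemma kernel_integrable (k : R -> R -> R) C f (F : R -> R -> R[i]) x :
  schur_kernel k C -> csqint f -> (forall t, F x t = (k x t)%:C * f t) -> 0 < x ->
  cintegrable (F x).
Proof.
move=> sk [sr si] FE x0; rewrite cintegrableE.
have -> : re_part (F x) = (fun t => k x t * re_part f t).
  by apply/funext => t; rewrite /re_part FE Re_scale.
have -> : im_part (F x) = (fun t => k x t * im_part f t).
  by apply/funext => t; rewrite /im_part FE Im_scale.
by split; exact: (kint_integrable sk).
Qed.

Let ratC (n : nat) : n%:R = (n%:R : R)%:C :> R[i].
Proof. by rewrite rmorph_nat. Qed.

Lemma chartley2E f x : chartley2 f x = 2 * f x + (2 / pi)%:C * cintegral (stieltjes_integrand f x).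
Proof.
rewrite (@kernel_integral (@stieltjes_kernel R) f)// ratC.
by apply: eq_complexP; rewrite ?Re_add ?Im_add ?Re_scale ?Im_scale.
Qed.

Lemma chartley2_invE f x : chartley2_inv f x =
  2^-1 * f x - ((pi ^+ 2)^-1)%:C * cintegral (log_integrand f x).
Proof.
rewrite (@kernel_integral (@log_kernel R) f)//.
have -> : 2^-1 = (2^-1 : R)%:C :> R[i] by rewrite ratC fmorphV.
rewrite -mulNr -rmorphN.
by apply: eq_complexP; rewrite ?Re_add ?Im_add ?Re_scale ?Im_scale.
Qed.

Lemma Cc2_parts f : Cc2 f -> exists a b, [/\ 0 < a, a < b,
  (forall x, 0 < x -> ~~ (a <= x <= b) -> re_part f x = 0) &
  (forall x, 0 < x -> ~~ (a <= x <= b) -> im_part f x = 0)].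
Proof.
move=> [_ _ [K [cK KR f0]]].
have [a [b [/andP[a0 ab] Kab]]] := compact_Rplus_itv cK KR.
have fz x : 0 < x -> ~~ (a <= x <= b) -> f x = 0.
  move=> x0 xab; apply: f0; first by rewrite RplusE.
  by move/Kab => h; move: xab; rewrite h.
exists a, b; split=> // x x0 xab; by rewrite /re_part /im_part (fz x x0 xab).
Qed.

Lemma Cc2_csqint f : Cc2 f -> csqint f.
Proof.
move=> cf; have [a [b [a0 ab fr fi]]] := Cc2_parts cf; have [Cr Ci _] := cf.
by split; [exact: test_sqint a0 ab fr Cr|exact: test_sqint a0 ab fi Ci].
Qed.

Let integrable_cas (u : R -> R) x : mu.-integrable Rp (fun t => (u t)%:E) ->
  mu.-integrable Rp (fun t => (cas (x * t) * u t)%:E).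
Proof.
apply: (integrable_bounded_mul (M := 2)); first exact: measurable_cas_section.
by move=> t _; exact: cas_le2.
Qed.

Lemma Cc2_hartley_defined f : Cc2 f ->
  hartley_defined f /\ hartley_defined (half_hartley f).
Proof.
move=> cf; have [a [b [a0 ab fr fi]]] := Cc2_parts cf; have [Cr Ci _] := cf.
split=> x x0; rewrite cintegrableE re_part_hartley_integrand im_part_hartley_integrand.
- split; apply: integrable_cas.
  + exact: test_integrable a0 ab fr Cr.
  + exact: test_integrable a0 ab fi Ci.
- rewrite half_hartleyE; split; apply: integrable_cas.
  + have h := integrable_hartley a0 ab fr Cr.
    have : mu.-integrable Rp (fun t => (Num.sqrt (2 / pi))%:E * (hartley (re_part f) t)%:E)%E.
      exact: integrableZl.
    by [].
  + have h := integrable_hartley a0 ab fi Ci.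
    have : mu.-integrable Rp (fun t => (Num.sqrt (2 / pi))%:E * (hartley (im_part f) t)%:E)%E.
      exact: integrableZl.
    by [].
Qed.

Let hartley_scale (c : R) (u : R -> R) x : mu.-integrable Rp (fun t => (u t)%:E) ->
  hartley (fun s => c * u s) x = c * hartley u x.
Proof.
move=> ui; have ci := integrable_cas x ui.
rewrite /hartley /kint -RintegralZl//; apply: eq_Rintegral => t _; ring.
Qed.

Lemma chartley2_half_hartley f x : Cc2 f -> 0 < x -> chartley2 f x = half_hartley (half_hartley f) x.
Proof.
move=> cf x0; have [a [b [a0 ab fr fi]]] := Cc2_parts cf; have [Cr Ci _] := cf.
have ir := integrable_hartley a0 ab fr Cr.
have ii := integrable_hartley a0 ab fi Ci.
have c2 : Num.sqrt (2 / pi) * Num.sqrt (2 / pi) = 2 / pi :> R.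
  by rewrite -expr2 sqr_sqrtr// divr_ge0// pi_ge0.
have pi0 : (pi : R) != 0 by rewrite gt_eqF// pi_gt0.
have key (u : R -> R) : hartley (hartley u) x = pi * u x + kint (@stieltjes_kernel R) u x ->
    2 / pi * hartley (hartley u) x = hartley2 u x.
  by move=> ->; rewrite /hartley2; move: pi0; generalize (pi : R) => p p0; field.
rewrite half_hartleyE half_hartleyE; apply: eq_complexP => /=.
- rewrite /re_part /= (hartley_scale _ _ ir) mulrA c2.
  by rewrite key//; exact: hartley_hartley a0 ab fr Cr _ x0.
- rewrite /im_part /= (hartley_scale _ _ ii) mulrA c2.
  by rewrite key//; exact: hartley_hartley a0 ab fi Ci _ x0.
Qed.

Lemma Cc2_dense f (e : R) : csqint f -> 0 < e ->
  exists2 phi, Cc2 phi & (cenergy (fun x => f x - phi x)%R <= e%:E)%E.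
Proof.
move=> [sr si] e0; have e20 : 0 < e / 2 by rewrite divr_gt0.
have [p [a [b [M [Cp [_ /andP[a0 _] _ _ p0] Ep]]]]] := C2_csupp_dense sr e20.
have [q [a' [b' [M' [Cq [_ /andP[a0' _] _ _ q0] Eq]]]]] := C2_csupp_dense si e20.
exists (cpair p q).
- split; [exact: Cp|exact: Cq|exists (`[a, b]%classic `|` `[a', b']%classic); split].
  + by apply: compactU; exact: segment_compact.
  + move=> x; rewrite RplusE => -[|]/=; rewrite in_itv/= => /andP[+ _].
      exact: lt_le_trans.
    exact: lt_le_trans.
  + move=> x _ xK; apply: eq_complexP => /=.
    * by apply: p0; apply/negP => h; apply: xK; left; rewrite /= in_itv.
    * by apply: q0; apply/negP => h; apply: xK; right; rewrite /= in_itv.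
- have -> : e%:E = ((e / 2)%:E + (e / 2)%:E)%E by rewrite -EFinD; congr EFin; lra.
  rewrite /cenergy; apply: leeD.
  + rewrite (_ : re_part _ = (fun x => re_part f x - p x))//.
    by apply/funext => x; rewrite /re_part Re_add; case: (f x).
  + rewrite (_ : im_part _ = (fun x => im_part f x - q x))//.
    by apply/funext => x; rewrite /im_part Im_add; case: (f x).
Qed.

Lemma bounded_linear_cenergy (T : (R -> R[i]) -> R -> R[i]) : L2_bounded_linear T ->
  exists2 M : R, 0 <= M & forall f, csqint f ->
    csqint (T f) /\ (cenergy (T f) <= M%:E * cenergy f)%E.
Proof.
move=> [TL _ _ [M MT]]; exists (`|M| ^+ 2); first exact: sqr_ge0.
move=> f sf; have Lf := (L2P f).2 sf; have LTf := TL f Lf.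
split; first exact/L2P.
have [mf _] := Lf; have [mTf _] := LTf.
apply: cenergy_le => //; apply: le_trans (MT f Lf) _.
by apply: lee_wpmul2r; [exact: Lnorm_ge0|rewrite lee_fin ler_norm].
Qed.

Let muleD_ACA (a b c d : \bar R) : (0 <= a)%E -> (0 <= b)%E -> (0 <= c)%E -> (0 <= d)%E ->
  (2%:E * (a + b) + 2%:E * (c + d) = (2%:E * a + 2%:E * c) + (2%:E * b + 2%:E * d))%E.
Proof. by move=> a0 b0 c0 d0; rewrite !ge0_muleDr// addeACA. Qed.

Lemma cenergy_sub_le f g : csqint f -> csqint g ->
  (cenergy (fun x => f x - g x)%R <= 2%:E * cenergy f + 2%:E * cenergy g)%E.
Proof.
move=> [[mfr _] [mfi _]] [[mgr _] [mgi _]].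
rewrite /cenergy muleD_ACA ?energy_ge0//; apply: leeD.
- have := energy_lin 1 (-1) mfr mgr; rewrite sqrrN expr1n mulr1.
  rewrite (@eq_energy _ _ (re_part (fun x => f x - g x)))// => x _.
  by rewrite /re_part Re_add mul1r mulN1r; case: (g x).
- have := energy_lin 1 (-1) mfi mgi; rewrite sqrrN expr1n mulr1.
  rewrite (@eq_energy _ _ (im_part (fun x => f x - g x)))// => x _.
  by rewrite /im_part Im_add mul1r mulN1r; case: (g x).
Qed.

Lemma csqint_sub f g : csqint f -> csqint g -> csqint (fun x => f x - g x).
Proof.
move=> [fr fi] [gr gi]; split.
- rewrite (_ : re_part _ = (fun x => 1 * re_part f x + (-1) * re_part g x)).
    exact: sqint_lin.
  by apply/funext => x; rewrite /re_part Re_add mul1r mulN1r; case: (g x).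
- rewrite (_ : im_part _ = (fun x => 1 * im_part f x + (-1) * im_part g x)).
    exact: sqint_lin.
  by apply/funext => x; rewrite /im_part Im_add mul1r mulN1r; case: (g x).
Qed.

Lemma ae_eq_cenergy f g : csqint f -> csqint g -> ae_eq_Rplus f g ->
  cenergy f = cenergy g.
Proof.
move=> [[? _] [? _]] [[? _] [? _]] fg; congr (_ + _)%E; apply: ae_eq_energy => //.
- exact: ae_eq_re_part.
- exact: ae_eq_im_part.
Qed.

(** Used below to prove equality almost everywhere by estimating a norm. *)
Lemma cenergy_sub_eq0 f g : csqint f -> csqint g ->
  cenergy (fun x => f x - g x) = 0%E -> ae_eq_Rplus f g.
Proof.
move=> sf sg /eqP; have [[mr _] [mi _]] := csqint_sub sf sg.
rewrite /cenergy padde_eq0 ?energy_ge0// => /andP[/eqP hr /eqP hi].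
apply: ae_eq_parts.
- apply: filterS (energy_eq0_ae mr hr) => x h Rx; have /= := h Rx.
  by rewrite /re_part; case: (f x) (g x) => [p q] [p' q'] /= /eqP; rewrite subr_eq0 => /eqP.
- apply: filterS (energy_eq0_ae mi hi) => x h Rx; have /= := h Rx.
  by rewrite /im_part; case: (f x) (g x) => [p q] [p' q'] /= /eqP; rewrite subr_eq0 => /eqP.
Qed.

(** Bounded operators that agree on a dense subspace agree: with f = phi + d
    and phi a test function, the images of f differ by those of d, whose
    energy is arbitrarily small. *)
Lemma bounded_linear_ext (T1 T2 : (R -> R[i]) -> R -> R[i]) :
  L2_bounded_linear T1 -> L2_bounded_linear T2 ->
  (forall f, Cc2 f -> ae_eq_Rplus (T1 f) (T2 f)) ->
  forall f, L2 f -> ae_eq_Rplus (T1 f) (T2 f).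
Proof.
move=> B1 B2 T12 f /L2P sf.
have [M1 M10 H1] := bounded_linear_cenergy B1.
have [M2 M20 H2'] := bounded_linear_cenergy B2.
apply: cenergy_sub_eq0; [exact: (H1 f sf).1|exact: (H2' f sf).1|].
apply/eqP; rewrite eq_le cenergy_ge0 andbT; apply/lee_addgt0Pr => e e0; rewrite add0e.
(* The energy of T1 d - T2 d is at most 2 M1 + 2 M2 times that of d; the added
   1 makes C positive. *)
pose C := 2 * M1 + 2 * M2 + 1.
have C0 : 0 < C by rewrite ltr_wpDl// addr_ge0// mulr_ge0.
have [phi cphi Ephi] := Cc2_dense sf (divr_gt0 e0 C0).
have sphi := Cc2_csqint cphi; have sd := csqint_sub sf sphi.
pose d : R -> R[i] := fun x => f x - phi x.
have fE : f = (fun x => 1 * phi x + d x).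
  by apply/funext => x; rewrite /d mul1r addrC subrK.
have [_ _ L1 _] := B1; have [_ _ L2' _] := B2.
have l1 := L1 1 phi d ((L2P _).2 sphi) ((L2P _).2 sd).
have l2 := L2' 1 phi d ((L2P _).2 sphi) ((L2P _).2 sd).
rewrite -fE in l1 l2.
have [s1 b1] := H1 d sd; have [s2 b2] := H2' d sd.
have -> : cenergy (fun x => T1 f x - T2 f x) = cenergy (fun x => T1 d x - T2 d x).
  apply: ae_eq_cenergy.
  - by apply: csqint_sub; [exact: (H1 f sf).1|exact: (H2' f sf).1].
  - exact: csqint_sub.
  - apply: filterS3 l1 l2 (T12 phi cphi); first exact: (ae_filter_ringOfSetsType mu).
    move=> x h1 h2 h3 Rx; rewrite h1// h2// h3//; ring.
apply: le_trans (cenergy_sub_le s1 s2) _.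
have eE : e%:E = (C%:E * (e / C)%:E)%E by rewrite -EFinM mulrCA divff ?mulr1// gt_eqF.
rewrite eE; apply: (@le_trans _ _ (C%:E * cenergy d)%E); last first.
  by apply: lee_wpmul2l => //; rewrite lee_fin ltW.
apply: (@le_trans _ _ ((2 * M1 + 2 * M2)%:E * cenergy d)%E); last first.
  by apply: lee_wpmul2r; [exact: cenergy_ge0|rewrite lee_fin /C lerDl].
have -> : ((2 * M1 + 2 * M2)%:E * cenergy d =
    2%:E * (M1%:E * cenergy d) + 2%:E * (M2%:E * cenergy d))%E.
  by rewrite EFinD ge0_muleDl ?lee_fin ?mulr_ge0// !EFinM !muleA.
by apply: leeD; apply: lee_wpmul2l.
Qed.

End Assembly.

Section Inverse.
Context {R : realType}.
Implicit Types (f : R -> R[i]).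

Lemma chartley2K f x : L2 f -> 0 < x -> chartley2_inv (chartley2 f) x = f x.
Proof.
by move=> /L2P[sr si] x0; apply: eq_complexP; exact: hartley2K.
Qed.

Lemma chartley2_invK f x : L2 f -> 0 < x -> chartley2 (chartley2_inv f) x = f x.
Proof.
by move=> /L2P[sr si] x0; apply: eq_complexP; exact: hartley2_invK.
Qed.

Lemma chartley2_bounded_linear : L2_bounded_linear (@chartley2 R).
Proof. by apply: (complexify_bounded_linear real_operator_hartley2). Qed.

Lemma chartley2_inv_bounded_linear : L2_bounded_linear (@chartley2_inv R).
Proof. by apply: (complexify_bounded_linear real_operator_hartley2_inv). Qed.

Lemma extends_chartley2 : extends_half_hartley2 (@chartley2 R).
Proof.
split; first exact: chartley2_bounded_linear.
by move=> f cf; apply: eq_ae_Rplus => x; exact: chartley2_half_hartley.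
Qed.

Lemma L2norm_chartley2_le f : L2 f -> (L2norm (chartley2 f) <= 4%:E * L2norm f)%E.
Proof. by move=> Lf; apply: (complexify_L2norm real_operator_hartley2). Qed.

(** The lower bound is the boundedness by 1 of the inverse, applied to the
    image of f. *)
Lemma L2norm_le_chartley2 f : L2 f -> (L2norm f <= L2norm (chartley2 f))%E.
Proof.
move=> Lf; have [LH _ _ _] := chartley2_bounded_linear; have LHf := LH f Lf.
have := complexify_L2norm real_operator_hartley2_inv ler01 LHf.
rewrite mul1e; apply: le_trans.
have [mf _] := Lf; have [LI _ _ _] := chartley2_inv_bounded_linear.
have [mg _] := LI _ LHf.
rewrite -[leRHS]mul1e; apply: L2norm_le => //; rewrite expr1n mul1e /cenergy.
rewrite (eq_energy (g := re_part (chartley2_inv (chartley2 f)))) => [|x x0]; last first.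
  by rewrite /re_part chartley2K.
rewrite (eq_energy (f := im_part f) (g := im_part (chartley2_inv (chartley2 f)))) => // x x0.
by rewrite /im_part chartley2K.
Qed.

End Inverse.

Theorem theorem2 (R : realType) :
  (forall f : R -> R[i], Cc2 f ->
     hartley_defined f /\ hartley_defined (half_hartley f)) /\
  exists T : (R -> R[i]) -> (R -> R[i]),
    [/\ extends_half_hartley2 T,
        forall T' : (R -> R[i]) -> (R -> R[i]), extends_half_hartley2 T' ->
          forall f, L2 f -> ae_eq_Rplus (T' f) (T f),
        L2_invertible T &
        forall f : R -> R[i], L2 f ->
          [/\ forall x : R, 0 < x -> cintegrable (stieltjes_integrand f x),
              ae_eq_Rplus (T f) (fun x =>
                2 * f x + (2 / pi)%:C * cintegral (stieltjes_integrand f x)),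
              forall x : R, 0 < x -> cintegrable (log_integrand (T f) x),
              ae_eq_Rplus f (fun x =>
                2^-1 * T f x
                - ((pi ^+ 2)^-1)%:C * cintegral (log_integrand (T f) x)) &
              (L2norm f <= L2norm (T f))%E /\
              (L2norm (T f) <= 8%:E * L2norm f)%E]].
Proof.
split; first exact: Cc2_hartley_defined.
have [LH _ _ _] := @chartley2_bounded_linear R.
exists (@chartley2 R); split.
- exact: extends_chartley2.
- move=> T' [bT' eT']; apply: bounded_linear_ext => //; first exact: chartley2_bounded_linear.
  move=> f cf; apply: ae_eq_trans_Rplus (eT' f cf) _.
  by apply: eq_ae_Rplus => x x0; rewrite chartley2_half_hartley.
- exists (@chartley2_inv R); split; first exact: chartley2_inv_bounded_linear.
  by move=> f Lf; split; apply: eq_ae_Rplus => x; [exact: chartley2K|exact: chartley2_invK].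
- move=> f Lf; have LHf := LH f Lf; split.
  + by move=> x; apply: (kernel_integrable (@schur_stieltjes R)) => //; exact/L2P.
  + by apply: eq_ae_Rplus => x _; exact: chartley2E.
  + by move=> x; apply: (kernel_integrable (@schur_log R)) => //; exact/L2P.
  + by apply: eq_ae_Rplus => x x0; rewrite -chartley2_invE chartley2K.
  + split; first exact: L2norm_le_chartley2.
    apply: le_trans (L2norm_chartley2_le Lf) _; apply: lee_wpmul2r; first exact: Lnorm_ge0.
    by rewrite lee_fin ler_nat.
Qed.
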